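(* Let $\alpha,\beta_w^+\in(0,1)$ be constants and let $n\to\infty$ with $m=\alpha n$ and $k=\beta_w^+ n$. Let $A$ be an $m\times n$ matrix with i.i.d. standard normal entries. Fix a set $S\subset\{1,\dots,n\}$ with $|S|=k$, and consider $k$-sparse vectors $\mathbf{x}\in\mathbb{R}^n$ with $\mathbf{x}_i=0$ for $i\notin S$ whose nonzero components are a priori known to be positive. For $\mathbf{y}=A\mathbf{x}$ consider $$\min_{\mathbf{u}}\ \|\mathbf{u}\|_1\quad\text{subject to}\quad A\mathbf{u}=\mathbf{y},\ \ \mathbf{u}_i\ge 0\ (1\le i\le n).\qquad(\ast\ast)$$ Let $\epsilon_1^{(c)},\epsilon_2^{(c)},\epsilon_1^{(m)},\epsilon_1^{(g)},\epsilon_3^{(g)}>0$ be arbitrarily small constants independent of $n$. (1) Let $\hat\theta_w^+\in[\beta_w^+,1]$ be the solution of $$(1-\epsilon_1^{(c)})(1-\beta_w^+)\frac{\sqrt{\frac{1}{2\pi}}\,e^{-(\operatorname{erfinv}(2\frac{1-\theta}{1-\beta_w^+}-1))^2}}{\theta}-\sqrt{2}\operatorname{erfinv}\Big(2\frac{(1+\epsilon_1^{(c)})(1-\theta)}{1-\beta_w^+}-1\Big)=0.$$ If $$\alpha>\frac{1-\beta_w^+}{\sqrt{2\pi}}\cdot\frac{\sqrt{2(\operatorname{erfinv}(2\frac{1-\hat\theta_w^+}{1-\beta_w^+}-1))^2}}{e^{(\operatorname{erfinv}(2\frac{1-\hat\theta_w^+}{1-\beta_w^+}-1))^2}}+\hat\theta_w^+-\frac{\left((1-\beta_w^+)\sqrt{\frac{1}{2\pi}}\,e^{-(\operatorname{erfinv}(2\frac{1-\hat\theta_w^+}{1-\beta_w^+}-1))^2}\right)^2}{\hat\theta_w^+},$$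 then with overwhelming probability the solution of $(\ast\ast)$ is the positive $k$-sparse $\mathbf{x}$. (2) Let $\hat\theta_w^+\in[\beta_w^+,1]$ be the solution of $$(1+\epsilon_2^{(c)})(1-\beta_w^+)\frac{\sqrt{\frac{1}{2\pi}}\,e^{-(\operatorname{erfinv}(2\frac{1-\theta}{1-\beta_w^+}-1))^2}}{\theta}-\sqrt{2}\operatorname{erfinv}\Big(2\frac{(1-\epsilon_2^{(c)})(1-\theta)}{1-\beta_w^+}-1\Big)=0.$$ If $$\alpha<\frac{1}{(1+\epsilon_1^{(m)})^2}\left((1-\epsilon_1^{(g)})\Big(\hat\theta_w^++\frac{1-\beta_w^+}{\sqrt{2\pi}}\frac{\sqrt{2(\operatorname{erfinv}(2\frac{1-\hat\theta_w^+}{1-\beta_w^+}-1))^2}}{e^{(\operatorname{erfinv}(2\frac{1-\hat\theta_w^+}{1-\beta_w^+}-1))^2}}\Big)-(1+\epsilon_3^{(g)})^{2}\frac{\left((1-\beta_w^+)\sqrt{\frac{1}{2\pi}}\,e^{-(\operatorname{erfinv}(2\frac{1-\hat\theta_w^+}{1-\beta_w^+}-1))^2}\right)^2}{\hat\theta_w^+}\right),$$ then with overwhelming probability there is a positive $k$-sparse $\mathbf{x}$ with nonzero components located in $S$ that satisfies $A\mathbf{x}=\mathbf{y}$ and is not the solution of $(\ast\ast)$.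
   Context: $\operatorname{erfinv}$ is the inverse of the standard error function $\operatorname{erf}(t)=\frac{2}{\sqrt{\pi}}\int_0^t e^{-s^2}\,ds$. ''With overwhelming probability'' means with probability at least $1-e^{-cn}$ for some constant $c>0$ independent of $n$ (for all large $n$). ''The solution of $(\ast\ast)$ is $\mathbf{x}$'' means $\mathbf{x}$ is the unique minimizer of $(\ast\ast)$. *)

(* Defs.v *)
From HB Require Import structures.
From mathcomp Require Import all_boot all_order all_algebra.
From mathcomp Require Import all_classical all_reals all_analysis.
Set Implicit Arguments. Unset Strict Implicit. Unset Printing Implicit Defensive.
Import Order.TTheory GRing.Theory Num.Theory.
Import numFieldNormedType.Exports.
Local Open Scope classical_set_scope.
Local Open Scope ring_scope.

Section Defs.
Context {R : realType}.

Definition erf (t : R) : R :=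
  (2 / Num.sqrt pi) *
  (if 0 <= t
   then Rintegral lebesgue_measure [set s : R | 0 <= s <= t] (fun s => expR (- s ^+ 2))
   else - Rintegral lebesgue_measure [set s : R | t <= s <= 0] (fun s => expR (- s ^+ 2))).

(* erfinv y = the t with erf t = y (unique for -1 < y < 1; arbitrary otherwise) *)
Definition erfinv (y : R) : R := xget 0 [set t : R | erf t = y].

(* m = alpha n and k = beta n, rounded down to integers *)
Definition nfloor (a : R) (n : nat) : nat := Num.truncn (a * n%:R).

(* Iterated integral against the standard Gaussian N(0,1) of the first N
   coordinates of a real sequence (the remaining coordinates are set to 0):
   giter N f = E[ f(g_0,...,g_{N-1},0,0,...) ] for g_i i.i.d. N(0,1). *)
Definition scons (t : R) (g : nat -> R) : nat -> R :=
  fun i => if i is i'.+1 then g i' else t.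

Fixpoint giter (N : nat) (f : (nat -> R) -> \bar R) : \bar R :=
  match N with
  | 0 => f (fun _ => 0)
  | N'.+1 => (\int[normal_prob 0 1]_t giter N' (fun g => f (scons t g)))%E
  end.

Definition mat_of (m n : nat) (v : nat -> R) : 'M[R]_(m, n) :=
  \matrix_(i < m, j < n) v (i * n + j)%N.

Definition gauss_prob (m n : nat) (E : set 'M[R]_(m, n)) : \bar R :=
  giter (m * n) (fun v => (\1_E (mat_of m n v))%:E).

Definition l1 (n : nat) (u : 'cV[R]_n) : R := \sum_(i < n) `| u i 0 |.

Definition feasible (m n : nat) (A : 'M[R]_(m, n)) (y : 'cV[R]_m) (u : 'cV[R]_n) :=
  A *m u = y /\ forall i, 0 <= u i 0.

Definition is_solution (m n : nat) (A : 'M[R]_(m, n)) (y : 'cV[R]_m) (x : 'cV[R]_n) :=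
  feasible A y x /\ forall u, feasible A y u -> u <> x -> l1 x < l1 u.

Definition pos_supported (n : nat) (S : {set 'I_n}) (x : 'cV[R]_n) :=
  forall i, (i \in S -> 0 < x i 0) /\ (i \notin S -> x i 0 = 0).

Definition earg (c beta theta : R) : R := 2 * ((c * (1 - theta)) / (1 - beta)) - 1.

Definition solves_eq (c1 c2 beta theta : R) : Prop :=
  [/\ beta <= theta <= 1,
      -1 < earg 1 beta theta < 1,
      -1 < earg c2 beta theta < 1 &
      c1 * (1 - beta) * (Num.sqrt (1 / (2 * pi)) * expR (- (erfinv (earg 1 beta theta)) ^+ 2))
        / theta
      - Num.sqrt 2 * erfinv (earg c2 beta theta) = 0].

Definition overwhelming (alpha beta : R)
    (P : forall (n : nat) (S : {set 'I_n}), set 'M[R]_(nfloor alpha n, n)) :=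
  exists c : R, 0 < c /\ exists N : nat, forall n : nat, (N <= n)%N ->
    forall S : {set 'I_n}, #|S| = nfloor beta n ->
      ((1 - expR (- (c * n%:R)))%:E <= gauss_prob (P n S))%E.

Definition recovery_event (m n : nat) (S : {set 'I_n}) : set 'M[R]_(m, n) :=
  [set A | forall x : 'cV[R]_n, pos_supported S x -> is_solution A (A *m x) x].

Definition failure_event (m n : nat) (S : {set 'I_n}) : set 'M[R]_(m, n) :=
  [set A | exists x : 'cV[R]_n, pos_supported S x /\ ~ is_solution A (A *m x) x].

End Defs.
Arguments overwhelming {R} alpha beta P.
Arguments recovery_event {R} m {n} S _.
Arguments failure_event {R} m {n} S _.

(* Main.v *)
(** Put C = {w : w_i >= 0 off S, sum w <= 0}. Every positive x supported on S is the unique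
    minimiser iff ker A meets C only at 0, and recovery fails for some x as soon as A maps
    C onto R^m. Gordon's comparison of g0 + z.Aw with z.g + w.h (g0 a normal variable that
    equalises the variances) reduces the min-max over unit vectors z and unit w in C, or in
    the other order, to |g| against sup {w.h : w in C, |w| = 1}.

    With t = sqrt 2 * erfinv (earg 1 beta theta) one has theta = beta + (1 - beta) Q(t), where Q
    is the Gaussian tail, and s = (1 - beta) gpdf t / theta is a Lagrange multiplier for the
    constraint sum w <= 0. Up to the epsilons both thresholds are
    F = theta + t s theta - s^2 theta, the mean per coordinate of (h - s)^2 on S and
    (h - s)^2 1_{h > t} off S. In part (1) the perturbed equation forces
    t < s, so the truncated h - s dominates w.h on C; in part (2) it forces s < t, so the
    truncated h - s' with s' slightly above s lies in C and is an explicit test direction.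
    The sums of functions of g and h concentrate by Chernoff bounds.

    Comparison is proved by Lindeberg replacement for the smooth function
    prod_i (1 - prod_j tau (x_ij)), a surrogate of the event that each row i has some x_ij >= c. *)
Require Import Defs.
From HB Require Import structures.
From mathcomp Require Import all_boot all_order all_algebra.
From mathcomp Require Import all_classical all_reals all_analysis.
From mathcomp Require Import measurable_realfun ring lra.
Set Implicit Arguments. Unset Strict Implicit. Unset Printing Implicit Defensive.
Import Order.TTheory GRing.Theory Num.Theory.
Import numFieldNormedType.Exports.
Local Open Scope classical_set_scope.
Local Open Scope ring_scope.

(** * The standard Gaussian law on the line: density, expectation, exponential moments *)

Section standard_gaussian.
Context {R : realType}.
Implicit Types (f g : R -> R) (x t a b c : R).
Local Notation mu := (@lebesgue_measure R).
Local Notation gam := (normal_prob (0 : R) 1).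

(** [giter] integrates an indicator that is not known to be measurable, so it is monotone but not
    known to be additive, and only lower bounds for it are accessible. Hence the estimates concern
    real functions all of whose partial integrals converge ([SI]), and a bad event is never
    measured: it is replaced by a nonnegative function of small mean that is at least 1 on it. Only
    in [gordon_event] does an integrable minorant of the indicator enter [giter].

    The comparison runs over finite nets of the spheres at fixed n. No union bound is paid: the
    sizes of the nets enter only through the steepness of the logistic [tau], which can be taken as
    large as desired because Gordon's inequality has no error term. The price of the auxiliary
    normal g0 is an event of probability at most e^(-kap^2/2), harmless since kap is of order sqrt
    n.

    Lindeberg replacement asks of the Gaussians only stability under sums and moments up to order
    three, so neither a density in dimension mn nor integration by parts occurs. Lipschitz bounds
    justify the exchanges of iterated integrals. *)

Definition gpdf (x : R) : R := normal_pdf 0 1 x.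

Lemma gpdf_ge0 x : 0 <= gpdf x.
Proof. exact: normal_pdf_ge0. Qed.

Lemma gpdfE x : gpdf x = (Num.sqrt (2 * pi))^-1 * expR (- x ^+ 2 / 2).
Proof.
rewrite /gpdf normal_pdfE ?oner_neq0// /normal_peak /normal_fun.
by rewrite expr1n mul1r subr0 mulr_natl.
Qed.

Lemma measurable_gpdf : measurable_fun setT gpdf.
Proof. exact: measurable_normal_pdf. Qed.

Lemma continuous_gpdf : continuous gpdf.
Proof. by apply: continuous_normal_pdf; exact: oner_neq0. Qed.

Import HBNNSimple.

Let integral_gam_indic (E : set (measurableTypeR R)) : measurable E ->
  (\int[gam]_x (\1_E x)%:E = \int[mu]_x ((\1_E x)%:E * (gpdf x)%:E))%E.
Proof.
move=> mE; rewrite integral_indic//= /normal_prob setIT.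
rewrite [LHS]integral_mkcond/=; apply: eq_integral => x _.
by rewrite patchE indicE; case: ifPn => xE; rewrite ?mul1e ?mul0e.
Qed.

Let integral_gam_nnsfun (f : {nnsfun _ >-> R}) :
  (\int[gam]_x (f x)%:E = \int[mu]_x ((f x)%:E * (gpdf x)%:E))%E.
Proof.
under [LHS]eq_integral do rewrite fimfunE -fsumEFin//.
rewrite [LHS]ge0_integral_fsum//; last 2 first.
  - by move=> r; exact/measurable_EFinP/measurableT_comp.
  - by move=> n x _; rewrite EFinM nnfun_muleindic_ge0.
under [RHS]eq_integral.
  move=> x xD; rewrite fimfunE -fsumEFin// muleC ge0_mule_fsumr; last first.
    by move=> r; rewrite EFinM nnfun_muleindic_ge0.
  over.
rewrite [RHS]ge0_integral_fsum//; last 2 first.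
  - move=> r; apply: emeasurable_funM.
      by apply/measurable_EFinP; exact: measurable_gpdf.
    exact/measurable_EFinP/measurableT_comp.
  - move=> n x _; rewrite mule_ge0//; first by rewrite lee_fin gpdf_ge0.
    by rewrite EFinM nnfun_muleindic_ge0.
apply: eq_fsbigr => r _.
under [RHS]eq_integral do rewrite EFinM muleCA.
have [r0|r0] := leP 0 r; last first.
  rewrite preimage_nnfun0// indic0.
  by rewrite !integral0_eq// => x _ /=; rewrite ?mulr0 ?mule0.
rewrite [RHS]ge0_integralZl//; last 2 first.
  - apply: emeasurable_funM.
      by apply/measurable_EFinP; exact: measurable_gpdf.
    exact/measurable_EFinP/measurable_indic.
  - by move=> x _; rewrite mule_ge0 ?lee_fin ?gpdf_ge0.
under eq_integral do rewrite EFinM.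
rewrite ge0_integralZl//; last first.
  exact/measurable_EFinP/measurable_indic.
congr (_ * _)%E; rewrite integral_gam_indic//.
by apply: eq_integral => x _; rewrite muleC.
Qed.

(** [normal_prob] is defined through its density, so the formula is immediate on indicators; it
    passes to simple functions by linearity and to nonnegative measurable functions by monotone
    convergence. *)
Lemma ge0_integral_gam (f : measurableTypeR R -> \bar R) :
  measurable_fun setT f -> (forall x, 0 <= f x)%E ->
  (\int[gam]_x f x = \int[mu]_x (f x * (gpdf x)%:E))%E.
Proof.
move=> mf f0.
pose f_ := nnsfun_approx measurableT mf.
have mf_ n : measurable_fun [set: measurableTypeR R] (fun x => (f_ n x)%:E * (gpdf x)%:E)%E.
  by apply: emeasurable_funM; apply/measurable_EFinP => //; exact: measurable_gpdf.
transitivity (lim (\int[gam]_x (f_ n x)%:E @[n --> \oo])%E).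
  rewrite -monotone_convergence//=.
  - apply: eq_integral => ? /[!inE] xD; apply/esym/cvg_lim => //=.
    exact: cvg_nnsfun_approx.
  - by move=> n; exact/measurable_EFinP/measurable_funTS.
  - by move=> n ? _; rewrite lee_fin.
  - by move=> ? _ ? ? mn; rewrite lee_fin; exact/lefP/nd_nnsfun_approx.
transitivity (lim (\int[mu]_x ((f_ n x)%:E * (gpdf x)%:E)%E @[n --> \oo])%E).
  by apply: congr_lim; apply/funext => n /=; exact: integral_gam_nnsfun.
rewrite -monotone_convergence//=.
- apply: eq_integral => x /[!inE] xD; apply/cvg_lim => //=.
  apply: cvgeZr => //.
  exact: cvg_nnsfun_approx.
- by move=> n x _; rewrite mule_ge0 ?lee_fin ?gpdf_ge0.
- move=> x _ m n mn; rewrite lee_wpmul2r ?lee_fin ?gpdf_ge0//.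
  exact/lefP/nd_nnsfun_approx.
Qed.

Lemma ge0_integral_gamR (f : R -> R) :
  measurable_fun setT f -> (forall x, 0 <= f x) ->
  (\int[gam]_x (f x)%:E = \int[mu]_x (f x * gpdf x)%:E)%E.
Proof.
move=> mf f0; rewrite ge0_integral_gam//; last by apply/measurable_EFinP.
Qed.

Lemma mgf_gam a : (\int[gam]_x (expR (a * x))%:E = (expR (a ^+ 2 / 2))%:E)%E.
Proof.
rewrite ge0_integral_gamR; last 2 first.
  - by apply: measurableT_comp => //; exact: measurable_funM.
  - by move=> x; exact: expR_ge0.
(* Completing the square: e^(ax) times the density is e^(a^2/2) times the normal density of mean
   a. *)
transitivity (\int[mu]_x ((expR (a ^+ 2 / 2))%:E * (normal_pdf a 1 x)%:E))%E.
  apply: eq_integral => x _; rewrite -EFinM; congr EFin.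
  rewrite gpdfE normal_pdfE ?oner_neq0// /normal_peak /normal_fun.
  rewrite expr1n mul1r -(mulr_natl pi) mulrCA [RHS]mulrCA; congr (_ * _).
  by rewrite -!expRD; congr expR; field.
rewrite ge0_integralZl//; last 2 first.
- by apply/measurable_EFinP; exact: measurable_normal_pdf.
- by move=> x _; rewrite lee_fin normal_pdf_ge0.
by rewrite integral_normal_pdf mule1.
Qed.

Definition gint f := gam.-integrable setT (EFin \o f).
Definition gE f : R := Rintegral gam setT f.

Lemma le_gint f g : measurable_fun setT f -> (forall x, `|f x| <= g x) ->
  gint g -> gint f.
Proof.
move=> mf fg ig; apply: (@le_integrable _ (measurableTypeR R) R gam setT measurableT _ (EFin \o g)).
- by apply/measurable_EFinP.
- by move=> x _; rewrite /= lee_fin (le_trans (fg x))// ler_norm.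
- exact: ig.
Qed.

Lemma measurable_gint f : gint f -> measurable_fun setT f.
Proof. by move=> /measurable_int fi; exact/measurable_EFinP. Qed.

Lemma gint_cst c : gint (fun=> c).
Proof. by apply: finite_measure_integrable_cst. Qed.

Lemma gintD f g : gint f -> gint g -> gint (fun x => f x + g x).
Proof. by move=> fi gi; exact: (integrableD measurableT fi gi). Qed.

Lemma gintZ c f : gint f -> gint (fun x => c * f x).
Proof. by move=> fi; exact: (integrableZl measurableT c fi). Qed.

Lemma gint_norm f : gint f -> gint (fun x => `|f x|).
Proof. by move=> fi; exact: (integrable_norm fi). Qed.

Lemma gE_EFin f : gint f -> (\int[gam]_x (f x)%:E = (gE f)%:E)%E.
Proof. by move=> fi; rewrite /gE /Rintegral fineK//; exact: integrable_fin_num. Qed.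

Lemma gE_cst c : gE (fun=> c) = c.
Proof. by rewrite /gE Rintegral_cst// [X in fine X](@probability_setT _ _ _ gam) mulr1. Qed.

Lemma gED f g : gint f -> gint g -> gE (fun x => f x + g x) = gE f + gE g.
Proof. by move=> fi gi; exact: (RintegralD measurableT fi gi). Qed.

Lemma gEZ c f : gint f -> gE (fun x => c * f x) = c * gE f.
Proof. by move=> fi; exact: (RintegralZl c measurableT fi). Qed.

Lemma le_gE f g : gint f -> gint g -> (forall x, f x <= g x) -> gE f <= gE g.
Proof. by move=> fi gi fg; apply: (le_Rintegral measurableT fi gi) => x _; exact: fg. Qed.

Lemma eq_gE f g : f =1 g -> gE f = gE g.
Proof. by move=> fg; congr gE; apply/funext. Qed.

Lemma eq_gint f g : f =1 g -> gint f -> gint g.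
Proof. by move=> /funext ->. Qed.

Lemma ge0_gint f (l : R) : measurable_fun setT f -> (forall x, 0 <= f x) ->
  (\int[gam]_x (f x)%:E = l%:E)%E -> gint f /\ gE f = l.
Proof.
move=> mf f0 fl; split; last by rewrite /gE /Rintegral fl.
apply/integrableP; split; first by apply/measurable_EFinP.
under eq_integral do rewrite /= ger0_norm//.
by rewrite fl ltry.
Qed.

Lemma gint_expR a : gint (fun x => expR (a * x)).
Proof.
apply: (ge0_gint _ _ (mgf_gam a)).1 => [|x]; last exact: expR_ge0.
by apply: measurableT_comp => //; exact: measurable_funM.
Qed.

Lemma gE_expR a : gE (fun x => expR (a * x)) = expR (a ^+ 2 / 2).
Proof. by rewrite /gE /Rintegral mgf_gam. Qed.

Lemma gint_expR_norm a : gint (fun x => expR (a * `|x|)).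
Proof.
apply: (@le_gint _ (fun x => expR (a * x) + expR ((- a) * x))).
- by apply: measurableT_comp => //; apply: measurable_funM.
- move=> x; rewrite ger0_norm ?expR_ge0//.
  have [x0|x0] := ger0P x; first by rewrite lerDl expR_ge0.
  by rewrite mulrN mulNr lerDr expR_ge0.
- by apply: gintD; exact: gint_expR.
Qed.

(** Times the density, e^(x^2/4) is sqrt 2 times the normal density of variance 2. Any factor below
    1/2 would be integrable; 1/4 leaves room for exponentials of quadratic functions in the Chernoff
    bound. *)
Lemma gint_sqrexp : gint (fun x => expR (x ^+ 2 / 4)).
Proof.
have mE : measurable_fun setT (fun x : R => expR (x ^+ 2 / 4)).
  by apply: measurableT_comp => //; apply: measurable_funM => //; exact: measurable_funX.
apply: (@ge0_gint _ (Num.sqrt 2) mE (fun x => expR_ge0 _) _).1.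
rewrite ge0_integral_gamR//.
have s2 : Num.sqrt 2 != 0 :> R by rewrite gt_eqF// sqrtr_gt0.
rewrite (_ : \int[mu]_x _ = \int[mu]_x ((Num.sqrt 2)%:E * (normal_pdf 0 (Num.sqrt 2) x)%:E))%E.
  rewrite ge0_integralZl//; last 2 first.
  - by apply/measurable_EFinP; exact: measurable_normal_pdf.
  - by move=> x _; rewrite lee_fin normal_pdf_ge0.
  by rewrite integral_normal_pdf mule1.
apply: eq_integral => x _; rewrite -EFinM; congr EFin.
rewrite gpdfE normal_pdfE// /normal_peak /normal_fun sqr_sqrtr//.
rewrite mulrCA -expRD mulrA.
have -> : Num.sqrt 2 / Num.sqrt (2 * pi *+ 2) = (Num.sqrt (2 * pi))^-1 :> R.
  by rewrite -(mulr_natl (2 * pi) 2) [X in _ / X]sqrtrM// invfM mulrA divff// mul1r.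
by congr (_ * expR _); rewrite subr0 mulr2n; field.
Qed.

Lemma gint_le_sqrexp f C : measurable_fun setT f ->
  (forall x, `|f x| <= C * expR (x ^+ 2 / 4)) -> gint f.
Proof. by move=> mf fC; apply: (le_gint mf fC); apply: gintZ; exact: gint_sqrexp. Qed.

Lemma gint_le_exp f C D : measurable_fun setT f ->
  (forall x, `|f x| <= C * expR (D * `|x|)) -> gint f.
Proof. by move=> mf fC; apply: (le_gint mf fC); apply: gintZ; exact: gint_expR_norm. Qed.

Lemma ge0_gE_opp f : (forall x, 0 <= f x) -> gint f ->
  gint (fun x => f (- x)) /\ gE (fun x => f (- x)) = gE f.
Proof.
move=> f0 fi; have mf := measurable_gint fi.
have mfN : measurable_fun setT (fun x => f (- x)) by exact: measurableT_comp.
apply: ge0_gint => //; rewrite -gE_EFin// !ge0_integral_gamR//.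
rewrite [RHS](@eq_measure_integral _ _ _ _ (pushforward mu (-%R : _ -> measurableTypeR R))); last first.
  by move=> A mA _ /=; exact/esym/lebesgue_measureN.
rewrite ge0_integral_pushforward; last 4 first.
- exact: oppr_measurable.
- exact: measurableT.
- by apply/measurable_EFinP; apply: measurable_funM => //; exact: measurable_gpdf.
- by move=> x _; rewrite lee_fin mulr_ge0// gpdf_ge0.
apply: eq_integral => x _ /=; rewrite !gpdfE; congr (_ * (_ * expR _))%:E.
by rewrite sqrrN.
Qed.

(** Positive and negative parts are each covered by [ge0_integral_gam]; integrability against
    Lebesgue measure makes their difference meaningful. *)
Lemma gE_pdf f l : measurable_fun setT f ->
  mu.-integrable setT (fun x => (f x * gpdf x)%:E) ->
  (\int[mu]_x (f x * gpdf x)%:E = l%:E)%E -> gint f /\ gE f = l.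
Proof.
move=> mf fi fl.
have fi' : gint f.
  apply/integrableP; split; first by apply/measurable_EFinP.
  rewrite (ge0_integral_gamR (f := fun x => `|f x|))//; last exact: measurableT_comp.
  have /integrableP[_] := fi.
  by under eq_integral do rewrite abse_EFin normrM (ger0_norm (gpdf_ge0 _)).
split => //; apply: EFin_inj; rewrite -gE_EFin// -fl.
rewrite integralE [RHS]integralE; congr (_ - _)%E.
- rewrite ge0_integral_gam//; last first.
    apply: measurable_funepos; by apply/measurable_EFinP.
  apply: eq_integral => x _ /=; rewrite !funeposE -!EFin_max -EFinM.
  by rewrite maxr_pMl ?gpdf_ge0// mul0r.
- rewrite ge0_integral_gam//; last first.
    apply: measurable_funeneg; by apply/measurable_EFinP.
  apply: eq_integral => x _ /=; rewrite !funenegE -!EFinN -!EFin_max -EFinM.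
  by rewrite maxr_pMl ?gpdf_ge0// mul0r mulNr.
Qed.

End standard_gaussian.

(** * The Gaussian tail and its first two truncated moments *)

Section gaussian_tail_moments.
Context {R : realType}.
Implicit Types (f g : R -> R) (x t a b c : R).
Local Notation mu := (@lebesgue_measure R).

(** The fundamental theorem on a half-line asks for an integrand of constant sign, whereas those
    used below may change sign near [t]. The split at [T] leaves a compact interval, where
    continuity suffices, and a tail on which [f] is nonnegative. *)
Lemma tail_FTC f (F : R -> R) t T (l : R) : continuous f ->
  (forall x, is_derive x 1 F (f x)) -> F x @[x --> +oo] --> l -> t < T ->
  (forall x, T <= x -> 0 <= f x) ->
  mu.-integrable `[t, +oo[ (EFin \o f) /\
  (\int[mu]_(x in `[t, +oo[) (f x)%:E = (l - F t)%:E)%E.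
Proof.
move=> cf dF Fl tT f0.
have mf : measurable_fun setT f by exact: continuous_measurable_fun.
have cF : continuous F.
  by move=> x; apply: differentiable_continuous; apply/derivable1_diffP; case: (dF x).
have F'E x : derive1 F x = f x by rewrite derive1E; exact: (@derive_val _ _ _ _ _ _ _ (dF x)).
have dFx x : derivable F x 1 by case: (dF x).
have tTE : `[t, +oo[%classic = `[t, T] `|` `]T, +oo[ :> set (measurableTypeR R).
  by apply: itv_bndbnd_setU; rewrite bnd_simp// ltW.
have dis : [disjoint (`[t, T]%classic : set (measurableTypeR R)) & `]T, +oo[%classic].
  rewrite disj_set2E; apply/eqP; rewrite -subset0 => x []/= /[!in_itv]/=.
  by move=> /andP[_ xT] /andP[]; rewrite ltNge xT.
have I1 : (\int[mu]_(x in `[t, T]) (f x)%:E = (F T)%:E - (F t)%:E)%E.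
  apply: continuous_FTC2 => //.
  - exact: continuous_subspaceT.
  - by split => //; [exact/cvg_at_right_filter/cF|exact/cvg_at_left_filter/cF].
have I2 : (\int[mu]_(x in `]T, +oo[) (f x)%:E = l%:E - (F T)%:E)%E.
  rewrite integral_itv_obnd_cbnd; last first.
    by apply/measurable_EFinP; apply: measurable_funTS.
  apply: ge0_continuous_FTC2y => //.
  - exact: continuous_subspaceT.
  - exact/cvg_at_right_filter/cF.
have mfE (A : set (measurableTypeR R)) : measurable_fun A (fun x => (f x)%:E).
  by apply/measurable_EFinP; apply: measurable_funTS.
split; last first.
  rewrite tTE integral_setU//; rewrite I1 I2 -!EFinB -EFinD; congr EFin; ring.
apply/integrableP; split; first exact: mfE.
rewrite tTE ge0_integral_setU//; last first.
- by apply: measurableT_comp => //; exact: mfE.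
rewrite lte_add_pinfty//.
- have /integrableP[] : mu.-integrable `[t, T] (EFin \o f); last by [].
  apply: continuous_compact_integrable; first exact: segment_compact.
  exact: continuous_subspaceT.
- rewrite [ltLHS](_ : _ = \int[mu]_(x in `]T, +oo[) (f x)%:E)%E; first by rewrite I2 ltry.
  apply: eq_integral => x; rewrite inE/= in_itv/= andbT => /ltW xT.
  by rewrite ger0_norm// f0.
Qed.

Definition step t x : R := if t < x then 1 else 0.

Lemma step_ge0 t x : 0 <= step t x.
Proof. by rewrite /step; case: ifP. Qed.

Lemma step_le1 t x : step t x <= 1.
Proof. by rewrite /step; case: ifP. Qed.

Lemma measurable_step t : measurable_fun setT (step t).
Proof.
rewrite (_ : step t = \1_(`]t, +oo[%classic)); first exact: measurable_indic.
apply/funext => x; rewrite /step indicE; case: ifPn => tx.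
  by rewrite mem_set//= in_itv/= tx.
by rewrite memNset//= in_itv/= (negbTE tx).
Qed.

Lemma tail_gE (p : R -> R) (F : R -> R) t T (l : R) : continuous p ->
  (forall x, is_derive x 1 F (p x * gpdf x)) -> F x @[x --> +oo] --> l -> t < T ->
  (forall x, T <= x -> 0 <= p x) ->
  gint (fun x => step t x * p x) /\ gE (fun x => step t x * p x) = l - F t.
Proof.
move=> cp dF Fl tT p0.
have cf : continuous (fun x => p x * gpdf x).
  by move=> x; apply: cvgM; [exact: cp|exact: continuous_gpdf].
have f0 x : T <= x -> 0 <= p x * gpdf x by move=> /p0 px; rewrite mulr_ge0// gpdf_ge0.
have [fi fE] := @tail_FTC (fun x => p x * gpdf x) F t T l cf dF Fl tT f0.
have E : (fun x : measurableTypeR R => (step t x * p x * gpdf x)%:E) =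
     (fun x => (p x * gpdf x)%:E) \_ `]t, +oo[.
  apply/funext => x; rewrite patchE /step; have [tx|xt] := ltP t x.
    by rewrite mem_set ?mul1r//= in_itv/= tx.
  by rewrite memNset ?mul0r//= in_itv/= andbT; apply/negP; rewrite -leNgt.
apply: gE_pdf.
- apply: measurable_funM; [exact: measurable_step|exact: continuous_measurable_fun].
- rewrite E; apply/(integrable_mkcond _ _).1 => //.
  by apply: integrableS fi => // x/=; rewrite !in_itv/= !andbT => /ltW.
- rewrite E -integral_mkcond integral_itv_obnd_cbnd//.
  apply/measurable_EFinP; apply: measurable_funTS; exact: continuous_measurable_fun.
Qed.

Lemma is_derive_gpdf x : is_derive x 1 (fun y => - gpdf y) (x * gpdf x).
Proof.
rewrite (_ : (fun y => _) = (fun y => - ((Num.sqrt (2 * pi))^-1 * expR (- y ^+ 2 / 2)))); last first.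
  by apply/funext => y; rewrite gpdfE.
apply: is_derive_eq; rewrite gpdfE.
rewrite /GRing.scale/=; field.
by rewrite gt_eqF// sqrtr_gt0 mulr_gt0// pi_gt0.
Qed.

Lemma is_derive_xgpdf x : is_derive x 1 (fun y => - (y * gpdf y)) ((x ^+ 2 - 1) * gpdf x).
Proof.
rewrite (_ : (fun y => _) = (fun y => - (y * ((Num.sqrt (2 * pi))^-1 * expR (- y ^+ 2 / 2))))); last first.
  by apply/funext => y; rewrite gpdfE.
apply: is_derive_eq; rewrite gpdfE.
rewrite /GRing.scale/=; field.
by rewrite gt_eqF// sqrtr_gt0 mulr_gt0// pi_gt0.
Qed.

(** Since e^y >= y at y = x^2/2, the product is at most a constant times 2/x. *)
Lemma cvg_xgpdf : x * gpdf x @[x --> +oo] --> (0 : R).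
Proof.
apply: (@squeeze_cvgr _ _ _ _ (fun=> 0) (fun x => (Num.sqrt (2 * pi))^-1 * (2 * x^-1))).
- near=> x; have x0 : 0 < x by near: x; exact: nbhs_pinfty_gt.
  rewrite mulr_ge0 ?gpdf_ge0 ?(ltW x0)//= gpdfE mulrCA ler_wpM2l// ?invr_ge0 ?sqrtr_ge0//.
  rewrite mulNr expRN ler_pdivrMr ?expR_gt0//.
  apply: (@le_trans _ _ (2 * x^-1 * (x ^+ 2 / 2))).
    by rewrite le_eqVlt; apply/orP; left; apply/eqP; field; rewrite gt_eqF.
  rewrite ler_wpM2l// ?mulr_ge0 ?invr_ge0 ?(ltW x0)//.
  by apply: le_trans (expR_ge1Dx _); rewrite lerDr.
- exact: cvg_cst.
- rewrite -[X in _ --> X](mulr0 (Num.sqrt (2 * pi))^-1); apply: cvgMr.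
  rewrite -[X in _ --> X](mulr0 2); apply: cvgMr.
  apply/gtr0_cvgV0; last exact: cvg_id.
  exact: nbhs_pinfty_gt.
Unshelve. all: by end_near. Qed.

Lemma cvg_gpdf : gpdf x @[x --> +oo] --> (0 : R).
Proof.
apply: (@squeeze_cvgr _ _ _ _ (fun=> 0) (fun x => x * gpdf x)).
- near=> x; have x1 : 1 <= x by near: x; apply: nbhs_pinfty_ge.
  by rewrite gpdf_ge0/= ler_peMl// gpdf_ge0.
- exact: cvg_cst.
- exact: cvg_xgpdf.
Unshelve. all: by end_near. Qed.

Definition gQ t := gE (step t).

Lemma gint_step t : gint (step t).
Proof.
apply: (@le_gint _ _ (fun=> 1)); [exact: measurable_step| |exact: gint_cst].
by move=> x; rewrite ger0_norm ?step_ge0 ?step_le1.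
Qed.

Lemma tail_moment1 t :
  gint (fun x => step t x * x) /\ gE (fun x => step t x * x) = gpdf t.
Proof.
have [|||||fi fE] := @tail_gE id (fun y => - gpdf y) t (Num.max t 0 + 1) 0.
- by move=> x; exact: cvg_id.
- exact: is_derive_gpdf.
- by rewrite -oppr0; apply: cvgN; exact: cvg_gpdf.
- by rewrite ltr_pwDr// le_max lexx.
- by move=> x; apply: le_trans; rewrite addr_ge0// le_max lexx orbT.
- by split => //; rewrite fE sub0r opprK.
Qed.

(** The antiderivative in closed form is that of (x^2 - 1) times the density, namely -x times the
    density; the tail mass [gQ t] is then added back. *)
Lemma tail_moment2 t : gint (fun x => step t x * x ^+ 2) /\
  gE (fun x => step t x * x ^+ 2) = gQ t + t * gpdf t.
Proof.
have [|||||fi fE] := @tail_gE (fun x => x ^+ 2 - 1) (fun y => - (y * gpdf y)) t (Num.max t 0 + 1) 0.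
- by move=> x; apply: cvgB; [exact: exprn_continuous|exact: cvg_cst].
- exact: is_derive_xgpdf.
- by rewrite -oppr0; apply: cvgN; exact: cvg_xgpdf.
- by rewrite ltr_pwDr// le_max lexx.
- move=> x /(le_trans _) x1; rewrite subr_ge0 -[leLHS](expr1n _ 2).
  have {}x1 : 1 <= x by apply: x1; rewrite lerDr le_max lexx orbT.
  by rewrite lerXn2r// nnegrE// (le_trans ler01).
have E : (fun x => step t x * x ^+ 2) = (fun x => step t x * (x ^+ 2 - 1) + step t x).
  by apply/funext => x; ring.
rewrite E; split; first by apply: gintD => //; exact: gint_step.
by rewrite gED//; [rewrite fE sub0r opprK addrC|exact: gint_step].
Qed.

(** The tail lemmas are one-sided, so the line is cut at 0 and its left half reflected. *)
Lemma gE_id : gint (fun x : R => x) /\ gE (fun x : R => x) = 0.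
Proof.
have [i1 E1] := tail_moment1 0.
have s0 x : 0 <= step 0 x * x.
  by rewrite /step; case: ifPn => [/ltW ?|]; rewrite ?mul1r ?mul0r.
have [i2 E2] := ge0_gE_opp s0 i1.
have E : (fun x : R => x) = (fun x => step 0 x * x + (-1) * (step 0 (- x) * (- x))).
  by apply/funext => x /=; rewrite /step oppr_gt0; case: ltrgtP => [x0|x0|<-]; ring.
rewrite [X in gint X /\ gE X = _]E; split.
  by apply: gintD => //; exact: gintZ.
by rewrite gED//; [rewrite gEZ// E2; ring|exact: gintZ].
Qed.

(** The two open half-lines have equal mass and the origin has none. *)
Lemma gQ0 : gQ 0 = 2^-1.
Proof.
have [i3 E3] := ge0_gE_opp (step_ge0 0) (gint_step 0).
have mi0 : measurable_fun setT (\1_[set (0 : R)] : R -> R).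
  by apply: measurable_indic; exact: measurable_set1.
have [i0 I0] : gint (\1_[set (0 : R)] : R -> R) /\ gE (\1_[set 0] : R -> R) = 0.
  apply: ge0_gint => //; rewrite integral_indic//= setIT.
  exact: integral_set1.
suff : gQ 0 + gQ 0 = 1 by lra.
rewrite {2}/gQ -E3 -gED//; last exact: gint_step.
have -> : (fun x => step 0 x + step 0 (- x)) = (fun x => 1 + (-1) * \1_[set 0] x) :> (R -> R).
  apply/funext => x; rewrite indicE /step oppr_gt0.
  have [->|x0] := eqVneq x 0; first by rewrite ltxx mem_set//= addr0; ring.
  rewrite memNset/=; last exact/eqP.
  by case: ltrgtP x0 => [_|_|->]; rewrite ?eqxx// => _; ring.
by rewrite gED; [rewrite gE_cst gEZ// I0; ring|exact: gint_cst|exact: gintZ].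
Qed.

Lemma gE_sqr : gint (fun x : R => x ^+ 2) /\ gE (fun x : R => x ^+ 2) = 1.
Proof.
have [i1 E1] := tail_moment2 0.
have s0 x : 0 <= step 0 x * x ^+ 2 by rewrite mulr_ge0 ?step_ge0 ?sqr_ge0.
have [i2 E2] := ge0_gE_opp s0 i1.
have E : (fun x : R => x ^+ 2) = (fun x => step 0 x * x ^+ 2 + (step 0 (- x) * (- x) ^+ 2)).
  by apply/funext => x /=; rewrite /step oppr_gt0; case: ltrgtP => [x0|x0|<-]; ring.
rewrite [X in gint X /\ gE X = _]E; split; first exact: gintD.
by rewrite gED// E2 E1 mul0r addr0 gQ0; lra.
Qed.

End gaussian_tail_moments.

(** * Fubini in the plane and rotation invariance of the Gaussian *)

Section gaussian_fubini.
Context {R : realType}.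
Implicit Types (f g : R -> R) (x t a b c : R).
Local Notation mu := (@lebesgue_measure R).
Local Notation gam := (normal_prob (0 : R) 1).
Local Notation RM := (measurableTypeR R).

(* Discretise the continuous variable. *)
Lemma measurable_caratheodory (F : R -> R -> R) :
  (forall y, continuous (F ^~ y)) -> (forall x, measurable_fun setT (F x)) ->
  measurable_fun [set: RM * RM] (fun p => F p.1 p.2).
Proof.
move=> cF mF.
pose q (n : nat) (x : R) : R := (Num.floor (n.+1%:R * x))%:~R / n.+1%:R.
apply: (@measurable_fun_cvg _ _ _ _ (fun n p => F (q n p.1) p.2)).
- move=> n _ B mB; rewrite setTI.
  pose I (k : int) : set RM := `[k%:~R / n.+1%:R, (k + 1)%:~R / n.+1%:R[%classic.
  rewrite (_ : _ @^-1` B = \bigcup_(k : int) (I k `*` (F (k%:~R / n.+1%:R) @^-1` B))).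
    apply: countable_bigcupT_measurable; first exact: countableP.
    move=> k; apply: measurableX; first exact: measurable_itv.
    by rewrite -[X in measurable X]setTI; exact: mF.
  apply/seteqP; split => [[x y] /= Bxy|[x y] [k _ [/=]]].
    exists (Num.floor (n.+1%:R * x)) => //; split => //=.
    rewrite /I/= in_itv/= ler_pdivrMr// ltr_pdivlMr// mulrC ge_floor/=.
    exact: floorD1_gt.
  rewrite /I/= in_itv/= ler_pdivrMr// ltr_pdivlMr// => kx.
  rewrite /q (_ : Num.floor _ = k)//; apply: floor_def.
  by rewrite mulrC.
- move=> [x y] _ /=.
  apply: (cvg_comp (q ^~ x) (F ^~ y)); last exact: cF.
  apply: (@squeeze_cvgr _ _ _ _ (fun n => x - n.+1%:R^-1) (fun=> x)).
  + near=> n; rewrite /q ler_pdivlMr// mulrBl mulVf// lerBlDr ler_pdivrMr//.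
    rewrite [x * _]mulrC ge_floor andbT.
    by have := floorD1_gt (n.+1%:R * x); rewrite intrD => /ltW.
  + rewrite -[X in _ --> X]subr0; apply: cvgB; first exact: cvg_cst.
    exact: cvg_harmonic.
  + exact: cvg_cst.
Unshelve. all: by end_near. Qed.

Lemma gE_swap (F : R -> R -> R) C D :
  (forall y, continuous (F ^~ y)) -> (forall x, measurable_fun setT (F x)) ->
  (forall x y, `|F x y| <= C * expR (D * `|x|) * expR (D * `|y|)) ->
  gE (fun x => gE (F x)) = gE (fun y => gE (F ^~ y)).
Proof.
move=> cF mF FC; have mFF := measurable_caratheodory cF mF.
have iy x : gint (F x) by apply: (@gint_le_exp _ _ (C * expR (D * `|x|)) D) => // y; exact: FC.
have ix y : gint (F ^~ y).
  apply: (@gint_le_exp _ _ (C * expR (D * `|y|)) D) => [|x].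
    by apply: continuous_measurable_fun; exact: cF.
  by rewrite mulrAC; exact: FC.
have iF : (gam \x gam)%E.-integrable setT (fun p : RM * RM => (F p.1 p.2)%:E).
  apply/integrable12ltyP; first by apply/measurable_EFinP.
  apply: (@le_lt_trans _ _ (\int[gam]_x (C * gE (fun y => expR (D * `|y|)) * expR (D * `|x|))%:E)%E).
    apply: ge0_le_integral => //.
    - by move=> x _; exact: integral_ge0.
    - apply: (@measurable_fun_fubini_tonelli_F _ _ RM RM R gam (fun p => `|(F p.1 p.2)%:E|%E)) => //.
      by apply: measurableT_comp => //; apply/measurable_EFinP.
    - by apply/measurable_EFinP; apply: measurable_funM => //; apply: measurableT_comp => //; exact: measurable_funM.
    - move=> x _ /=.
      rewrite (gE_EFin (gint_norm (iy x))) lee_fin.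
      rewrite mulrAC -gEZ; last exact: gint_expR_norm.
      apply: le_gE; [exact: gint_norm|apply: gintZ; exact: gint_expR_norm|].
      by move=> y; exact: FC.
  rewrite gE_EFin ?ltry//; apply: gintZ; exact: gint_expR_norm.
have := Fubini iF.
under eq_integral do rewrite (gE_EFin (iy _)).
under [X in _ = X -> _]eq_integral do rewrite (gE_EFin (ix _)).
by rewrite /gE /Rintegral => ->.
Qed.

Lemma gpdf_affine a t (s : R) : 0 < a ->
  a * normal_pdf t a (a * s + t) = gpdf s.
Proof.
move=> a0; rewrite gpdfE normal_pdfE ?gt_eqF// /normal_peak /normal_fun.
rewrite -[_ *+ 2]mulr_natr -mulrA sqrtrM ?sqr_ge0// sqrtr_sqr (gtr0_norm a0).
rewrite invfM !mulrA divff ?gt_eqF// mul1r (mulrC pi); congr (_ * expR _).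
by rewrite addrK -mulr_natr; field; rewrite gt_eqF.
Qed.

Lemma integral_affine f a t : continuous f -> (forall x, 0 <= f x) -> 0 < a ->
  (\int[gam]_s (f (a * s + t))%:E = \int[mu]_u (f u * normal_pdf t a u)%:E)%E.
Proof.
move=> cf f0 a0.
have caff : continuous (fun s => a * s + t).
  by move=> x; apply: cvgD; [apply: cvgMr; exact: cvg_id|exact: cvg_cst].
have dF x : is_derive x 1 (fun s => a * s + t) a.
  by apply: is_derive_eq; rewrite /GRing.scale/=; ring.
have F'E : derive1 (fun s => a * s + t) = cst a.
  by apply/funext => x; rewrite derive1E; exact: (@derive_val _ _ _ _ _ _ _ (dF x)).
rewrite ge0_integral_gamR; last 2 first.
- by apply: measurableT_comp; exact: continuous_measurable_fun.
- by move=> s; exact: f0.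
rewrite (@increasing_ge0_integration_by_substitutionT _ (fun s => a * s + t) (fun u => f u * normal_pdf t a u))//.
- apply: eq_integral => s _; congr EFin; rewrite F'E.
  rewrite -[RHS]/(f (a * s + t) * normal_pdf t a (a * s + t) * a).
  by rewrite -mulrA; congr (_ * _); rewrite mulrC gpdf_affine.
- by move=> x y xy; rewrite ltrD2r ltr_pM2l.
- by rewrite F'E => x; exact: cvg_cst.
- by rewrite F'E; exact: is_cvg_cst.
- by rewrite F'E; exact: is_cvg_cst.
- apply/cvgrNyPle => A; near=> x; rewrite -lerBrDr mulrC -ler_pdivlMr//.
- apply/cvgryPge => A; near=> x; rewrite -lerBlDr mulrC -ler_pdivrMr//.
- move=> x; apply: cvgM; first exact: cf.
  by apply: continuous_normal_pdf; rewrite gt_eqF.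
- by move=> x; rewrite mulr_ge0// normal_pdf_ge0.
Unshelve. all: by end_near. Qed.

(** Both sides are the joint density of t and u = a s + b t for independent normals s and t: a
    centred pair with unit variances and covariance b, hence symmetric in t and u. This is the
    reversibility of the Ornstein-Uhlenbeck kernel. *)
Lemma normal_pdf_exchange a b (u t : R) : 0 < a -> a ^+ 2 + b ^+ 2 = 1 ->
  normal_pdf (b * t) a u * gpdf t = gpdf u * normal_pdf (b * u) a t.
Proof.
move=> a0 ab; rewrite !gpdfE !normal_pdfE ?gt_eqF// /normal_peak /normal_fun.
rewrite [LHS]mulrACA [RHS]mulrACA -!expRD [X in X * _]mulrC; congr (_ * expR _).
have b2 : b ^+ 2 = 1 - a ^+ 2 by rewrite -ab; ring.
have E (x y : R) : (x - b * y) ^+ 2 = x ^+ 2 - 2 * b * x * y + (1 - a ^+ 2) * y ^+ 2.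
  by rewrite -b2; ring.
by rewrite !E -mulr_natr; field; rewrite gt_eqF.
Qed.

(** Substitution turns the inner integral into one against the normal density of mean [b * t]; by
    [normal_pdf_exchange] and Tonelli the variable t then integrates out to 1. *)
Lemma ge0_gE_stable f a b : continuous f -> (forall x, 0 <= f x) ->
  0 < a -> a ^+ 2 + b ^+ 2 = 1 ->
  (\int[gam]_t \int[gam]_s (f (a * s + b * t))%:E = \int[gam]_u (f u)%:E)%E.
Proof.
move=> cf f0 a0 ab.
have mf : measurable_fun [set: RM] f by exact: continuous_measurable_fun.
under eq_integral do rewrite integral_affine//.
have mnp : measurable_fun [set: RM * RM] (fun p : RM * RM => normal_pdf (b * p.1) a p.2).
  rewrite (_ : (fun p => _) = (fun p => normal_peak a * expR (- (p.2 - b * p.1) ^+ 2 / (a ^+ 2 *+ 2)))); last first.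
    by apply/funext => p; rewrite normal_pdfE ?gt_eqF.
  apply: measurable_funM => //; apply: measurableT_comp => //.
  apply: measurable_funM => //; apply: measurableT_comp => //.
  apply: measurable_funX; apply: measurable_funB; first exact: measurable_snd.
  by apply: measurable_funM => //; exact: measurable_fst.
have mh : measurable_fun [set: RM * RM] (fun p : RM * RM => f p.2 * normal_pdf (b * p.1) a p.2).
  by apply: measurable_funM => //; apply: (measurableT_comp mf); exact: measurable_snd.
have mg1 : measurable_fun [set: RM * RM] (fun p : RM * RM => gpdf p.1).
  apply: (@measurableT_comp _ _ _ _ _ _ (gpdf : RM -> R)); last exact: measurable_fst.
  exact: measurable_gpdf.
rewrite [LHS]ge0_integral_gam; last 2 first.
- apply: (measurable_fun_fubini_tonelli_F (fun p : RM * RM => (f p.2 * normal_pdf (b * p.1) a p.2)%:E)).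
    by apply/measurable_EFinP.
  by move=> p; rewrite lee_fin mulr_ge0// normal_pdf_ge0.
- by move=> t; apply: integral_ge0 => u _; rewrite lee_fin mulr_ge0// normal_pdf_ge0.
transitivity (\int[mu]_t \int[mu]_u (f u * normal_pdf (b * t) a u * gpdf t)%:E)%E.
  apply: eq_integral => t _; rewrite -ge0_integralZr//.
  - apply/measurable_EFinP; apply: measurable_funM => //; exact: measurable_normal_pdf.
  - by move=> u _; rewrite lee_fin mulr_ge0// normal_pdf_ge0.
  - by rewrite lee_fin gpdf_ge0.
rewrite (fubini_tonelli (fun p : RM * RM => (f p.2 * normal_pdf (b * p.1) a p.2 * gpdf p.1)%:E))/=; last 2 first.
- by apply/measurable_EFinP; exact: measurable_funM.
- by move=> p; rewrite lee_fin !mulr_ge0// ?gpdf_ge0// normal_pdf_ge0.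
rewrite ge0_integral_gamR//; apply: eq_integral => u _.
under eq_integral do rewrite -mulrA (normal_pdf_exchange _ _ a0 ab) mulrA EFinM.
rewrite ge0_integralZl//.
- by rewrite integral_normal_pdf mule1.
- by apply/measurable_EFinP; exact: measurable_normal_pdf.
- by move=> t _; rewrite lee_fin normal_pdf_ge0.
- by rewrite lee_fin mulr_ge0// gpdf_ge0.
Qed.

Lemma measurable_gE_affine f a b : continuous f -> (forall x, 0 <= f x) ->
  measurable_fun setT (fun t => gE (fun s => f (a * s + b * t))).
Proof.
move=> cf f0; rewrite /gE /Rintegral.
have mf : measurable_fun [set: RM] f by exact: continuous_measurable_fun.
apply: (@measurableT_comp _ _ _ _ _ _ fine); first exact: fine_measurable.
apply: (@measurable_fun_fubini_tonelli_F _ _ RM RM R gam (fun p => (f (a * p.2 + b * p.1))%:E)).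
  apply/measurable_EFinP; apply: (measurableT_comp mf).
  by apply: measurable_funD; apply: measurable_funM.
by move=> p; rewrite lee_fin.
Qed.

Lemma ge0_gE_stable_unit f a b C D : continuous f -> (forall x, 0 <= f x) ->
  (forall x, f x <= C * expR (D * `|x|)) ->
  0 < a -> a ^+ 2 + b ^+ 2 = 1 ->
  gint (fun t => gE (fun s => f (a * s + b * t))) /\
  gE (fun t => gE (fun s => f (a * s + b * t))) = gE f.
Proof.
move=> cf f0 fC a0 ab.
have C0 : 0 <= C.
  by have := le_trans (f0 0) (fC 0); rewrite normr0 mulr0 expR0 mulr1.
have mf : measurable_fun setT f by exact: continuous_measurable_fun.
have i1 t : gint (fun s => f (a * s + b * t)).
  have caff : continuous (fun s => a * s + b * t).
    by move=> x; apply: cvgD; [apply: cvgMr; exact: cvg_id|exact: cvg_cst].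
  apply: (@gint_le_exp _ _ (C * expR (`|D| * `|b * t|)) (`|D| * a)).
    by apply: measurableT_comp => //; exact: continuous_measurable_fun.
  move=> s; rewrite ger0_norm// (le_trans (fC _))// -mulrA ler_wpM2l// -expRD ler_expR.
  apply: (@le_trans _ _ (`|D| * `|a * s + b * t|)); first by rewrite ler_wpM2r// ler_norm.
  rewrite addrC -mulrA -mulrDr ler_wpM2l// (le_trans (ler_normD _ _))//.
  by rewrite (normrM a) (gtr0_norm a0).
have i2 : gint f by apply: (@gint_le_exp _ _ C D) => // x; rewrite ger0_norm.
apply: ge0_gint.
- exact: measurable_gE_affine.
- by move=> t; apply: Rintegral_ge0.
- under eq_integral do rewrite -(gE_EFin (i1 _)).
  by rewrite ge0_gE_stable// gE_EFin.
Qed.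

(** Dividing by c = sqrt(a^2 + b^2) reduces to the unit case, and splitting into positive and
    negative parts reduces to nonnegative functions. The case a = 0 is separate because the
    transition density degenerates there. *)
Lemma gE_stable f a b C D : continuous f ->
  (forall x, `|f x| <= C * expR (D * `|x|)) -> 0 <= a -> 0 <= b ->
  gE (fun t => gE (fun s => f (a * s + b * t))) =
  gE (fun s => f (Num.sqrt (a ^+ 2 + b ^+ 2) * s)).
Proof.
move=> cf fC; rewrite le_eqVlt => /predU1P[<- b0|a0 b0].
  rewrite expr0n add0r sqrtr_sqr ger0_norm//; apply: eq_gE => t.
  by rewrite -[RHS]gE_cst; apply: eq_gE => s; rewrite mul0r add0r.
set c := Num.sqrt _.
have c0 : 0 < c by rewrite sqrtr_gt0 ltr_wpDr ?sqr_ge0// exprn_gt0.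
have ab : (a / c) ^+ 2 + (b / c) ^+ 2 = 1.
  rewrite !expr_div_n -mulrDl sqr_sqrtr ?divff//.
    by rewrite gt_eqF// ltr_wpDr ?sqr_ge0// exprn_gt0.
  by rewrite addr_ge0// sqr_ge0.
have cc x : continuous (fun y => c * y).
  by move=> y; apply: cvgMr; exact: cvg_id.
pose fp x : R := Num.max (f (c * x)) 0; pose fm x : R := Num.max (- f (c * x)) 0.
have cfc : continuous (fun x => f (c * x)).
  by move=> x; apply: (cvg_comp (fun y => c * y) f); [exact: cc|exact: cf].
have cp : continuous fp.
  by move=> x; apply: continuous_max; [exact: cfc|exact: cvg_cst].
have cm : continuous fm.
  have cN : continuous (fun x => - f (c * x)) by move=> x; apply: cvgN; exact: cfc.
  by move=> x; apply: (@continuous_max R R (fun x => - f (c * x)) (fun=> 0)); [exact: cN|exact: cvg_cst].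
have fp0 x : 0 <= fp x by rewrite le_max lexx orbT.
have fm0 x : 0 <= fm x by rewrite le_max lexx orbT.
have bd x : `|f (c * x)| <= C * expR ((D * c) * `|x|).
  by rewrite (le_trans (fC _))// normrM (gtr0_norm c0) mulrA.
have fpC x : fp x <= C * expR ((D * c) * `|x|).
  by apply: le_trans (bd x); rewrite ge_max normr_ge0 ler_norm.
have fmC x : fm x <= C * expR ((D * c) * `|x|).
  by apply: le_trans (bd x); rewrite ge_max normr_ge0 -normrN ler_norm.
have ac0 : 0 < a / c by rewrite divr_gt0.
have [ip Ep] := ge0_gE_stable_unit cp fp0 fpC ac0 ab.
have [im Em] := ge0_gE_stable_unit cm fm0 fmC ac0 ab.
have fE x : f (c * x) = fp x + (-1) * fm x.
  rewrite /fp /fm mulN1r; have [y0|y0] := leP 0 (f (c * x)).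
    by rewrite (max_idPr _) ?subr0// oppr_le0.
  by rewrite (max_idPl _) ?add0r ?opprK// oppr_ge0 ltW.
have ifp g : continuous g -> (forall x, 0 <= g x) -> (forall x, g x <= C * expR ((D * c) * `|x|)) ->
    forall p q : R, gint (fun s => g (p * s + q)).
  move=> cg g0 gC p q.
  have caff : continuous (fun s => p * s + q).
    by move=> x; apply: cvgD; [apply: cvgMr; exact: cvg_id|exact: cvg_cst].
  have C0 : 0 <= C by have := le_trans (g0 0) (gC 0); rewrite normr0 mulr0 expR0 mulr1.
  apply: (@gint_le_exp _ _ (C * expR (`|D * c| * `|q|)) (`|D * c| * `|p|)).
    by apply: measurableT_comp => //; exact: continuous_measurable_fun.
  move=> s; rewrite ger0_norm// (le_trans (gC _))// -(mulrA C) ler_wpM2l// -expRD ler_expR.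
  apply: (@le_trans _ _ (`|D * c| * `|p * s + q|)); first by rewrite ler_wpM2r// ler_norm.
  by rewrite addrC -mulrA -mulrDr ler_wpM2l// (le_trans (ler_normD _ _))// normrM.
have id1 g : (fun s => g (1 * s + 0)) = g :> (R -> R).
  by apply/funext => s; rewrite mul1r addr0.
transitivity (gE (fun t => gE (fun s => fp ((a / c) * s + (b / c) * t)) +
    (-1) * gE (fun s => fm ((a / c) * s + (b / c) * t)))).
  apply: eq_gE => t; rewrite -gEZ; last exact: ifp.
  rewrite -gED; [|exact: ifp|by apply: gintZ; exact: ifp].
  apply: eq_gE => s; rewrite -fE; congr f; field; exact: lt0r_neq0.
rewrite gED//; last exact: gintZ.
rewrite gEZ// Ep Em -gEZ -?gED.
- by apply: eq_gE => s; rewrite -fE.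
- by have := ifp _ cp fp0 fpC 1 0; rewrite id1.
- by apply: gintZ; have := ifp _ cm fm0 fmC 1 0; rewrite id1.
- by have := ifp _ cm fm0 fmC 1 0; rewrite id1.
Qed.

End gaussian_fubini.

(** * Iterated Gaussian integrals of functions of finitely many coordinates *)

Section iterated_gaussian.
Context {R : realType}.
Implicit Types (f g : (nat -> R) -> R) (N M : nat) (v : nat -> R).
Local Notation gam := (normal_prob (0 : R) 1).

(** Real-valued counterpart of [giter], on which the algebra of expectations is available. *)
Fixpoint gEn N f : R :=
  if N is N'.+1 then gE (fun t => gEn N' (fun v => f (scons t v)))
  else f (fun=> 0).

(** Every partial integral met by [gEn] converges. Linearity and monotonicity of [gEn] then follow
    by induction, without a product measure or joint measurability. *)
Fixpoint SI N f : Prop :=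
  if N is N'.+1 then (forall t, SI N' (fun v => f (scons t v))) /\
    gint (fun t => gEn N' (fun v => f (scons t v)))
  else True.

Lemma SI_cst N (c : R) : SI N (fun=> c) /\ gEn N (fun=> c) = c.
Proof.
elim: N => [//|N [IH1 IH2]] /=; rewrite (funext (fun=> IH2)) gE_cst.
by split => //; split => //; exact: gint_cst.
Qed.

Lemma SI_add N f g : SI N f -> SI N g ->
  SI N (fun v => f v + g v) /\ gEn N (fun v => f v + g v) = gEn N f + gEn N g.
Proof.
elim: N f g => [//|N IH] f g [fi gi] [fi' gi'] /=.
rewrite (funext (fun t => (IH _ _ (fi t) (fi' t)).2)) gED//; split => //; split.
  by move=> t; have [] := IH _ _ (fi t) (fi' t).
exact: gintD.
Qed.

Lemma SI_scale N (c : R) f : SI N f ->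
  SI N (fun v => c * f v) /\ gEn N (fun v => c * f v) = c * gEn N f.
Proof.
elim: N f => [//|N IH] f [fi gi] /=.
rewrite (funext (fun t => (IH _ (fi t)).2)) gEZ//; split => //; split.
  by move=> t; have [] := IH _ (fi t).
exact: gintZ.
Qed.

Lemma eq_SI N f g : f =1 g -> SI N f -> SI N g.
Proof. by move=> /funext ->. Qed.

Lemma eq_gEn N f g : f =1 g -> gEn N f = gEn N g.
Proof. by move=> /funext ->. Qed.

Lemma SI_sum N (I : finType) (F : I -> (nat -> R) -> R) : (forall i, SI N (F i)) ->
  SI N (fun v => \sum_i F i v) /\ gEn N (fun v => \sum_i F i v) = \sum_i gEn N (F i).
Proof.
move=> Fi; elim: (index_enum I) => [|i r [IH1 IH2]].
  have [H1 H2] := SI_cst N 0; rewrite big_nil -[RHS]H2.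
  by split; [apply: eq_SI H1|apply: eq_gEn] => v; rewrite big_nil.
have [H1 H2] := SI_add (Fi i) IH1.
split; first by apply: eq_SI H1 => v; rewrite big_cons.
by rewrite big_cons -IH2 -H2; apply: eq_gEn => v; rewrite big_cons.
Qed.

Lemma le_gEn N f g : SI N f -> SI N g -> (forall v, f v <= g v) -> gEn N f <= gEn N g.
Proof.
elim: N f g => [f g _ _ fg|N IH f g /= [fi gi] [fi' gi'] fg]; first exact: fg.
by apply: le_gE => // t; apply: IH.
Qed.

(* The integral of a nonnegative function is a supremum over the simple functions below
   it; the events of the theorem are not known to be measurable. *)
Lemma ge0_le_integral_nomeas (h k : R -> \bar R) :
  (forall x, 0 <= h x)%E -> (forall x, h x <= k x)%E ->
  (\int[gam]_x h x <= \int[gam]_x k x)%E.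
Proof.
move=> h0 hk; have k0 x : (0 <= k x)%E by exact: le_trans (hk x).
rewrite !ge0_integralTE//; apply: le_ereal_sup => _ [u /= uh <-].
by exists u => // x; exact: le_trans (hk x).
Qed.

Lemma giter_ge0 N (h : (nat -> R) -> \bar R) : (forall v, 0 <= h v)%E -> (0 <= giter N h)%E.
Proof.
elim: N h => [h h0|N IH h h0 /=]; first exact: h0.
by apply: integral_ge0 => t _; apply: IH => v; exact: h0.
Qed.

Lemma gEn_le_giter N f (h : (nat -> R) -> \bar R) : SI N f ->
  (forall v, 0 <= h v)%E -> (forall v, (f v)%:E <= h v)%E ->
  ((gEn N f)%:E <= giter N h)%E.
Proof.
elim: N f h => [f h _ _|N IH f h [fi gi] h0 fh] /=; first exact.
(* Monotonicity without measurability holds between nonnegative functions, so the inner expectation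
   is first replaced by its positive part. *)
apply: (@le_trans _ _ (\int[gam]_t (Num.max (gEn N (fun v => f (scons t v))) 0)%:E)%E).
  have im : gint (fun t => Num.max (gEn N (fun v => f (scons t v))) 0).
    apply: (@le_gint _ _ (fun t => `|gEn N (fun v => f (scons t v))|)).
    - by apply: measurable_maxr => //; exact: measurable_gint gi.
    - by move=> x; rewrite ger0_norm ?le_max ?lexx ?orbT// ge_max ler_norm normr_ge0.
    - exact: gint_norm.
  rewrite (gE_EFin im) lee_fin; apply: le_gE => // t; by rewrite le_max lexx.
apply: ge0_le_integral_nomeas => t; first by rewrite lee_fin le_max lexx orbT.
rewrite EFin_max ge_max; apply/andP; split; last by apply: giter_ge0 => v; exact: h0.
by apply: IH => [|v|v]; [exact: fi|exact: h0|exact: fh].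
Qed.

Lemma SI_prod N (psi : nat -> R -> R) (c : R) : (forall i, (i < N)%N -> gint (psi i)) ->
  SI N (fun v => c * \prod_(i < N) psi i (v i)) /\
  gEn N (fun v => c * \prod_(i < N) psi i (v i)) = c * \prod_(i < N) gE (psi i).
Proof.
elim: N psi c => [|N IH] psi c pi; first by rewrite /= !big_ord0.
have E t v : c * \prod_(i < N.+1) psi i (scons t v i) =
    (c * psi 0%N t) * \prod_(i < N) psi i.+1 (v i).
  by rewrite big_ord_recl/= mulrA.
have IH' t := IH (fun i => psi i.+1) (c * psi 0%N t) (fun i iN => pi i.+1 iN).
have gE' t : gEn N (fun v => c * \prod_(i < N.+1) psi i (scons t v i)) =
    (c * \prod_(i < N) gE (psi i.+1)) * psi 0%N t.
  by under eq_gEn do rewrite E; rewrite (IH' t).2 mulrAC.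
split; last first.
  rewrite /= (eq_gE gE') gEZ; last exact: pi.
  by rewrite big_ord_recl mulrAC mulrA.
split; first by move=> t; apply: eq_SI (IH' t).1 => v; rewrite E.
by move/funext: gE' => ->; apply: gintZ; exact: pi.
Qed.

Definition nd N (x y : nat -> R) : R := \sum_(i < N) `|x i - y i|.

Lemma ndxx N x : nd N x x = 0.
Proof. by rewrite /nd big1// => i _; rewrite subrr normr0. Qed.

Lemma nd_ge0 N x y : 0 <= nd N x y.
Proof. by apply: sumr_ge0. Qed.

Lemma nd_scons N (t t' : R) x y : nd N.+1 (scons t x) (scons t' y) = `|t - t'| + nd N x y.
Proof. by rewrite /nd big_ord_recl. Qed.

Lemma lip1_continuous (C : R) (h : R -> R) :
  (forall t t', `|h t - h t'| <= C * `|t - t'|) -> continuous h.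
Proof.
move=> hC x; apply/cvgrPdist_le => e e0.
have C0 : 0 <= C by have := hC 1 0; rewrite subr0 normr1 mulr1; exact: le_trans.
near=> y; apply: (le_trans (hC _ _)).
apply: (@le_trans _ _ ((C + 1) * `|x - y|)); first by rewrite ler_wpM2r// lerDl.
rewrite -ler_pdivlMl ?ltr_wpDl//.
near: y; apply: cvgr_dist_le; first exact: cvg_id.
by rewrite mulr_gt0// invr_gt0 ltr_wpDl.
Unshelve. all: by end_near. Qed.

Lemma expR_ge_norm (x : R) : `|x| <= expR `|x|.
Proof. by apply: le_trans (expR_ge1Dx _); rewrite lerDr. Qed.

Lemma expR_norm_ge1 (x : R) : 1 <= expR `|x|.
Proof. by rewrite -[leLHS]expR0 ler_expR. Qed.

Lemma lip1_gint (C : R) (h : R -> R) :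
  (forall t t', `|h t - h t'| <= C * `|t - t'|) -> gint h.
Proof.
move=> hC.
have C0 : 0 <= C by have := hC 1 0; rewrite subr0 normr1 mulr1; exact: le_trans.
apply: (@gint_le_exp _ _ (`|h 0| + C) 1).
  by apply: continuous_measurable_fun; exact: lip1_continuous hC.
move=> x; rewrite mul1r -{1}(subrK (h 0) (h x)) (le_trans (ler_normD _ _))//.
rewrite addrC mulrDl lerD//.
  by rewrite ler_peMr// expR_norm_ge1.
by rewrite (le_trans (hC _ _))// subr0 ler_wpM2l// expR_ge_norm.
Qed.

(** The parameter type [T] is arbitrary so that the induction can pass the first integration
    variable into it: the new parameter is a pair in [T * R], with the distances added. The
    Lipschitz constant is preserved at each stage and yields integrability there. *)
Lemma lip_gEn (T : Type) (d : T -> T -> R) (C : R) N (F : T -> (nat -> R) -> R) :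
  (forall x, d x x = 0) ->
  (forall x x' y y', `|F x y - F x' y'| <= C * (d x x' + nd N y y')) ->
  (forall x, SI N (F x)) /\
  (forall x x', `|gEn N (F x) - gEn N (F x')| <= C * d x x').
Proof.
elim: N T d F => [|N IH] T d F dxx FC.
  by split => // x x' /=; have := FC x x' (fun=> 0) (fun=> 0); rewrite ndxx addr0.
have [||S' L'] := IH (T * R)%type (fun p q => d p.1 q.1 + `|p.2 - q.2|)
    (fun p v => F p.1 (scons p.2 v)).
- by move=> [x t] /=; rewrite dxx subrr normr0 addr0.
- move=> [x t] [x' t'] y y' /=; apply: (le_trans (FC _ _ _ _)).
  by rewrite nd_scons addrA.
have Lt x t t' : `|gEn N (fun v => F x (scons t v)) - gEn N (fun v => F x (scons t' v))| <= C * `|t - t'|.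
  by have := L' (x, t) (x, t'); rewrite /= dxx add0r.
have gi x := lip1_gint (Lt x).
split => [x|x x'] /=.
  by split => // t; exact: (S' (x, t)).
have -> : gE (fun t => gEn N (fun v => F x (scons t v))) -
    gE (fun t => gEn N (fun v => F x' (scons t v))) =
    gE (fun t => gEn N (fun v => F x (scons t v)) + (-1) * gEn N (fun v => F x' (scons t v))).
  by rewrite gED ?gEZ ?mulN1r//; exact: gintZ.
have gi2 : gint (fun t => gEn N (fun v => F x (scons t v)) + (-1) * gEn N (fun v => F x' (scons t v))).
  by apply: gintD => //; exact: gintZ.
have bd t : `|gEn N (fun v => F x (scons t v)) + -1 * gEn N (fun v => F x' (scons t v))| <= C * d x x'.
  by rewrite mulN1r; have := L' (x, t) (x', t); rewrite /= subrr normr0 addr0.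
rewrite ler_norml -{1}(gE_cst (- (C * d x x'))) -{2}(gE_cst (C * d x x')).
apply/andP; split; apply: le_gE => //; try exact: gint_cst.
- by move=> t; have := bd t; rewrite ler_norml => /andP[].
- by move=> t; have := bd t; rewrite ler_norml => /andP[].
Qed.

(** The variable t is moved past one coordinate at a time. Each move is Fubini in the plane, whose
    continuity and growth conditions come from the Lipschitz bound of [lip_gEn]. *)
Lemma gEn_gE_swap (C : R) N (F : (nat -> R) -> R -> R) :
  (forall x x' t t', `|F x t - F x' t'| <= C * (nd N x x' + `|t - t'|)) ->
  gEn N (fun x => gE (F x)) = gE (fun t => gEn N (F ^~ t)).
Proof.
elim: N F => [//|N IH] F FC /=.
have [||_ HC] := @lip_gEn (R * R)%type (fun p q => `|p.1 - q.1| + `|p.2 - q.2|) C N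
    (fun p x => F (scons p.1 x) p.2).
- by move=> [s t] /=; rewrite !subrr normr0 addr0.
- move=> [s t] [s' t'] y y' /=; apply: (le_trans (FC _ _ _ _)).
  by rewrite nd_scons addrAC.
pose H s t := gEn N (fun x => F (scons s x) t).
have {}HC s t s' t' : `|H s t - H s' t'| <= C * (`|s - s'| + `|t - t'|) by exact: (HC (s, t) (s', t')).
have C0 : 0 <= C.
  by have := HC 1 0 0 0; rewrite subrr subr0 normr0 normr1 addr0 mulr1; exact: le_trans.
transitivity (gE (fun s => gE (H s))).
  apply: eq_gE => s; apply: IH => x x' t t'; apply: (le_trans (FC _ _ _ _)).
  by rewrite nd_scons subrr normr0 add0r.
apply: (@gE_swap _ _ (`|H 0 0| + C * 2) 1).
- move=> t; apply: (@lip1_continuous C) => s s'; apply: (le_trans (HC _ _ _ _)).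
  by rewrite subrr normr0 addr0.
- move=> s; apply: continuous_measurable_fun; apply: (@lip1_continuous C) => t t'.
  by apply: (le_trans (HC _ _ _ _)); rewrite subrr normr0 add0r.
- move=> s t; rewrite !mul1r -mulrA -{1}(subrK (H 0 0) (H s t)) (le_trans (ler_normD _ _))//.
  have e1 (u : R) : 1 <= expR `|u| by rewrite expR_norm_ge1.
  rewrite addrC mulrDl lerD//.
    by rewrite ler_peMr// -[leLHS]mulr1 ler_pM.
  rewrite (le_trans (HC _ _ _ _))// !subr0 -mulrA ler_wpM2l// mulr_natl mulr2n lerD//.
    by rewrite (le_trans (expR_ge_norm s))// ler_peMr// expR_ge0.
  by rewrite (le_trans (expR_ge_norm t))// ler_peMl// expR_ge0.
Qed.

Lemma gEn_swap (C : R) N M (F : (nat -> R) -> (nat -> R) -> R) :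
  (forall x x' y y', `|F x y - F x' y'| <= C * (nd N x x' + nd M y y')) ->
  gEn N (fun x => gEn M (F x)) = gEn M (fun y => gEn N (F ^~ y)).
Proof.
elim: M F => [//|M IH] F FC /=.
rewrite (@gEn_gE_swap C).
  apply: eq_gE => t; rewrite (IH (fun x y => F x (scons t y)))// => x x' y y'.
  by apply: (le_trans (FC _ _ _ _)); rewrite nd_scons subrr normr0 add0r.
move=> x x' t t'.
have [||_ HC] := @lip_gEn ((nat -> R) * R)%type (fun p q => nd N p.1 q.1 + `|p.2 - q.2|) C M
    (fun p y => F p.1 (scons p.2 y)).
- by move=> [z u] /=; rewrite ndxx subrr normr0 addr0.
- move=> [z u] [z' u'] y y' /=; apply: (le_trans (FC _ _ _ _)).
  by rewrite nd_scons addrA.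
exact: (HC (x, t) (x', t')).
Qed.

Lemma nd_axpy N (a b : R) x y x' y' : 0 <= a -> 0 <= b ->
  nd N (fun i => a * x i + b * y i) (fun i => a * x' i + b * y' i) <=
  a * nd N x x' + b * nd N y y'.
Proof.
move=> a0 b0; rewrite /nd !mulr_sumr -big_split; apply: ler_sum => i _ /=.
rewrite (_ : _ - _ = a * (x i - x' i) + b * (y i - y' i)); last by ring.
by rewrite (le_trans (ler_normD _ _))// !normrM (ger0_norm a0) (ger0_norm b0).
Qed.

Lemma nd_scale N (c : R) x x' : 0 <= c ->
  nd N (fun i => c * x i) (fun i => c * x' i) = c * nd N x x'.
Proof.
by move=> c0; rewrite /nd mulr_sumr; apply: eq_bigr => i _; rewrite -mulrBr normrM ger0_norm.
Qed.

Lemma scons_axpy (a b t t' : R) (x y : nat -> R) :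
  (fun i => a * scons t x i + b * scons t' y i) =
  scons (a * t + b * t') (fun i => a * x i + b * y i).
Proof. by apply/funext => -[]. Qed.

Lemma scons_scale (a t : R) (x : nat -> R) :
  (fun i => a * scons t x i) = scons (a * t) (fun i => a * x i).
Proof. by apply/funext => -[]. Qed.

(** The integrals over x and y come in two blocks; exchanging them brings equal coordinates
    together, where the one-dimensional [gE_stable] applies. *)
Lemma gEn_stable (C : R) N f (a b : R) :
  (forall x y, `|f x - f y| <= C * nd N x y) -> 0 <= a -> 0 <= b ->
  gEn N (fun x => gEn N (fun y => f (fun i => a * x i + b * y i))) =
  gEn N (fun x => f (fun i => Num.sqrt (a ^+ 2 + b ^+ 2) * x i)).
Proof.
move=> + a0 b0; elim: N f => [f _ /=|N IH f fC /=].
  by congr f; apply/funext => i; rewrite !mulr0 addr0.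
have C0 : 0 <= C.
  have := fC (fun i => (i == 0)%:R) (fun=> 0).
  rewrite /nd big_ord_recl/= subr0 normr1 big1 ?addr0 ?mulr1; first exact: le_trans.
  by move=> i _; rewrite subr0 normr0.
set c := Num.sqrt _.
have c0 : 0 <= c by exact: sqrtr_ge0.
transitivity (gE (fun t => gE (fun t' => gEn N (fun x => gEn N (fun y =>
    f (scons (a * t + b * t') (fun i => a * x i + b * y i))))))).
  apply: eq_gE => t.
  rewrite -(@gEn_gE_swap (C * (a + b)) N (fun x t' => gEn N (fun y =>
    f (scons (a * t + b * t') (fun i => a * x i + b * y i))))).
    by apply: eq_gEn => x; apply: eq_gE => t'; apply: eq_gEn => y; rewrite scons_axpy.
  move=> x x' s s'.
  have [||_ HC] := @lip_gEn ((nat -> R) * R)%type (fun p q => nd N p.1 q.1 + `|p.2 - q.2|) (C * (a + b)) N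
    (fun p y => f (scons (a * t + b * p.2) (fun i => a * p.1 i + b * y i))).
  - by move=> [z u] /=; rewrite ndxx subrr normr0 addr0.
  - move=> [z u] [z' u'] y y' /=; apply: (le_trans (fC _ _)).
    rewrite nd_scons -mulrA ler_wpM2l//.
    have := nd_axpy N z y z' y' a0 b0; have := nd_ge0 N z z'; have := nd_ge0 N y y'.
    rewrite (_ : a * t + b * u - _ = b * (u - u')); last by ring.
    rewrite normrM (ger0_norm b0); have := normr_ge0 (u - u').
    set p := nd _ _ _; set q := nd _ _ _; set r := nd _ _ _; set w := `|_| => w0 q0 p0 rpq.
    nra.
  exact: (HC (x, s) (x', s')).
pose h u := gEn N (fun x => f (scons u (fun i => c * x i))).
have hC s s' : `|h s - h s'| <= C * (1 + c) * `|s - s'|.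
  have [||_ HC] := @lip_gEn R (fun p q => `|p - q|) (C * (1 + c)) N
    (fun p x => f (scons p (fun i => c * x i))).
  - by move=> z /=; rewrite subrr normr0.
  - move=> z z' y y' /=; apply: (le_trans (fC _ _)).
    rewrite nd_scons -mulrA ler_wpM2l//.
    rewrite nd_scale//; have := nd_ge0 N y y'; have := normr_ge0 (z - z').
    by set q := nd _ _ _; set w := `|_| => w0 q0; nra.
  exact: HC.
transitivity (gE (fun t => gE (fun t' => h (b * t' + a * t)))).
  apply: eq_gE => t; apply: eq_gE => t'; rewrite addrC /h.
  rewrite (IH (fun z => f (scons (b * t' + a * t) z)))// => x y.
  by apply: (le_trans (fC _ _)); rewrite nd_scons subrr normr0 add0r.
rewrite (@gE_stable _ _ _ _ (`|h 0| + C * (1 + c)) 1)//; last 2 first.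
- exact: lip1_continuous hC.
- move=> x; rewrite mul1r -{1}(subrK (h 0) (h x)) (le_trans (ler_normD _ _))//.
  rewrite addrC mulrDl lerD//; first by rewrite ler_peMr// expR_norm_ge1.
  rewrite (le_trans (hC _ _))// subr0 ler_wpM2l// ?expR_ge_norm//.
  by rewrite mulr_ge0// addr_ge0.
rewrite (addrC (b ^+ 2)) -/c; apply: eq_gE => s; apply: eq_gEn => x.
by rewrite scons_scale.
Qed.

End iterated_gaussian.

(** * Third-order Taylor estimates and the logistic function *)

Section taylor.
Context {R : realType}.

Lemma mvt_bound (F F' : R -> R) (u h B : R) : (forall x : R, is_derive x 1 F (F' x)) ->
  (forall x, `|x - u| <= `|h| -> `|F' x| <= B) -> `|F (u + h) - F u| <= B * `|h|.
Proof.
move=> dF FB.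
have cF : continuous F.
  by move=> x; apply: differentiable_continuous; apply/derivable1_diffP; case: (dF x).
have [h0|h0] := leP 0 h.
- have uh : u <= u + h by rewrite lerDl.
  have [x xI ->] := MVT_segment uh (fun x _ => dF x) (continuous_subspaceT cF).
  move: xI; rewrite in_itv/= => /andP[ux xh]; rewrite normrM addrAC subrr add0r.
  by rewrite ler_wpM2r// FB// !ger0_norm// ?subr_ge0// lerBlDl.
- have uh : u + h <= u by rewrite gerDl ltW.
  have [x xI E] := MVT_segment uh (fun x _ => dF x) (continuous_subspaceT cF).
  move: xI; rewrite in_itv/= => /andP[ux xh]; rewrite distrC E normrM opprD addrA subrr add0r normrN.
  by rewrite ler_wpM2r// FB// !ler0_norm ?subr_le0// ?(ltW h0)//; lra.
Qed.

(** Three nested mean value bounds, from the second derivative down; having M in place of M/6 is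
    harmless. *)
Lemma taylor2 (f f1 f2 f3 : R -> R) (M u h : R) :
  (forall x : R, is_derive x 1 f (f1 x)) -> (forall x : R, is_derive x 1 f1 (f2 x)) ->
  (forall x : R, is_derive x 1 f2 (f3 x)) -> (forall x, `|f3 x| <= M) ->
  `|f (u + h) - (f u + f1 u * h + f2 u / 2 * h ^+ 2)| <= M * `|h| ^+ 3.
Proof.
move=> d1 d2 d3 fM.
have M0 : 0 <= M by apply: le_trans (fM 0).
have b2 x : `|x - u| <= `|h| -> `|f2 x - f2 u| <= M * `|h|.
  move=> xh; have := @mvt_bound f2 f3 u (x - u) M d3 (fun x _ => fM x).
  by rewrite (addrC u) subrK => /le_trans; apply; rewrite ler_wpM2l.
have b1 x : `|x - u| <= `|h| -> `|f1 x - f1 u - f2 u * (x - u)| <= M * `|h| ^+ 2.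
  move=> xh; pose g y := f1 y - f2 u * (y - u).
  have dg (y : R) : is_derive y 1 g (f2 y - f2 u).
    by apply: is_derive_eq; rewrite /GRing.scale/=; ring.
  have := @mvt_bound g (fun y => f2 y - f2 u) u (x - u) (M * `|h|) dg.
  rewrite /g subrr mulr0 subr0 (addrC u) subrK => H.
  rewrite addrAC; apply: (le_trans (H _)).
    by move=> y yx; apply: b2; exact: le_trans xh.
  by rewrite expr2 mulrA ler_wpM2l// mulr_ge0.
pose k y := f y - f1 u * (y - u) - f2 u / 2 * (y - u) ^+ 2.
have dk (y : R) : is_derive y 1 k (f1 y - f1 u - f2 u * (y - u)).
  by apply: is_derive_eq; rewrite /GRing.scale/=; field.
have := @mvt_bound k _ u h (M * `|h| ^+ 2) dk b1.
rewrite /k subrr mulr0 expr0n mulr0 !subr0 (addrC u) addrK -(mulrA M) -exprSr.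
by move=> H; apply: le_trans H; rewrite le_eqVlt; apply/orP; left; apply/eqP; congr `|_|; ring.
Qed.

Variables (l c : R).
(** For positive [l], a decreasing logistic cut-off at [c] of steepness [l]. Its derivatives are
    polynomials in itself, which makes the sign of the first one and uniform bounds on all of them
    immediate. *)
Definition tau (x : R) : R := (1 + expR (l * (x - c)))^-1.

Lemma tau_bnd x : 0 < tau x < 1.
Proof.
have e0 := expR_gt0 (l * (x - c)).
by rewrite invr_gt0 addr_gt0//= invf_lt1 ?ltrDl// addr_gt0.
Qed.

Lemma is_derive_tau (x : R) : is_derive x 1 tau (- l * (tau x * (1 - tau x))).
Proof.
have e0 := expR_gt0 (l * (x - c)).
have n0 : 1 + expR (l * (x - c)) != 0 by rewrite gt_eqF// addr_gt0.
have d : is_derive x 1 (fun x => 1 + expR (l * (x - c))) (l * expR (l * (x - c))).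
  by apply: is_derive_eq; rewrite /GRing.scale/=; ring.
have d' := @is_deriveV _ (fun x => 1 + expR (l * (x - c))) x _ _ n0 d; apply: (is_derive_eq d').
by rewrite /tau /GRing.scale/=; field.
Qed.

Definition tau1 x := - l * (tau x * (1 - tau x)).
Definition tau2 x := l ^+ 2 * (tau x * (1 - tau x) * (1 - 2 * tau x)).
Definition tau3 x := - l ^+ 3 * (tau x * (1 - tau x) * (1 - 6 * tau x + 6 * tau x ^+ 2)).

Lemma is_derive_tau1 (x : R) : is_derive x 1 tau1 (tau2 x).
Proof.
have := is_derive_tau x => d.
by apply: is_derive_eq; rewrite /tau2 /GRing.scale/=; ring.
Qed.

Lemma is_derive_tau2 (x : R) : is_derive x 1 tau2 (tau3 x).
Proof.
have := is_derive_tau x => d.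
by apply: is_derive_eq; rewrite /tau3 /GRing.scale/=; ring.
Qed.

Lemma taylor_tau u h :
  `|tau (u + h) - (tau u + tau1 u * h + tau2 u / 2 * h ^+ 2)| <= `|l| ^+ 3 * `|h| ^+ 3.
Proof.
apply: (@taylor2 tau tau1 tau2 tau3 (`|l| ^+ 3) u h is_derive_tau is_derive_tau1 is_derive_tau2).
move=> x; rewrite /tau3 normrM normrN normrX ler_piMr// ?exprn_ge0//.
have /andP[t0 t1] := tau_bnd x; set t := tau x in t0 t1 *.
have q0 : 0 <= t * (1 - t) by rewrite mulr_ge0 ?subr_ge0// ltW.
have q1 : t * (1 - t) <= 1 / 4.
  rewrite -subr_ge0 (_ : _ - _ = (t - 1 / 2) ^+ 2) ?sqr_ge0//.
  by field.
rewrite (_ : 1 - 6 * t + 6 * t ^+ 2 = 1 - 6 * (t * (1 - t))); last by ring.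
rewrite normrM ger0_norm// -[leRHS]mulr1 ler_pM//; first by lra.
by rewrite ler_norml; apply/andP; split; lra.
Qed.

End taylor.

(** * A class of functions with uniform second-order expansions *)

Section taylor_class.
Context {R : realType} {P : finType}.
Implicit Types (x h b : P -> R) (c : P -> P -> R) (f g : (P -> R) -> R).

Definition n1 h : R := \sum_p `|h p|.

Lemma n1_ge0 h : 0 <= n1 h.
Proof. exact: sumr_ge0. Qed.

Definition lin b h : R := \sum_p b p * h p.
Definition quad c h : R := \sum_p \sum_q c p q * (h p * h q).

Lemma lin_bound b h (M : R) : (forall p, `|b p| <= M) -> `|lin b h| <= M * n1 h.
Proof.
move=> bM; rewrite (le_trans (ler_norm_sum _ _ _))// mulr_sumr.
by apply: ler_sum => p _; rewrite normrM ler_wpM2r.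
Qed.

Lemma quad_bound c h (M : R) : (forall p q, `|c p q| <= M) -> `|quad c h| <= M * n1 h ^+ 2.
Proof.
move=> cM; rewrite (le_trans (ler_norm_sum _ _ _))// expr2 -[n1 h * _]/((\sum_p `|h p|) * n1 h) mulr_suml mulr_sumr.
apply: ler_sum => p _; rewrite (le_trans (ler_norm_sum _ _ _))// /n1 !mulr_sumr.
by apply: ler_sum => q _; rewrite !normrM ler_wpM2r// mulr_ge0.
Qed.

Lemma le_normD2 (a b u v : R) : `|a| <= u -> `|b| <= v -> `|a + b| <= u + v.
Proof. by move=> au bv; rewrite (le_trans (ler_normD _ _))// lerD. Qed.

(* [K] records sign information on the value, gradient and (half) Hessian. *)
Definition T3 (K : R -> (P -> R) -> (P -> P -> R) -> Prop) f :=
  exists2 M : R, 0 <= M & forall x, exists b c,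
    [/\ `|f x| <= M, forall p, `|b p| <= M, forall p q, `|c p q| <= M,
        K (f x) b c &
        forall h, n1 h <= 1 ->
          `|f (fun p => x p + h p) - (f x + lin b h + quad c h)| <= M * n1 h ^+ 3].

(** Expansions multiply like power series. Of the sixteen products of terms, six have order at most
    two; the other ten are each at most [V] times the cube of [n1 h], since [n1 h <= 1] lowers
    higher powers. Hence the constant 10. *)
Lemma T3_prod K1 K2 K3 f g :
  (forall u b c u' b' c', K1 u b c -> K2 u' b' c' ->
     K3 (u * u') (fun p => u * b' p + u' * b p)
        (fun p q => u * c' p q + u' * c p q + b p * b' q)) ->
  T3 K1 f -> T3 K2 g -> T3 K3 (fun x => f x * g x).
Proof.
move=> K123 [M M0 fM] [M' M'0 gM]; pose V := M * M'.
have V0 : 0 <= V by rewrite mulr_ge0.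
exists (10 * V); first by rewrite mulr_ge0.
move=> x; have [b [c [f0 bM cM Kf fh]]] := fM x; have [b' [c' [g0 b'M c'M Kg gh]]] := gM x.
exists (fun p => f x * b' p + g x * b p).
exists (fun p q => f x * c' p q + g x * c p q + b p * b' q).
have E (p q : R) : `|p| <= M -> `|q| <= M' -> `|p * q| <= V.
  by move=> pM qM; rewrite normrM ler_pM.
have E' (p q : R) : `|p| <= M -> `|q| <= M' -> `|q * p| <= V.
  by move=> pM qM; rewrite mulrC E.
split.
- by rewrite (le_trans (E _ _ f0 g0))//; lra.
- move=> p; have := le_normD2 (E _ _ f0 (b'M p)) (E' _ _ (bM p) g0).
  by move/le_trans; apply; lra.
- move=> p q.
  have := le_normD2 (le_normD2 (E _ _ f0 (c'M p q)) (E' _ _ (cM p q) g0)) (E _ _ (bM p) (b'M q)).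
  by move/le_trans; apply; lra.
- exact: K123.
- move=> h h1; set H := n1 h in h1 *; have H0 : 0 <= H := n1_ge0 h.
  have linE : lin (fun p => f x * b' p + g x * b p) h = f x * lin b' h + g x * lin b h.
    by rewrite /lin !mulr_sumr -big_split; apply: eq_bigr => p _ /=; ring.
  have quadE : quad (fun p q => f x * c' p q + g x * c p q + b p * b' q) h =
      f x * quad c' h + g x * quad c h + lin b h * lin b' h.
    rewrite /quad /lin mulr_suml !mulr_sumr -!big_split; apply: eq_bigr => p _ /=.
    by rewrite !mulr_sumr -!big_split; apply: eq_bigr => q _ /=; ring.
  rewrite linE quadE.
  have := fh h h1; have := gh h h1.
  have := lin_bound h bM; have := lin_bound h b'M; have := quad_bound h cM; have := quad_bound h c'M.
  rewrite -/H; set B := lin b h; set B' := lin b' h; set Q := quad c h; set Q' := quad c' h.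
  move=> Q'b Qb B'b Bb.
  set gx := g x in g0 *; set fx := f x in f0 *.
  set r' := (X in `|X| <= M' * _ -> _); set r := (X in _ -> `|X| <= _ -> _) => r'b rb.
  have fE : f (fun p => x p + h p) = fx + B + Q + r by rewrite /r; ring.
  have gE : g (fun p => x p + h p) = gx + B' + Q' + r' by rewrite /r'; ring.
  rewrite fE gE.
  rewrite (_ : _ - _ = fx * r' + r * gx + B * Q' + Q * B' + B * r' + r * B' + Q * Q' + Q * r' + r * Q' + r * r'); last by ring.
  have T (p q : R) (i j : nat) : `|p| <= M * H ^+ i -> `|q| <= M' * H ^+ j ->
      (3 <= i + j)%N -> `|p * q| <= V * H ^+ 3.
    move=> pM qM ij; rewrite normrM (le_trans (ler_pM _ _ pM qM))//.
    rewrite mulrACA -exprD ler_wpM2l//.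
    by rewrite -(subnK ij) exprD ler_piMl ?exprn_ge0// exprn_ile1.
  have Bb1 : `|B| <= M * H ^+ 1 by [].
  have B'b1 : `|B'| <= M' * H ^+ 1 by [].
  have f00 : `|fx| <= M * H ^+ 0 by rewrite expr0 mulr1.
  have g00 : `|gx| <= M' * H ^+ 0 by rewrite expr0 mulr1.
  have -> : 10 * V * H ^+ 3 = V * H ^+ 3 + V * H ^+ 3 + V * H ^+ 3 + V * H ^+ 3 + V * H ^+ 3 +
     V * H ^+ 3 + V * H ^+ 3 + V * H ^+ 3 + V * H ^+ 3 + V * H ^+ 3 by ring.
  by do 9 (apply: le_normD2; last (apply: T; [eassumption|eassumption|by []])); apply: T; [eassumption|eassumption|by []].
Qed.

(** Beyond [n1 h = 1] boundedness suffices: the values at x + h and at x, the linear term and the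
    quadratic term are each at most M times the cube, which accounts for the 4. *)
Lemma T3_taylor K f : T3 K f -> exists2 M : R, 0 <= M & forall x, exists b c,
    K (f x) b c /\ forall h,
      `|f (fun p => x p + h p) - (f x + lin b h + quad c h)| <= M * n1 h ^+ 3.
Proof.
move=> [M M0 fM]; exists (4 * M); first by rewrite mulr_ge0.
move=> x; have [b [c [f0 bM cM Kf fh]]] := fM x; exists b, c; split => // h.
have H0 := n1_ge0 h.
have [h1|h1] := leP (n1 h) 1.
  by rewrite (le_trans (fh h h1))// ler_wpM2r ?exprn_ge0//; lra.
have [_ [_ [fxh _ _ _ _]]] := fM (fun p => x p + h p).
have := lin_bound h bM; have := quad_bound h cM; move: fxh f0 h1.
rewrite !ler_norml; set H := n1 h; set B := lin b h; set Q := quad c h.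
set u := f _; set v := f _ => /andP[u1 u2] /andP[v1 v2] H1 /andP[q1 q2] /andP[b1 b2].
have H2 : H <= H ^+ 3 by rewrite -{1}[H]expr1 ler_eXn2l// ltW.
have H3 : H ^+ 2 <= H ^+ 3 by rewrite ler_eXn2l// ltW.
have H4 : 1 <= H ^+ 3 by rewrite exprn_ege1// ltW.
have := ler_wpM2l M0 H2; have := ler_wpM2l M0 H3; have := ler_wpM2l M0 H4; rewrite mulr1.
by move=> ? ? ?; apply/andP; split; lra.
Qed.

(** Within distance 1 the linear, quadratic and error terms are each at most M times the distance;
    beyond it 2M bounds the difference. *)
Lemma T3_lip K f : T3 K f -> exists2 M : R, 0 <= M &
  forall x y, `|f x - f y| <= M * n1 (fun p => x p - y p).
Proof.
move=> [M M0 fM]; exists (3 * M); first by rewrite mulr_ge0.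
move=> x y; have [b [c [f0 bM cM Kf fh]]] := fM y.
pose h p := x p - y p; rewrite -/h.
have xE : x = (fun p => y p + h p) by apply/funext => p; rewrite /h addrC subrK.
have H0 := n1_ge0 h.
have [h1|h1] := leP (n1 h) 1; last first.
  have [_ [_ [fx _ _ _ _]]] := fM x.
  have := ler_wpM2l M0 (ltW h1); rewrite mulr1 => Mh.
  by rewrite (le_trans (ler_normB _ _))//; lra.
have := fh h h1; rewrite -xE; have := lin_bound h bM; have := quad_bound h cM.
rewrite !ler_norml; move: h1; set H := n1 h; set B := lin b h; set Q := quad c h.
set u := f _; set v := f _ => H1 /andP[q1 q2] /andP[b1 b2] /andP[r1 r2].
have H2 : H ^+ 3 <= H by rewrite -{2}[H]expr1 ler_wiXn2l.
have H3 : H ^+ 2 <= H by rewrite -{2}[H]expr1 ler_wiXn2l.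
have := ler_wpM2l M0 H2; have := ler_wpM2l M0 H3.
by move=> ? ?; apply/andP; split; lra.
Qed.

End taylor_class.

(** * The smooth surrogate of the min-max event *)

Section gordon_function.
Context {R : realType} {I J : finType}.
Implicit Types (x h b : I * J -> R) (c : I * J -> I * J -> R).
Variables (l c0 : R).
Hypothesis l0 : 0 <= l.

Definition gfun x : R := \prod_(i : I) (1 - \prod_(j : J) tau l c0 (x (i, j))).

(** Data kept for a product of logistic factors of row [i]: the gradient is nonpositive and lives on
    that row, and the Hessian is free inside a row. *)
Definition Kneg (i : I) (u : R) b c := [/\ 0 <= u <= 1, forall p, b p <= 0,
  forall p, p.1 != i -> b p = 0 & forall p q, p.1 != q.1 -> c p q = 0].
(** Gordon's sign condition. The Hessian is free inside a row, where the two covariances will agree.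
    The sign of the gradient is carried along because mixed second derivatives of a product contain
    products of first derivatives. *)
Definition Kpos (u : R) b c := [/\ 0 <= u, forall p, 0 <= b p &
  forall p q, p.1 != q.1 -> 0 <= c p q].

Lemma T3_cst1 (K : R -> (I * J -> R) -> (I * J -> I * J -> R) -> Prop) :
  K 1 (fun=> 0) (fun _ _ => 0) -> T3 K (fun=> 1).
Proof.
move=> K1; exists 1 => // x; exists (fun=> 0), (fun _ _ => 0); split => //.
- by rewrite normr1.
- by move=> p; rewrite normr0.
- by move=> p q; rewrite normr0.
- move=> h _; rewrite /lin /quad !big1; last 2 first.
  + by move=> p _; rewrite big1// => q _; rewrite mul0r.
  + by move=> p _; rewrite mul0r.
  by rewrite !addr0 subrr normr0 mul1r exprn_ge0// n1_ge0.
Qed.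

Lemma T3_tau i j : T3 (Kneg i) (fun x => tau l c0 (x (i, j))).
Proof.
have l2 : 0 <= l ^+ 2 by rewrite exprn_ge0.
have l3 : 0 <= l ^+ 3 by rewrite exprn_ge0.
(* One constant dominating the bounds 1, l, l^2 and l^3 of the logistic and its derivatives. *)
set L := 1 + l + l ^+ 2 + l ^+ 3.
have [L0 L1 Ll Ll2 Ll3] : [/\ 0 <= L, 1 <= L, l <= L, l ^+ 2 <= L & l ^+ 3 <= L].
  by rewrite /L; clear L; move: (l ^+ 2) (l ^+ 3) l2 l3 => a b a0 b0; have l0' := l0; split; lra.
exists L => //; move: L0 L1 Ll Ll2 Ll3; move: L => L L0 L1 Ll Ll2 Ll3.
move=> x; set u := x (i, j).
exists (fun p => if p == (i, j) then tau1 l c0 u else 0).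
exists (fun p q => if (p == (i, j)) && (q == (i, j)) then tau2 l c0 u / 2 else 0).
have /andP[t0 t1] := tau_bnd l c0 u.
have q0 : 0 <= tau l c0 u * (1 - tau l c0 u) by rewrite mulr_ge0 ?subr_ge0// ltW.
have q1 : tau l c0 u * (1 - tau l c0 u) <= 1.
  by rewrite -[leRHS]mulr1 ler_pM ?subr_ge0 ?(ltW t0) ?(ltW t1)//; lra.
split.
- by rewrite ger0_norm ?(ltW t0)// (le_trans (ltW t1)).
- move=> p; case: ifP => _; last by rewrite normr0.
  rewrite /tau1 mulNr normrN normrM ger0_norm// (ger0_norm q0).
  by have := ler_wpM2l l0 q1; rewrite mulr1 => /le_trans; apply.
- move=> p q; case: ifP => _; last by rewrite normr0.
  rewrite /tau2 normrM (ger0_norm (_ : 0 <= 2^-1)) ?invr_ge0//.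
  have : `|l ^+ 2 * (tau l c0 u * (1 - tau l c0 u) * (1 - 2 * tau l c0 u))| <= l ^+ 2.
    rewrite normrM ger0_norm// ler_piMr// normrM ger0_norm// -[leRHS]mulr1 ler_pM//.
    by rewrite ler_norml; apply/andP; split; lra.
  by set z := `|_|; lra.
- split.
  + by rewrite (ltW t0) (ltW t1).
  + by move=> p; case: ifP => // _; rewrite /tau1 mulNr oppr_le0 mulr_ge0.
  + by move=> [p p'] /= pi; rewrite xpair_eqE (negbTE pi).
  + move=> [p p'] [q q'] /= pq; case: ifP => // /andP[/eqP[pi _] /eqP[qi _]].
    by move: pq; rewrite pi qi eqxx.
- move=> h h1.
  have -> : lin (fun p => if p == (i, j) then tau1 l c0 u else 0) h = tau1 l c0 u * h (i, j).
    rewrite /lin (bigD1 (i, j))//= eqxx big1 ?addr0// => p /negbTE ->.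
    by rewrite mul0r.
  have -> : quad (fun p q => if (p == (i, j)) && (q == (i, j)) then tau2 l c0 u / 2 else 0) h =
      tau2 l c0 u / 2 * h (i, j) ^+ 2.
    rewrite /quad (bigD1 (i, j))//= eqxx [X in _ + X]big1 ?addr0; last first.
      by move=> p /negbTE ->; rewrite big1// => q _; rewrite mul0r.
    rewrite (bigD1 (i, j))//= eqxx big1 ?addr0 ?expr2// => p /negbTE ->.
    by rewrite mul0r.
  apply: (le_trans (taylor_tau _ _ _ _)); rewrite (ger0_norm l0).
  have hn : `|h (i, j)| <= n1 h by rewrite /n1 (bigD1 (i, j))//= lerDl sumr_ge0.
  apply: ler_pM; rewrite ?exprn_ge0//.
  by rewrite lerXn2r// nnegrE// n1_ge0.
Qed.

(** Each factor 1 - prod_j tau is nondecreasing in its own row and constant in the others, so mixed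
    derivatives across rows arise only as products of two nonnegative first derivatives with the
    remaining nonnegative factors. *)
Lemma T3_gfun : T3 Kpos gfun.
Proof.
have inner i : T3 Kpos (fun x => 1 - \prod_(j : J) tau l c0 (x (i, j))).
  have : T3 (Kneg i) (fun x => \prod_(j : J) tau l c0 (x (i, j))).
    elim: (index_enum J) => [|j r IH].
      rewrite (_ : (fun x => _) = (fun=> 1)); last by apply/funext => x; rewrite big_nil.
      by apply: T3_cst1; split => //; rewrite ler01 lexx.
    rewrite (_ : (fun x => _) = (fun x => tau l c0 (x (i, j)) * \prod_(j <- r) tau l c0 (x (i, j)))); last first.
      by apply/funext => x; rewrite big_cons.
    apply: T3_prod (T3_tau i j) IH.
    move=> u b c u' b' c' [/andP[u0 u1] b0 bi cp] [/andP[u'0 u'1] b'0 b'i c'p]; split.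
    - by rewrite mulr_ge0//= mulr_ile1.
    - by move=> p; have := b0 p; have := b'0 p; nra.
    - by move=> p pi; rewrite b'i// bi// !mulr0 addr0.
    - move=> p q pq; rewrite cp// c'p// !mulr0 !add0r.
      have [pi|/bi ->] := eqVneq p.1 i; last by rewrite mul0r.
      by rewrite b'i ?mulr0// -pi eq_sym.
  move=> [M M0 HM]; exists (1 + M); first by rewrite addr_ge0.
  move=> x; have [b [c [f0 bM cM [/andP[u0 u1] b0 bi cp] fh]]] := HM x.
  exists (fun p => - b p), (fun p q => - c p q); split.
  - by rewrite (le_trans (ler_normB _ _))// normr1 lerD2l.
  - by move=> p; rewrite normrN (le_trans (bM p))// lerDr.
  - by move=> p q; rewrite normrN (le_trans (cM p q))// lerDr.
  - split; first by rewrite subr_ge0.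
    + by move=> p; rewrite oppr_ge0.
    + by move=> p q pq; rewrite cp// oppr0.
  - move=> h h1; have := fh h h1.
    have -> : lin (fun p => - b p) h = - lin b h.
      by rewrite /lin -sumrN; apply: eq_bigr => p _; rewrite mulNr.
    have -> : quad (fun p q => - c p q) h = - quad c h.
      rewrite /quad -sumrN; apply: eq_bigr => p _; rewrite -sumrN.
      by apply: eq_bigr => q _; rewrite mulNr.
    set p1 := \prod_j tau l c0 (x (i, j) + h (i, j)); set p0 := \prod_j _.
    move=> H; rewrite (_ : 1 - p1 - _ = - (p1 - (p0 + lin b h + quad c h))) ?normrN; last by ring.
    by apply: (le_trans H); rewrite ler_wpM2r ?exprn_ge0 ?n1_ge0// lerDr.
rewrite /gfun; elim: (index_enum I) => [|i r IH].
  rewrite (_ : (fun x => _) = (fun=> 1)); last by apply/funext => x; rewrite big_nil.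
  exact: T3_cst1.
rewrite (_ : (fun x => _) = (fun x => (1 - \prod_j tau l c0 (x (i, j))) *
    \prod_(i <- r) (1 - \prod_j tau l c0 (x (i, j))))); last first.
  by apply/funext => x; rewrite big_cons.
apply: T3_prod (inner i) IH.
move=> u b c u' b' c' [u0 b0 cp] [u'0 b'0 c'p]; split; first exact: mulr_ge0.
  by move=> p; rewrite addr_ge0// mulr_ge0.
by move=> p q pq; rewrite !addr_ge0// mulr_ge0// ?cp ?c'p.
Qed.

Lemma gfun_bnd x : 0 <= gfun x <= 1.
Proof.
have t01 i j : 0 <= tau l c0 (x (i, j)) <= 1.
  by have /andP[t0 t1] := tau_bnd l c0 (x (i, j)); rewrite !ltW.
have p01 i : 0 <= \prod_j tau l c0 (x (i, j)) <= 1.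
  apply/andP; split; first by apply: prodr_ge0 => j _; case/andP: (t01 i j).
  by rewrite prodr_ile1// => j _; exact: t01.
apply/andP; split; first by apply: prodr_ge0 => i _; rewrite subr_ge0; case/andP: (p01 i).
apply: prodr_ile1 => i _; case/andP: (p01 i) => p0 p1.
by rewrite subr_ge0 p1 gerBl.
Qed.

End gordon_function.

(** * Moments of linear Gaussian fields *)

Section gaussian_monomials.
Context {R : realType}.
Implicit Types (w v : nat -> R) (N : nat).

Lemma gint_pow_norm e : gint (fun x : R => `|x| ^+ e).
Proof.
apply: (@gint_le_exp _ _ 1 e%:R).
  by apply: measurable_funX; exact: normr_measurable.
move=> x; rewrite ger0_norm ?exprn_ge0// mul1r expRM_natl.
by rewrite lerXn2r ?nnegrE ?expR_ge0// expR_ge_norm.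
Qed.

Lemma gint_pow e : gint (fun x : R => x ^+ e).
Proof.
apply: (@le_gint _ _ (fun x : R => `|x| ^+ e)); last exact: gint_pow_norm.
  exact: measurable_funX.
by move=> x; rewrite normrX.
Qed.

(** Writes one coordinate as a product over all of them, the form that [SI_prod] integrates. *)
Lemma prod_delta N r w : (r < N)%N -> \prod_(i < N) w i ^+ (i == r :> nat) = w r.
Proof.
move=> rN; rewrite (bigD1 (Ordinal rN))//= eqxx big1 ?mulr1// => i ir.
by rewrite -val_eqE/= in ir; rewrite (negbTE ir).
Qed.

Lemma SI_coord N r : (r < N)%N ->
  SI N (fun w : nat -> R => w r) /\ gEn N (fun w => w r) = 0.
Proof.
move=> rN; have [H1 H2] := @SI_prod R N (fun i x => x ^+ (i == r)) 1 (fun i _ => gint_pow _).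
have E w : 1 * \prod_(i < N) w i ^+ (i == r :> nat) = w r by rewrite mul1r prod_delta.
split; first exact: eq_SI H1.
rewrite -(eq_gEn _ E) H2 mul1r (bigD1 (Ordinal rN))//= eqxx.
by rewrite (gE_id (R := R)).2 mul0r.
Qed.

Lemma SI_coord2 N r s : (r < N)%N -> (s < N)%N ->
  SI N (fun w : nat -> R => w r * w s) /\ gEn N (fun w => w r * w s) = (r == s)%:R.
Proof.
move=> rN sN.
have [H1 H2] := @SI_prod R N (fun i x => x ^+ ((i == r) + (i == s))) 1 (fun i _ => gint_pow _).
have E w : 1 * \prod_(i < N) w i ^+ ((i == r :> nat) + (i == s :> nat)) = w r * w s.
  rewrite mul1r -[in RHS](prod_delta w rN) -[in RHS](prod_delta w sN) -big_split.
  by apply: eq_bigr => i _ /=; rewrite exprD.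
split; first exact: eq_SI H1.
rewrite -(eq_gEn _ E) H2 mul1r.
have [<-|rs] := eqVneq r s.
  rewrite big1// => i _; case: eqP => _ /=; last by rewrite gE_cst.
  exact: (gE_sqr (R := R)).2.
rewrite (bigD1 (Ordinal rN))//= eqxx (negbTE rs).
by rewrite (gE_id (R := R)).2 mul0r.
Qed.

Lemma SI_cube N : SI N (fun w : nat -> R => (\sum_(i < N) `|w i|) ^+ 3).
Proof.
have H (r s t : 'I_N) : SI N (fun w : nat -> R => `|w r| * `|w s| * `|w t|).
  have [H1 _] := @SI_prod R N (fun i x => `|x| ^+ ((i == r) + (i == s) + (i == t))) 1 (fun i _ => gint_pow_norm _).
  apply: eq_SI H1 => w; rewrite mul1r.
  rewrite -[in RHS](prod_delta (fun i => `|w i|) (ltn_ord r)) -[in RHS](prod_delta (fun i => `|w i|) (ltn_ord s)).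
  rewrite -[in RHS](prod_delta (fun i => `|w i|) (ltn_ord t)) -!big_split.
  by apply: eq_bigr => i _ /=; rewrite !exprD.
have S1 := (@SI_sum R N _ _ (fun r => (@SI_sum R N _ _ (fun s => (@SI_sum R N _ _ (H r s)).1)).1)).1.
apply: eq_SI S1 => w; rewrite !exprS expr0 mulr1 mulr_suml; apply: eq_bigr => r _.
rewrite mulr_suml mulr_sumr; apply: eq_bigr => s _.
by rewrite mulr_sumr mulr_sumr; apply: eq_bigr => t _; rewrite mulrA.
Qed.

Context {P : finType}.
Implicit Types (X : P -> nat -> R).

(** The fields to be compared are given by their coefficients on independent normals, so that [cov]
    is their covariance. *)
Definition xi N X w (p : P) : R := \sum_(r < N) X p r * w r.
Definition cov N X (p q : P) : R := \sum_(r < N) X p r * X q r.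

Lemma xi_n1 N X : exists2 B : R, 0 <= B & forall w w',
  n1 (fun p => xi N X w p - xi N X w' p) <= B * nd N w w'.
Proof.
exists (\sum_p \sum_(r < N) `|X p r|); first by apply: sumr_ge0 => p _; apply: sumr_ge0.
move=> w w'; rewrite mulr_suml; apply: ler_sum => p _.
rewrite /xi -sumrB (le_trans (ler_norm_sum _ _ _))// mulr_suml.
apply: ler_sum => r _; rewrite -mulrBr normrM ler_wpM2l//.
by rewrite /nd (bigD1 r)//= lerDl sumr_ge0.
Qed.

Lemma gEn_lin N X (b : P -> R) :
  SI N (fun w => lin b (xi N X w)) /\ gEn N (fun w => lin b (xi N X w)) = 0.
Proof.
have H (p : P) : SI N (fun w => b p * xi N X w p) /\ gEn N (fun w => b p * xi N X w p) = 0.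
  have H0 (r : 'I_N) := SI_scale (X p r) (SI_coord (ltn_ord r)).1.
  have [H1 H2] := @SI_sum R N _ _ (fun r : 'I_N => (H0 r).1).
  have [H3 H4] := SI_scale (b p) H1.
  split => //; rewrite H4 H2 big1 ?mulr0// => r _.
  by rewrite (H0 r).2 (SI_coord (ltn_ord r)).2 mulr0.
have [H1 H2] := @SI_sum R N _ _ (fun p => (H p).1).
by split => //; rewrite H2 big1// => p _; rewrite (H p).2.
Qed.

Lemma gEn_quad N X (c : P -> P -> R) :
  SI N (fun w => quad c (xi N X w)) /\
  gEn N (fun w => quad c (xi N X w)) = \sum_p \sum_q c p q * cov N X p q.
Proof.
have H (p q : P) : SI N (fun w => c p q * (xi N X w p * xi N X w q)) /\
    gEn N (fun w => c p q * (xi N X w p * xi N X w q)) = c p q * cov N X p q.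
  have H0 (r s : 'I_N) := SI_scale (X p r * X q s) (SI_coord2 (ltn_ord r) (ltn_ord s)).1.
  have H1 (r : 'I_N) := @SI_sum R N _ _ (fun s : 'I_N => (H0 r s).1).
  have [H3 H4] := @SI_sum R N _ _ (fun r => (H1 r).1).
  have E w : \sum_(r < N) \sum_(s < N) X p r * X q s * (w r * w s) = xi N X w p * xi N X w q.
    rewrite /xi mulr_suml; apply: eq_bigr => r _; rewrite mulr_sumr.
    by apply: eq_bigr => s _; rewrite mulrACA.
  have [H5 H6] := SI_scale (c p q) (eq_SI E H3).
  split => //; rewrite H6 -(eq_gEn _ E) H4; congr (_ * _).
  apply: eq_bigr => r _; rewrite (H1 r).2 (bigD1 r)//= big1 ?addr0.
    by rewrite (H0 r r).2 (SI_coord2 (ltn_ord r) (ltn_ord r)).2 eqxx mulr1.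
  move=> s sr; rewrite (H0 r s).2 (SI_coord2 (ltn_ord r) (ltn_ord s)).2.
  by rewrite eq_sym -val_eqE in sr; rewrite (negbTE sr) mulr0.
have H1 (p : P) := @SI_sum R N _ _ (fun q => (H p q).1).
have [H2 H3] := @SI_sum R N _ _ (fun p => (H1 p).1).
split => //; rewrite H3; apply: eq_bigr => p _; rewrite (H1 p).2.
by apply: eq_bigr => q _; rewrite (H p q).2.
Qed.

End gaussian_monomials.

(** * Gordon's comparison inequality by Lindeberg replacement *)

Section gordon.
Context {R : realType} {I J : finType}.
Notation P := (I * J)%type.
Variables (f : (P -> R) -> R) (T3f : T3 Kpos f).
Variables (NX NY : nat) (X Y : P -> nat -> R).
Hypothesis covE : forall p q : P, p.1 = q.1 -> cov NX X p q = cov NY Y p q.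
Hypothesis covL : forall p q : P, cov NY Y p q <= cov NX X p q.

Lemma scale_norm (e x : R) : 0 <= e -> e * `|x| = `|e * x|.
Proof. by move=> e0; rewrite normrM ger0_norm. Qed.

Lemma lip_SI N g (C : R) : (forall y y', `|g y - g y'| <= C * nd N y y') -> SI N g.
Proof.
move=> gC; have [||S _] := @lip_gEn R unit (fun _ _ => 0) C N (fun _ => g).
- by [].
- by move=> _ _ y y'; rewrite add0r.
exact: (S tt).
Qed.

Lemma lip3 NZ (Z : P -> nat -> R) (a b e : R) : 0 <= a -> 0 <= b -> 0 <= e ->
  exists2 C : R, 0 <= C & forall w w1 y y1 z z1,
  `|f (fun p => a * xi NX X w p + b * xi NY Y y p + e * xi NZ Z z p) -
    f (fun p => a * xi NX X w1 p + b * xi NY Y y1 p + e * xi NZ Z z1 p)| <=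
   C * (nd NX w w1 + nd NY y y1 + nd NZ z z1).
Proof.
move=> a0 b0 e0; have [M M0 fM] := T3_lip T3f.
have [BX BX0 HX] := xi_n1 NX X; have [BY BY0 HY] := xi_n1 NY Y; have [BZ BZ0 HZ] := xi_n1 NZ Z.
exists (M * (a * BX + b * BY + e * BZ)); first by rewrite mulr_ge0// !addr_ge0// mulr_ge0.
move=> w w1 y y1 z z1; apply: (le_trans (fM _ _)); rewrite -mulrA ler_wpM2l//.
apply: (@le_trans _ _ (a * n1 (fun p => xi NX X w p - xi NX X w1 p) +
   b * n1 (fun p => xi NY Y y p - xi NY Y y1 p) + e * n1 (fun p => xi NZ Z z p - xi NZ Z z1 p))).
  rewrite /n1 !mulr_sumr -!big_split; apply: ler_sum => p _ /=.
  rewrite !scale_norm//.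
  apply: le_trans (lerD (ler_normD _ _) (lexx _)); apply: le_trans (ler_normD _ _).
  by rewrite le_eqVlt; apply/orP; left; apply/eqP; congr `|_|; ring.
have := ler_wpM2l a0 (HX w w1); have := ler_wpM2l b0 (HY y y1); have := ler_wpM2l e0 (HZ z z1).
have := nd_ge0 NX w w1; have := nd_ge0 NY y y1; have := nd_ge0 NZ z z1.
have := mulr_ge0 a0 BX0; have := mulr_ge0 b0 BY0; have := mulr_ge0 e0 BZ0.
rewrite !(mulrA _ BX) !(mulrA _ BY) !(mulrA _ BZ).
move: (a * BX) (b * BY) (e * BZ) (nd NX w w1) (nd NY y y1) (nd NZ z z1) => A B E d1 d2 d3.
move: (a * n1 _) (b * n1 _) (e * n1 _) => u1 u2 u3 E0 B0 A0 d30 d20 d10 h3 h2 h1.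
have := mulr_ge0 A0 d20; have := mulr_ge0 A0 d30; have := mulr_ge0 B0 d10.
have := mulr_ge0 B0 d30; have := mulr_ge0 E0 d10; have := mulr_ge0 E0 d20.
by lra.
Qed.

Lemma xi_axpy N (Z : P -> nat -> R) (a b : R) w w' p :
  xi N Z (fun i => a * w i + b * w' i) p = a * xi N Z w p + b * xi N Z w' p.
Proof.
by rewrite /xi !mulr_sumr -big_split; apply: eq_bigr => r _ /=; ring.
Qed.

Lemma xi_scale N (Z : P -> nat -> R) (a : R) w p :
  xi N Z (fun i => a * w i) p = a * xi N Z w p.
Proof. by rewrite /xi mulr_sumr; apply: eq_bigr => r _ /=; ring. Qed.

(** The linear term has mean zero and the quadratic one sees only the covariance. [K] is chosen
    before [v], [b], [c] and [e], so that the errors of all replacement steps can be added. *)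
Lemma taylor_mean N (Z : P -> nat -> R) (M : R) : 0 <= M -> exists2 K : R, 0 <= K &
  forall (v b : P -> R) c (e : R), 0 <= e ->
   (forall h, `|f (fun p => v p + h p) - (f v + lin b h + quad c h)| <= M * n1 h ^+ 3) ->
   `|gEn N (fun w => f (fun p => v p + e * xi N Z w p)) -
     (f v + e ^+ 2 * \sum_p \sum_q c p q * cov N Z p q)| <= K * e ^+ 3.
Proof.
move=> M0; have [B B0 HB] := xi_n1 N Z.
pose cu (w : nat -> R) : R := (\sum_(i < N) `|w i|) ^+ 3.
have cu0 w : 0 <= cu w by rewrite exprn_ge0// sumr_ge0.
have S0 := SI_cst N (0 : R).
exists (M * B ^+ 3 * gEn N cu).
  by rewrite mulr_ge0 ?mulr_ge0 ?exprn_ge0// -[leLHS]S0.2; apply: le_gEn => //; [exact: S0.1|exact: SI_cube].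
move=> v b c e e0 fh.
have SF : SI N (fun w => f (fun p => v p + e * xi N Z w p)).
  have [L L0 fL] := T3_lip T3f.
  apply: (@lip_SI _ _ (L * (e * B))) => y y'; apply: (le_trans (fL _ _)).
  rewrite -mulrA ler_wpM2l// -mulrA; apply: le_trans (ler_wpM2l e0 (HB y y')).
  rewrite /n1 mulr_sumr; apply: ler_sum => p _.
  by rewrite scale_norm// le_eqVlt; apply/orP; left; apply/eqP; congr `|_|; ring.
have Sf := SI_cst N (f v).
have Sl := SI_scale e (gEn_lin N Z b).1.
have Sq := SI_scale (e ^+ 2) (gEn_quad N Z c).1.
have Sc (s : R) := SI_scale (s * (M * B ^+ 3 * e ^+ 3)) (SI_cube (R := R) N).
have Sm (s : R) := SI_add (SI_add (SI_add Sf.1 Sl.1).1 Sq.1).1 (Sc s).1.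
have val s : gEn N (fun w => f v + e * lin b (xi N Z w) + e ^+ 2 * quad c (xi N Z w) +
     s * (M * B ^+ 3 * e ^+ 3) * cu w) =
   f v + e ^+ 2 * \sum_p \sum_q c p q * cov N Z p q + s * (M * B ^+ 3 * gEn N cu * e ^+ 3).
  rewrite (Sm s).2 (Sc s).2 (SI_add (SI_add Sf.1 Sl.1).1 Sq.1).2 (SI_add Sf.1 Sl.1).2.
  rewrite Sf.2 Sl.2 Sq.2 (gEn_lin N Z b).2 (gEn_quad N Z c).2 -/cu.
  by ring.
have pt w : `|f (fun p => v p + e * xi N Z w p) -
   (f v + e * lin b (xi N Z w) + e ^+ 2 * quad c (xi N Z w))| <= M * B ^+ 3 * e ^+ 3 * cu w.
  have := fh (fun p => e * xi N Z w p).
  have -> : lin b (fun p => e * xi N Z w p) = e * lin b (xi N Z w).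
    by rewrite /lin mulr_sumr; apply: eq_bigr => p _; ring.
  have -> : quad c (fun p => e * xi N Z w p) = e ^+ 2 * quad c (xi N Z w).
    rewrite /quad mulr_sumr; apply: eq_bigr => p _; rewrite mulr_sumr.
    by apply: eq_bigr => q _; ring.
  move=> /le_trans; apply.
  rewrite (_ : M * B ^+ 3 * e ^+ 3 * cu w = M * (B * (e * \sum_(i < N) `|w i|)) ^+ 3); last first.
    by rewrite /cu !exprMn !mulrA.
  apply: ler_wpM2l => //.
  have : n1 (fun p => e * xi N Z w p) <= B * (e * \sum_(i < N) `|w i|).
    have := HB w (fun=> 0); rewrite /nd; under [X in _ <= _ * X -> _]eq_bigr do rewrite subr0.
    have -> : (fun p => xi N Z w p - xi N Z (fun=> 0) p) = xi N Z w.
      apply/funext => p; rewrite [X in _ - X](_ : _ = 0) ?subr0//.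
      by rewrite /xi big1// => r _; rewrite mulr0.
    move=> /(ler_wpM2l e0); rewrite mulrCA; apply: le_trans.
    rewrite /n1 mulr_sumr le_eqVlt; apply/orP; left; apply/eqP; apply: eq_bigr => p _.
    by rewrite normrM (ger0_norm e0).
  move=> H; rewrite lerXn2r// nnegrE ?n1_ge0//.
  by rewrite !mulr_ge0// sumr_ge0.
rewrite ler_norml; apply/andP; split.
- rewrite lerBrDr addrC -[X in _ + X]mulN1r -val; apply: le_gEn => //; first exact: (Sm (-1)).1.
  by move=> w; have := pt w; rewrite ler_norml => /andP[+ _]; rewrite -/(cu w); lra.
- rewrite lerBlDr addrC -[X in _ + X]mul1r -val; apply: le_gEn => //; first exact: (Sm 1).1.
  by move=> w; have := pt w; rewrite ler_norml => /andP[_ +]; rewrite -/(cu w); lra.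
Qed.

(** To second order the two means differ by e^2 times the sum of [c p q] times the covariance gap.
    The gap vanishes inside a row, and across rows both factors are nonnegative. *)
Lemma gordon_step : exists2 K : R, 0 <= K & forall (v : P -> R) (e : R), 0 <= e ->
  gEn NY (fun w => f (fun p => v p + e * xi NY Y w p)) - K * e ^+ 3 <=
  gEn NX (fun w => f (fun p => v p + e * xi NX X w p)).
Proof.
have [M M0 HM] := T3_taylor T3f.
have [KX KX0 HX] := taylor_mean NX X M0; have [KY KY0 HY] := taylor_mean NY Y M0.
exists (KX + KY); first exact: addr_ge0.
move=> v e e0; have [b [c [[_ _ cp] fh]]] := HM v.
have := HX v b c e e0 fh; have := HY v b c e e0 fh; rewrite !ler_norml.
have : \sum_p \sum_q c p q * cov NY Y p q <= \sum_p \sum_q c p q * cov NX X p q.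
  apply: ler_sum => p _; apply: ler_sum => q _.
  have [pq|pq] := eqVneq p.1 q.1; first by rewrite (covE pq).
  by rewrite ler_wpM2l ?cp.
move=> /(ler_wpM2l (sqr_ge0 e)).
set u := _ * \sum_p _; set u' := _ * \sum_p _ => uu /andP[h1 h2] /andP[h3 h4].
by rewrite mulrDl; lra.
Qed.

(** The interpolation between independent copies of the two fields; the path followed has a^2 + b^2
    = 1, from (0, 1) to (1, 0). *)
Definition mixed (a b : R) : R := gEn NX (fun w => gEn NY (fun y =>
  f (fun p => a * xi NX X w p + b * xi NY Y y p))).

(** By stability sqrt(b^2 + e^2) Y has the law of b Y + e Y' with Y' an independent copy, and
    likewise for X. With a X + b Y held fixed, only the small increment is exchanged, which is
    [gordon_step]. *)
Lemma mixed_step : exists2 K : R, 0 <= K & forall a b e : R, 0 <= a -> 0 <= b -> 0 <= e ->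
  mixed a (Num.sqrt (b ^+ 2 + e ^+ 2)) - K * e ^+ 3 <= mixed (Num.sqrt (a ^+ 2 + e ^+ 2)) b.
Proof.
have [K K0 HK] := gordon_step; exists K => // a b e a0 b0 e0.
pose GX w y z := f (fun p => a * xi NX X w p + b * xi NY Y y p + e * xi NX X z p).
pose GY w y z := f (fun p => a * xi NX X w p + b * xi NY Y y p + e * xi NY Y z p).
have EX : mixed (Num.sqrt (a ^+ 2 + e ^+ 2)) b = gEn NX (fun w => gEn NY (fun y => gEn NX (GX w y))).
  pose Phi w := gEn NY (fun y => f (fun p => xi NX X w p + b * xi NY Y y p)).
  transitivity (gEn NX (fun w => Phi (fun i => Num.sqrt (a ^+ 2 + e ^+ 2) * w i))).
    apply: eq_gEn => w; apply: eq_gEn => y; congr f; apply/funext => p.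
    by rewrite xi_scale.
  have [C C0 HC] := lip3 NX X ler01 b0 (lexx 0).
  have PhiC w w' : `|Phi w - Phi w'| <= C * nd NX w w'.
    have [||_] := @lip_gEn R (nat -> R) (nd NX) C NY (fun w y => f (fun p => xi NX X w p + b * xi NY Y y p)).
    - exact: ndxx.
    - move=> x x' y y'; have := HC x x' y y' (fun=> 0) (fun=> 0); rewrite ndxx addr0.
      by under [X in f X]eq_fun do rewrite mul1r mul0r addr0; under [X in _ - f X]eq_fun do rewrite mul1r mul0r addr0.
    by apply.
  rewrite -(gEn_stable PhiC a0 e0); apply: eq_gEn => w.
  have [C' C'0 HC'] := lip3 NX X a0 b0 e0.
  rewrite -(@gEn_swap R C' NX NY (fun z y => GX w y z)).
    apply: eq_gEn => z; apply: eq_gEn => y; congr f; apply/funext => p.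
    by rewrite xi_axpy addrAC.
  move=> z z' y y'; apply: (le_trans (HC' _ _ _ _ _ _)).
  by rewrite ndxx add0r addrC.
have EY : mixed a (Num.sqrt (b ^+ 2 + e ^+ 2)) = gEn NX (fun w => gEn NY (fun y => gEn NY (GY w y))).
  apply: eq_gEn => w.
  pose g y := f (fun p => a * xi NX X w p + xi NY Y y p).
  have [C C0 HC] := lip3 NX X a0 ler01 (lexx 0).
  have gC y y' : `|g y - g y'| <= C * nd NY y y'.
    have := HC w w y y' (fun=> 0) (fun=> 0); rewrite !ndxx addr0 add0r /g.
    by under [X in f X]eq_fun do rewrite mul1r mul0r addr0; under [X in _ - f X]eq_fun do rewrite mul1r mul0r addr0.
  transitivity (gEn NY (fun y => g (fun i => Num.sqrt (b ^+ 2 + e ^+ 2) * y i))).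
    by apply: eq_gEn => y; congr f; apply/funext => p; rewrite xi_scale.
  rewrite -(gEn_stable gC b0 e0); apply: eq_gEn => y; apply: eq_gEn => z.
  by congr f; apply/funext => p; rewrite xi_axpy addrA.
have SIG NZ (Z : P -> nat -> R) :
    (forall w, SI NY (fun y => gEn NZ (fun z => f (fun p => a * xi NX X w p + b * xi NY Y y p + e * xi NZ Z z p)))) /\
    SI NX (fun w => gEn NY (fun y => gEn NZ (fun z => f (fun p => a * xi NX X w p + b * xi NY Y y p + e * xi NZ Z z p)))).
  have [C C0 HC] := lip3 NZ Z a0 b0 e0.
  have [||_ L1] := @lip_gEn R ((nat -> R) * (nat -> R))%type (fun u v => nd NX u.1 v.1 + nd NY u.2 v.2) C NZ
     (fun u z => f (fun p => a * xi NX X u.1 p + b * xi NY Y u.2 p + e * xi NZ Z z p)).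
  - by move=> u; rewrite !ndxx addr0.
  - by move=> u u' z z'; exact: HC.
  have [||S2 L2] := @lip_gEn R (nat -> R) (nd NX) C NY
     (fun w y => gEn NZ (fun z => f (fun p => a * xi NX X w p + b * xi NY Y y p + e * xi NZ Z z p))).
  - exact: ndxx.
  - by move=> w w' y y'; exact: (L1 (w, y) (w', y')).
  by split => //; exact: lip_SI L2.
have [SX1 SX2] := SIG NX X; have [SY1 SY2] := SIG NY Y.
rewrite EX EY -mulN1r.
have inner w : gEn NY (fun y => gEn NY (GY w y)) + -1 * (K * e ^+ 3) <= gEn NY (fun y => gEn NX (GX w y)).
  have [c1 c2] := SI_cst NY (-1 * (K * e ^+ 3)).
  rewrite -{1}c2 -(SI_add (SY1 w) c1).2; apply: le_gEn; [exact: (SI_add (SY1 w) c1).1|exact: SX1|].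
  by move=> y; rewrite mulN1r; exact: HK.
have [c1 c2] := SI_cst NX (-1 * (K * e ^+ 3)).
by rewrite -{1}c2 -(SI_add SY2 c1).2; apply: le_gEn; [exact: (SI_add SY2 c1).1|exact: SX2|exact: inner].
Qed.

(* Lindeberg: replace Y by X in k^2 steps of size 1/k. *)
Lemma gordon_comparison :
  gEn NY (fun y => f (xi NY Y y)) <= gEn NX (fun w => f (xi NX X w)).
Proof.
have [K K0 HK] := mixed_step.
have -> : gEn NX (fun w => f (xi NX X w)) = mixed 1 0.
  apply: eq_gEn => w; have [_ <-] := SI_cst NY (f (xi NX X w)).
  by apply: eq_gEn => y; congr f; apply/funext => p; rewrite mul1r mul0r addr0.
have -> : gEn NY (fun y => f (xi NY Y y)) = mixed 0 1.
  have [_ <-] := SI_cst NX (gEn NY (fun y => f (xi NY Y y))).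
  apply: eq_gEn => w.
  by apply: eq_gEn => y; congr f; apply/funext => p; rewrite mul1r mul0r add0r.
have step (k : nat) : (0 < k)%N -> mixed 0 1 - K / k%:R <= mixed 1 0.
  move=> k0; have kR : 0 < k%:R :> R by rewrite ltr0n.
  (* One step exchanges variance 1/k^2 at the cost K/k^3, so k^2 steps cost K/k in total. *)
  pose e : R := k%:R^-1; have e0 : 0 <= e by rewrite invr_ge0 ltW.
  have e2 : e ^+ 2 * (k * k)%:R = 1 by rewrite /e natrM; field; exact: lt0r_neq0.
  have H (j : nat) : (j <= k * k)%N -> mixed 0 1 - K * e ^+ 3 * j%:R <=
      mixed (Num.sqrt (e ^+ 2 * j%:R)) (Num.sqrt (e ^+ 2 * (k * k - j)%:R)).
    elim: j => [_|j IH jk].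
      by rewrite !mulr0 sqrtr0 subn0 e2 sqrtr1 subr0.
    have := HK (Num.sqrt (e ^+ 2 * j%:R)) (Num.sqrt (e ^+ 2 * (k * k - j.+1)%:R)) e
       (sqrtr_ge0 _) (sqrtr_ge0 _) e0.
    rewrite !sqr_sqrtr ?mulr_ge0 ?exprn_ge0//.
    have -> : e ^+ 2 * j%:R + e ^+ 2 = e ^+ 2 * j.+1%:R by rewrite -natr1; ring.
    have -> : e ^+ 2 * (k * k - j.+1)%:R + e ^+ 2 = e ^+ 2 * (k * k - j)%:R.
      by rewrite -(subnSK jk) -[in RHS]natr1; ring.
    apply: le_trans; have := IH (ltnW jk); rewrite -natr1.
    by set u := mixed _ _; set v := mixed _ _; lra.
  have := H (k * k)%N (leqnn _); rewrite subnn mulr0 sqrtr0 e2 sqrtr1.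
  suff -> : K * e ^+ 3 * (k * k)%:R = K / k%:R by [].
  by rewrite /e natrM; field; exact: lt0r_neq0.
apply/ler_addgt0Pr => d d0.
pose k := (Num.truncn (K / d)).+1.
have kd : K / k%:R <= d.
  rewrite ler_pdivrMr ?ltr0n// mulrC -ler_pdivrMr//.
  by apply: ltW; exact: truncnS_gt.
have := step k isT; lra.
Qed.

End gordon.

(** * Gordon's inequality for a Gaussian matrix *)

Section gordon_matrix.
Context {R : realType}.

(** Row-major numbering of the entries, in agreement with [mat_of]. *)
Lemma sum_ord_mul (m n : nat) (G : nat -> R) :
  \sum_(r < m * n) G r = \sum_(k < m) \sum_(l < n) G (k * n + l)%N.
Proof.
rewrite -(big_mkord predT) big_nat_mul big_mkord; apply: eq_bigr => k _.
rewrite -[(k * n)%N]add0n big_addn mulSn addnK big_mkord.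
by apply: eq_bigr => l _; rewrite addnC.
Qed.

(* Coefficients of the processes g0 + z.Aw and z.g + w.h on their independent normals. *)
Definition Xcoef (n : nat) (z w : nat -> R) (r : nat) : R :=
  if r is r'.+1 then z (r' %/ n)%N * w (r' %% n)%N else 1.
Definition Ycoef (m : nat) (z w : nat -> R) (r : nat) : R :=
  if (r < m)%N then z r else w (r - m)%N.

Definition bil (m n : nat) (z : nat -> R) (v : nat -> R) (w : nat -> R) : R :=
  \sum_(k < m) \sum_(l < n) z k * v (k * n + l)%N * w l.
Definition dot (n : nat) (z w : nat -> R) : R := \sum_(k < n) z k * w k.

Lemma divmod_kl (n k l : nat) : (l < n)%N -> ((k * n + l) %/ n = k /\ (k * n + l) %% n = l)%N.
Proof.
move=> ln; have n0 : (0 < n)%N by case: n ln.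
by rewrite divnMDl// divn_small// addn0 modnMDl modn_small.
Qed.

Lemma sum_Xcoef m n z w (g0 : R) v :
  \sum_(r < (m * n).+1) Xcoef n z w r * scons g0 v r = g0 + bil m n z v w.
Proof.
rewrite big_ord_recl/= mul1r; congr (_ + _).
rewrite (sum_ord_mul m n (fun r => z (r %/ n)%N * w (r %% n)%N * v r)).
apply: eq_bigr => k _; apply: eq_bigr => l _.
by have [-> ->] := divmod_kl k (ltn_ord l); ring.
Qed.

Lemma cov_Xcoef m n z w z' w' :
  \sum_(r < (m * n).+1) Xcoef n z w r * Xcoef n z' w' r = 1 + dot m z z' * dot n w w'.
Proof.
rewrite big_ord_recl/= mul1r; congr (_ + _).
rewrite (sum_ord_mul m n (fun r => z (r %/ n)%N * w (r %% n)%N * (z' (r %/ n)%N * w' (r %% n)%N))).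
rewrite /dot mulr_suml; apply: eq_bigr => k _; rewrite mulr_sumr; apply: eq_bigr => l _.
by have [-> ->] := divmod_kl k (ltn_ord l); ring.
Qed.

Lemma sum_Ycoef m n z w (v : nat -> R) :
  \sum_(r < m + n) Ycoef m z w r * v r = dot m z v + dot n w (fun l => v (m + l)%N).
Proof.
rewrite big_split_ord /=; congr (_ + _); apply: eq_bigr => k _ /=.
  by rewrite /Ycoef ltn_ord.
by rewrite /Ycoef ltnNge leq_addr/= addKn.
Qed.

Lemma cov_Ycoef m n z w z' w' :
  \sum_(r < m + n) Ycoef m z w r * Ycoef m z' w' r = dot m z z' + dot n w w'.
Proof.
rewrite sum_Ycoef; congr (_ + _); apply: eq_bigr => k _ /=; rewrite /Ycoef ?ltn_ord//.
by rewrite ltnNge leq_addr/= addKn.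
Qed.

Lemma dot_le1 n (z w : nat -> R) : dot n z z = 1 -> dot n w w = 1 -> dot n z w <= 1.
Proof.
move=> z1 w1.
have : 0 <= dot n (fun k => z k - w k) (fun k => z k - w k).
  by apply: sumr_ge0 => k _; rewrite -expr2 sqr_ge0.
have -> : dot n (fun k => z k - w k) (fun k => z k - w k) = dot n z z + dot n w w - 2 * dot n z w.
  by rewrite /dot mulr_sumr -big_split -sumrB; apply: eq_bigr => k _ /=; ring.
by rewrite z1 w1; lra.
Qed.

Context {I J : finType}.
Variables (m n : nat) (Zv Wv : I * J -> nat -> R).
Hypothesis Z1 : forall p, dot m (Zv p) (Zv p) = 1.
Hypothesis W1 : forall p, dot n (Wv p) (Wv p) = 1.
Hypothesis ZW : forall p q : I * J, p.1 = q.1 -> Zv p = Zv q \/ Wv p = Wv q.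

(** The covariance of g0 + z.Aw minus that of z.g + w.h is (1 - z.z')(1 - w.w'): nonnegative on unit
    vectors, and zero as soon as one of the two vectors is shared, which [ZW] grants within a
    row. *)
Lemma gordon_matrix (f : (I * J -> R) -> R) : T3 Kpos f ->
  gEn (m + n) (fun e => f (fun p => dot m (Zv p) e + dot n (Wv p) (fun l => e (m + l)%N))) <=
  gE (fun g0 => gEn (m * n) (fun v => f (fun p => g0 + bil m n (Zv p) v (Wv p)))).
Proof.
move=> T3f.
have := @gordon_comparison R I J f T3f (m * n).+1 (m + n)
  (fun p => Xcoef n (Zv p) (Wv p)) (fun p => Ycoef m (Zv p) (Wv p)).
have covX p q : cov (m * n).+1 (fun p => Xcoef n (Zv p) (Wv p)) p q =
    1 + dot m (Zv p) (Zv q) * dot n (Wv p) (Wv q) by exact: cov_Xcoef.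
have covY p q : cov (m + n) (fun p => Ycoef m (Zv p) (Wv p)) p q =
    dot m (Zv p) (Zv q) + dot n (Wv p) (Wv q) by exact: cov_Ycoef.
move=> H; have := H _ _; move=> {H} H.
have -> : gE (fun g0 => gEn (m * n) (fun v => f (fun p => g0 + bil m n (Zv p) v (Wv p)))) =
    gEn (m * n).+1 (fun w => f (xi (m * n).+1 (fun p => Xcoef n (Zv p) (Wv p)) w)).
  by apply: eq_gE => g0; apply: eq_gEn => v; congr f; apply/funext => p; rewrite /xi sum_Xcoef.
rewrite (_ : gEn (m + n) _ = gEn (m + n) (fun y => f (xi (m + n) (fun p => Ycoef m (Zv p) (Wv p)) y))).
  apply: H => p q; rewrite covX covY.
    by move=> /ZW[] ->; rewrite ?Z1 ?W1; ring.
  have := dot_le1 (Z1 p) (Z1 q); have := dot_le1 (W1 p) (W1 q).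
  by set u := dot _ _ _; set u' := dot _ _ _ => h1 h2; nra.
by apply: eq_gEn => y; congr f; apply/funext => p; rewrite /xi sum_Ycoef.
Qed.

(** Weierstrass' product inequality; the induction also carries that the product stays in [0, 1]. *)
Lemma prod_1sub (K : finType) (x : K -> R) (e : R) : (forall k, 0 <= x k <= 1) ->
  (forall k, x k <= e) -> 1 - #|K|%:R * e <= \prod_k (1 - x k).
Proof.
move=> x01 xe; rewrite -sum1_card natr_sum mulr_suml.
suff [] : 1 - \sum_(k : K) 1 * e <= \prod_k (1 - x k) /\ 0 <= \prod_k (1 - x k) <= 1 by [].
elim/big_rec2: _ => [|k p s _ [IH /andP[p0 p1]]]; first by rewrite subr0 ler01 lexx.
have /andP[xk0 xk1] := x01 k; have := xe k; have := mulr_ge0 xk0 p0.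
rewrite mul1r; split; last by rewrite mulr_ge0 ?subr_ge0//= mulr_ile1 ?subr_ge0// gerBl.
by rewrite mulrBl mul1r; nra.
Qed.

Definition ssum (N : nat) (v : nat -> R) : R := \sum_(i < N) `|v i|.

Lemma SI_ssum N : SI N (ssum N) /\ gEn N (ssum N) = N%:R * gE (fun x : R => `|x|).
Proof.
have H (r : 'I_N) : SI N (fun w : nat -> R => `|w r|) /\ gEn N (fun w => `|w r|) = gE (fun x : R => `|x|).
  have [H1 H2] := @SI_prod R N (fun i x => `|x| ^+ (i == r)) 1 (fun i _ => gint_pow_norm _).
  have E (w : nat -> R) : 1 * \prod_(i < N) `|w i| ^+ (i == r :> nat) = `|w r|.
    by rewrite mul1r (prod_delta (fun i => `|w i|) (ltn_ord r)).
  split; first exact: eq_SI H1.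
  rewrite -(eq_gEn _ E) H2 mul1r (bigD1 r)//= eqxx big1 ?mulr1//.
  by move=> i ir; rewrite -val_eqE/= in ir; rewrite (negbTE ir) gE_cst.
have [H1 H2] := @SI_sum R N _ _ (fun r => (H r).1); split => //.
rewrite /ssum H2 (eq_bigr (fun=> gE (fun x : R => `|x|))); last by move=> r _; exact: (H r).2.
by rewrite sumr_const card_ord mulr_natl.
Qed.

Variables (kap : R) (B : (nat -> R) -> R) (E : set (nat -> R)) (mu : R).
Hypothesis kap0 : 0 < kap.
Hypothesis mu0 : 0 <= mu.
Hypothesis SIB : SI (m + n) B.
Hypothesis B0 : forall e, 0 <= B e.
Hypothesis goodY : forall e, B e < 1 -> forall i, exists j,
  4 * kap <= dot m (Zv (i, j)) e + dot n (Wv (i, j)) (fun l => e (m + l)%N).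
Hypothesis goodX : forall v, (forall i, exists j, kap <= bil m n (Zv (i, j)) v (Wv (i, j))) ->
  ssum (m * n) v * mu < 1 -> E v.

(** Separate levels keep the approximations apart. Where [B < 1], each row of the comparison process
    has an entry at least 4 kap; the logistic cut sits at 3 kap; below 2 kap the complement of the
    logistic is negligible, and 2 kap allows kap for g0 and kap for the bilinear form. The losses
    are the mean of [B], a Chernoff bound for g0 >= kap, Markov's inequality for [ssum], and [eps]
    for the smoothing. *)
Lemma gordon_event (eps : R) : 0 < eps ->
  ((1 - gEn (m + n) B - expR (- (kap ^+ 2 / 2)) - mu * ((m * n)%:R * gE (fun x : R => `|x|)) - eps)%:E
   <= giter (m * n) (fun v => (\1_E v)%:E))%E.
Proof.
move=> eps0.
pose c : R := #|I|%:R + #|J|%:R.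
have c0 : 0 <= c by rewrite addr_ge0.
(* Steep enough that the total smoothing error [c * q] is at most [eps] whatever the sizes of the
   index sets: l kap = c / eps and e^x >= x. *)
pose l := c / eps / kap.
have l0 : 0 <= l by rewrite !mulr_ge0 ?invr_ge0// ltW.
pose q := expR (- (l * kap)).
have q0 : 0 <= q by exact: expR_ge0.
have cq : c * q <= eps.
  rewrite /q expRN ler_pdivrMr ?expR_gt0// mulrC -ler_pdivrMr//.
  apply: le_trans (expR_ge1Dx _); rewrite /l -[c / eps / kap * kap]mulrA mulVf ?gt_eqF// mulr1.
  by rewrite lerDr.
pose f : (I * J -> R) -> R := gfun l (3 * kap).
have T3f : T3 Kpos f by exact: T3_gfun.
have f01 x : 0 <= f x <= 1 := gfun_bnd l (3 * kap) x.
have t01 u : 0 <= tau l (3 * kap) u <= 1.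
  by have /andP[? ?] := tau_bnd l (3 * kap) u; rewrite !ltW.
have tau_small u : 4 * kap <= u -> tau l (3 * kap) u <= q.
  move=> u4; rewrite /tau /q expRN lef_pV2 ?posrE ?expR_gt0 ?addr_gt0 ?expR_gt0//.
  apply: (@le_trans _ _ (expR (l * (u - 3 * kap)))); last by rewrite lerDr.
  by rewrite ler_expR ler_wpM2l//; lra.
have tau_big u : u <= 2 * kap -> 1 - tau l (3 * kap) u <= q.
  move=> u2; have e0 := expR_gt0 (l * (u - 3 * kap)).
  have -> : 1 - tau l (3 * kap) u = expR (l * (u - 3 * kap)) / (1 + expR (l * (u - 3 * kap))).
    by rewrite /tau; field; rewrite gt_eqF// addr_gt0.
  rewrite ler_pdivrMr ?addr_gt0//; apply: (@le_trans _ _ q).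
    by rewrite /q ler_expR -(mulrN l) ler_wpM2l//; have := kap0; lra.
  by rewrite ler_peMr// lerDl ltW.
have fY e : 1 - B e - #|I|%:R * q <= f (fun p => dot m (Zv p) e + dot n (Wv p) (fun l => e (m + l)%N)).
  set y := (fun p => _).
  have [Be|Be] := ltP (B e) 1; last first.
    have /andP[f0 _] := f01 y; apply: le_trans f0.
    have : 0 <= #|I|%:R * q by rewrite mulr_ge0. lra.
  apply: (@le_trans _ _ (1 - #|I|%:R * q)); first by have := B0 e; lra.
  have pt i j : 0 <= tau l (3 * kap) (y (i, j)) <= 1 by exact: t01.
  apply: prod_1sub => i.
    apply/andP; split; first by apply: prodr_ge0 => j _; case/andP: (pt i j).
    by rewrite prodr_ile1// => j _; exact: pt.
  have [j yj] := goodY Be i.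
  rewrite (bigD1 j)//= -[leRHS]mulr1 ler_pM//; first by case/andP: (pt i j).
  - by apply: prodr_ge0 => j' _; case/andP: (pt i j').
  - exact: tau_small.
  - by rewrite prodr_ile1// => j' _; exact: pt.
(* A pointwise minorant of the indicator of [E]: e^(kap g0 - kap^2) is at least 1 when g0 >= kap,
   and its mean is e^(-kap^2/2). *)
have fX g0 v : f (fun p => g0 + bil m n (Zv p) v (Wv p)) - #|J|%:R * q - expR (kap * g0 - kap ^+ 2) -
     mu * ssum (m * n) v <= \1_E v.
  set x := (fun p => _); have /andP[fx0 fx1] := f01 x.
  have s0 : 0 <= mu * ssum (m * n) v by rewrite mulr_ge0// sumr_ge0.
  have e0 : 0 <= expR (kap * g0 - kap ^+ 2) by exact: expR_ge0.
  have j0 : 0 <= #|J|%:R * q by rewrite mulr_ge0.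
  rewrite indicE; have [_|/negP vE] := boolP (v \in E); rewrite /=; first by lra.
  have [s1|s1] := leP 1 (mu * ssum (m * n) v); first by lra.
  have [gk|gk] := leP kap g0.
    have : 1 <= expR (kap * g0 - kap ^+ 2).
      by rewrite -[leLHS]expR0 ler_expR subr_ge0 expr2 ler_wpM2l// ltW.
    lra.
  have [i Hi] : exists i, forall j, bil m n (Zv (i, j)) v (Wv (i, j)) < kap.
    apply: contrapT => /forallNP H; apply: vE; rewrite inE; apply: goodX; last by rewrite mulrC.
    by move=> i; have /existsNP[j /negP] := H i; rewrite -leNgt => ?; exists j.
  suff : f x <= #|J|%:R * q by lra.
  rewrite /f /gfun (bigD1 i)//= -[leRHS]mulr1.
  have p01 i' : 0 <= \prod_j tau l (3 * kap) (x (i', j)) <= 1.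
    apply/andP; split; first by apply: prodr_ge0 => j _; case/andP: (t01 (x (i', j))).
    by rewrite prodr_ile1// => j _; exact: t01.
  apply: ler_pM.
  - by rewrite subr_ge0; case/andP: (p01 i).
  - by apply: prodr_ge0 => i' _; rewrite subr_ge0; case/andP: (p01 i').
  - have := @prod_1sub J (fun j => 1 - tau l (3 * kap) (x (i, j))) q.
    under eq_bigr do rewrite subKr.
    move=> H; rewrite lerBlDr addrC -lerBlDr; apply: H => j.
      by have /andP[? ?] := t01 (x (i, j)); rewrite subr_ge0 gerBl; apply/andP; split.
    by apply: tau_big; rewrite /x; have := Hi j; lra.
  - by apply: prodr_ile1 => i' _; have /andP[? ?] := p01 i'; rewrite subr_ge0 gerBl; apply/andP; split.
have lower : 1 - gEn (m + n) B - #|I|%:R * q <=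
   gE (fun g0 => gEn (m * n) (fun v => f (fun p => g0 + bil m n (Zv p) v (Wv p)))).
  apply: le_trans (gordon_matrix T3f).
  have S1 := SI_cst (m + n) (1 - #|I|%:R * q).
  have SB := SI_scale (-1) SIB; have SS := SI_add S1.1 SB.1.
  rewrite [leLHS](_ : _ = gEn (m + n) (fun e => (1 - #|I|%:R * q) + -1 * B e)); last first.
    by rewrite SS.2 S1.2 SB.2; ring.
  apply: le_gEn; first exact: SS.1.
    have [L L0 fL] := T3_lip T3f.
    have [C C0 HC] := xi_n1 (m + n) (fun p => Ycoef m (Zv p) (Wv p)).
    apply: (@lip_SI R _ _ (L * C)) => e e'; apply: (le_trans (fL _ _)).
    rewrite -mulrA ler_wpM2l//; apply: le_trans (HC e e').
    by rewrite /xi; under [X in _ <= n1 X]eq_fun do rewrite !sum_Ycoef.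
  by move=> e; have := fY e; lra.
set p := giter _ _.
have gi : (forall g0, SI (m * n) (fun v => f (fun p => g0 + bil m n (Zv p) v (Wv p)))) /\
  gint (fun g0 => gEn (m * n) (fun v => f (fun p => g0 + bil m n (Zv p) v (Wv p)))).
  have [L L0 fL] := T3_lip T3f.
  have [C C0 HC] := xi_n1 (m * n).+1 (fun p => Xcoef n (Zv p) (Wv p)).
  have : SI (m * n).+1 (fun w => f (xi (m * n).+1 (fun p => Xcoef n (Zv p) (Wv p)) w)).
    apply: (@lip_SI R _ _ (L * C)) => e e'; apply: (le_trans (fL _ _)).
    by rewrite -mulrA ler_wpM2l//; exact: HC.
  have fE g0 : (fun v => f (xi (m * n).+1 (fun p => Xcoef n (Zv p) (Wv p)) (scons g0 v))) =
      (fun v => f (fun p => g0 + bil m n (Zv p) v (Wv p))).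
    by apply/funext => v; congr f; apply/funext => p'; rewrite /xi sum_Xcoef.
  move=> [H1 H2]; split => [g0|]; first by rewrite -fE; exact: H1.
  by apply: eq_gint H2 => g0; rewrite fE.
(* For each fixed g0 the minorant bounds [p] from below, and [p] does not depend on g0; the average
   over g0 is taken afterwards. *)
have up g0 : ((gEn (m * n) (fun v => f (fun p => g0 + bil m n (Zv p) v (Wv p))) +
   (-1 * (#|J|%:R * q + mu * gEn (m * n) (ssum (m * n))) + - expR (- kap ^+ 2) * expR (kap * g0)))%:E <= p)%E.
  have S1 := SI_cst (m * n) (- (#|J|%:R * q) - expR (kap * g0 - kap ^+ 2)).
  have Ss := SI_scale (- mu) (SI_ssum (m * n)).1.
  have SS := SI_add (SI_add (gi.1 g0) S1.1).1 Ss.1.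
  rewrite [X in (X%:E <= _)%E](_ : _ = gEn (m * n) (fun v => f (fun p => g0 + bil m n (Zv p) v (Wv p)) +
     (- (#|J|%:R * q) - expR (kap * g0 - kap ^+ 2)) + - mu * ssum (m * n) v)); last first.
    by rewrite SS.2 Ss.2 (SI_add (gi.1 g0) S1.1).2 S1.2 expRD; ring.
  apply: gEn_le_giter; first exact: SS.1.
    by move=> v; rewrite lee_fin indicE.
  by move=> v; rewrite lee_fin; have := fX g0 v; lra.
have iE : gint (fun g0 : R => -1 * (#|J|%:R * q + mu * gEn (m * n) (ssum (m * n))) + - expR (- kap ^+ 2) * expR (kap * g0)).
  by apply: gintD; [exact: gint_cst|apply: gintZ; exact: gint_expR].
have pge0 : (0 <= p)%E by apply: giter_ge0 => v; rewrite lee_fin indicE.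
case: p up pge0 => [r up _|_ _|//]; last by rewrite leey.
rewrite lee_fin.
have : gE (fun g0 => gEn (m * n) (fun v => f (fun p => g0 + bil m n (Zv p) v (Wv p))) +
   (-1 * (#|J|%:R * q + mu * gEn (m * n) (ssum (m * n))) + - expR (- kap ^+ 2) * expR (kap * g0))) <= r.
  rewrite -[leRHS](gE_cst r); apply: le_gE; [by apply: gintD; first exact: gi.2|exact: gint_cst|].
  by move=> g0; rewrite -lee_fin; exact: up.
rewrite gED//; last exact: gi.2.
rewrite gED; [|exact: gint_cst|by apply: gintZ; exact: gint_expR].
rewrite gE_cst gEZ; last exact: gint_expR.
rewrite gE_expR (mulNr (expR _)) -expRD (SI_ssum (m * n)).2.
rewrite (_ : - kap ^+ 2 + kap ^+ 2 / 2 = - (kap ^+ 2 / 2)); last by field.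
move: cq; rewrite /c mulrDl; move: lower.
set u := gE _; set e1 := expR _; set e2 := mu * _; lra.
Qed.

End gordon_matrix.

(** * Chernoff bounds for sums of functions of independent normals *)

Section chernoff.
Context {R : realType}.
Implicit Types (phi : R -> R).

Lemma expR_le_quad (y : R) : expR y <= 1 + y + y ^+ 2 * expR `|y|.
Proof.
have dexp (x : R) : is_derive x 1 (@expR R) (expR x) by exact: is_derive_expR.
have ble (x : R) : `|x - 0| <= `|y| -> `|expR x| <= expR `|y|.
  by rewrite subr0 => xy; rewrite ger0_norm ?expR_ge0// ler_expR (le_trans (ler_norm _)).
have b1 (x : R) : `|x - 0| <= `|y| -> `|expR x - 1| <= expR `|y| * `|y|.
  move=> xy; have := @mvt_bound R (@expR R) (@expR R) 0 x (expR `|y|) dexp.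
  rewrite add0r expR0 => H; apply: (le_trans (H _)).
    by move=> z zx; apply: ble; rewrite (le_trans zx)// -(subr0 x).
  by rewrite ler_wpM2l ?expR_ge0// -(subr0 x).
have dg (x : R) : is_derive x 1 (fun x : R => expR x - x) (expR x - 1).
  by apply: is_derive_eq; rewrite /GRing.scale/=; ring.
have := @mvt_bound R _ _ 0 y _ dg b1; rewrite add0r expR0 subr0.
move=> /(le_trans (ler_norm _)).
by rewrite -mulrA -expr2 real_normK ?num_real// mulrC; lra.
Qed.

Definition growth phi := measurable_fun setT phi /\
  exists2 B : R, 0 <= B & forall x, `|phi x| <= B * (1 + x ^+ 2).

Lemma sqr_le_exp (x : R) : 1 + x ^+ 2 <= 16 * expR (x ^+ 2 / 16).
Proof.
by have := expR_ge1Dx (x ^+ 2 / 16); have := sqr_ge0 x; lra.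
Qed.

Lemma growth_gint phi : growth phi -> gint phi.
Proof.
move=> [mphi [B B0 phiB]]; apply: (@gint_le_sqrexp _ _ (B * 16)) => // x.
rewrite (le_trans (phiB x))// -mulrA ler_wpM2l// (le_trans (sqr_le_exp x))//.
by rewrite ler_wpM2l// ler_expR ler_wpM2l ?sqr_ge0// lef_pV2 ?posrE// ler_nat.
Qed.

(** Expand e^y with remainder y^2 e^|y| at y = xi phi(x): a factor xi^2 comes out, and the rest is
    dominated, uniformly in xi, by a multiple of the integrable e^(x^2/4). *)
Lemma chernoff1 phi : growth phi -> exists2 C : R, 0 <= C & exists2 xi0 : R, 0 < xi0 &
  forall xi : R, 0 <= xi <= xi0 -> gint (fun x => expR (xi * phi x)) /\
    gE (fun x => expR (xi * phi x)) <= expR (xi * gE phi + C * xi ^+ 2).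
Proof.
move=> gphi; have iphi := growth_gint gphi; case: gphi => mphi [B B0 phiB].
pose K : R := gE (fun x : R => expR (x ^+ 2 / 4)).
have K0 : 0 <= K by rewrite -[leLHS](gE_cst 0); apply: le_gE; [exact: gint_cst|exact: gint_sqrexp|move=> x; exact: expR_ge0].
pose C1 : R := 256 * B ^+ 2 * expR (1 / 8).
have C10 : 0 <= C1 by rewrite !mulr_ge0 ?exprn_ge0 ?expR_ge0.
exists (C1 * K); first by rewrite mulr_ge0.
have B1 : 0 < 8 * (B + 1) by rewrite mulr_gt0// ltr_wpDl.
(* This range gives xi B <= 1/8, so that e^|xi phi| grows at most like e^(x^2/8), and phi^2 takes up
   another e^(x^2/8). *)
exists (8 * (B + 1))^-1; first by rewrite invr_gt0.
move=> xi /andP[xi0 xi1].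
have xiB : xi * B <= 1 / 8.
  have : xi * (8 * (B + 1)) <= 1 by rewrite -ler_pdivlMr// mul1r.
  by nra.
have bnd x : `|xi * phi x| <= 1 / 8 + x ^+ 2 / 8.
  rewrite normrM (ger0_norm xi0) (le_trans (ler_wpM2l xi0 (phiB x)))// mulrA.
  by have := ler_wpM2r (_ : 0 <= 1 + x ^+ 2) xiB; rewrite addr_ge0 ?sqr_ge0// => /(_ isT); lra.
have rem x : (xi * phi x) ^+ 2 * expR `|xi * phi x| <= xi ^+ 2 * (C1 * expR (x ^+ 2 / 4)).
  rewrite exprMn -mulrA ler_wpM2l ?sqr_ge0//.
  have h1 : phi x ^+ 2 <= B ^+ 2 * (256 * expR (x ^+ 2 / 8)).
    rewrite -real_normK ?num_real//.
    have h2 : `|phi x| <= B * (16 * expR (x ^+ 2 / 16)).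
      by rewrite (le_trans (phiB x))// ler_wpM2l// sqr_le_exp.
    have -> : 256 * expR (x ^+ 2 / 8) = (16 * expR (x ^+ 2 / 16)) ^+ 2.
      rewrite exprMn -expRM_natl; congr (_ * expR _); last by field.
      by rewrite -natrX.
    by rewrite -exprMn lerXn2r// nnegrE// !mulr_ge0// expR_ge0.
  have h3 : expR `|xi * phi x| <= expR (1 / 8) * expR (x ^+ 2 / 8) by rewrite -expRD ler_expR.
  apply: (le_trans (ler_pM (sqr_ge0 _) (expR_ge0 _) h1 h3)).
  have -> : expR (x ^+ 2 / 4) = expR (x ^+ 2 / 8) * expR (x ^+ 2 / 8) by rewrite -expRD; congr expR; field.
  by rewrite /C1 le_eqVlt; apply/orP; left; apply/eqP; ring.
have mexp : measurable_fun setT (fun x => expR (xi * phi x)).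
  by apply: measurableT_comp => //; exact: measurable_funM.
have ie : gint (fun x => expR (xi * phi x)).
  apply: (@gint_le_sqrexp _ _ (expR (1 / 8))) => // x.
  rewrite ger0_norm ?expR_ge0// -expRD ler_expR (le_trans (ler_norm _))// (le_trans (bnd x))//.
  by have := sqr_ge0 x; lra.
split => //.
have i1 := gint_cst (1 : R); have i2 := gintZ xi iphi; have i3 := gintZ (xi ^+ 2) (gintZ C1 (gint_sqrexp (R := R))).
apply: (@le_trans _ _ (gE (fun x => 1 + xi * phi x + xi ^+ 2 * (C1 * expR (x ^+ 2 / 4))))).
  apply: le_gE => //; first by apply: gintD => //; exact: gintD.
  by move=> x; apply: (le_trans (expR_le_quad _)); rewrite lerD2l; exact: rem.
rewrite (gED (gintD i1 i2) i3) (gED i1 i2) gE_cst gEZ// gEZ; last by apply: gintZ; exact: gint_sqrexp.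
rewrite gEZ; last exact: gint_sqrexp.
by apply: le_trans (expR_ge1Dx _); rewrite -/K (mulrC (C1 * K)) addrA.
Qed.

(** The first [m] coordinates of [e] are those of g, the next [n] those of h. *)
Definition stat (pg pS pc : R -> R) (m n : nat) (S : {set 'I_n}) (e : nat -> R) : R :=
  \sum_(k < m) pg (e k) +
  \sum_(l < n) (if l \in S then pS (e (m + l)%N) else pc (e (m + l)%N)).

(** A choice by position, polymorphic so that it selects functions as well as their means; it gives
    [SI_prod] a single family indexed by naturals. *)
Definition kind (T : Type) (pg pS pc : T) (m n : nat) (S : {set 'I_n}) (i : nat) : T :=
  if (i < m)%N then pg
  else if insub (i - m)%N is Some l then (if l \in S then pS else pc) else pc.

Lemma sum_kind (T : Type) (pg pS pc : T) (m n : nat) (S : {set 'I_n}) (F : T -> nat -> R) :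
  \sum_(i < m + n) F (kind pg pS pc m S i) i =
  \sum_(k < m) F pg k + \sum_(l < n) (if l \in S then F pS (m + l)%N else F pc (m + l)%N).
Proof.
rewrite big_split_ord/=; congr (_ + _); apply: eq_bigr => k _; rewrite /kind /=.
  by rewrite ltn_ord.
by rewrite ltnNge leq_addr/= addKn (valK k); case: ifP.
Qed.

Lemma nfloor_itv (a : R) (n : nat) : 0 <= a -> a * n%:R - 1 <= (nfloor a n)%:R <= a * n%:R.
Proof.
move=> a0; have := @truncn_itv _ (a * n%:R); rewrite mulr_ge0// => /(_ isT) /andP[h1 h2].
by rewrite h1 andbT lerBlDr natr1 ltW.
Qed.

Lemma eventually_ge (x : R) : exists N : nat, forall n : nat, (N <= n)%N -> x <= n%:R.
Proof.
exists (Num.truncn x).+1 => n nN; apply: (@le_trans _ _ (Num.truncn x).+1%:R); last by rewrite ler_nat.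
by apply: ltW; exact: truncnS_gt.
Qed.

(** The witness [B] is e^(xi stat) itself: it is below 1 exactly when the statistic is negative, and
    being a product it has a mean that factors. *)
Lemma stat_chernoff (alpha beta : R) (pg pS pc : R -> R) :
  0 < alpha < 1 -> 0 < beta < 1 -> growth pg -> growth pS -> growth pc ->
  alpha * gE pg + beta * gE pS + (1 - beta) * gE pc < 0 ->
  exists2 c : R, 0 < c & exists N : nat, forall n : nat, (N <= n)%N ->
    forall S : {set 'I_n}, #|S| = nfloor beta n ->
    exists B : (nat -> R) -> R, [/\ SI (nfloor alpha n + n) B, forall e, 0 <= B e,
       gEn (nfloor alpha n + n) B <= expR (- (c * n%:R)) &
       forall e, B e < 1 -> stat pg pS pc (nfloor alpha n) S e < 0].
Proof.
move=> /andP[a0 a1] /andP[b0 b1] gg gS gc.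
set mg := gE pg; set mS := gE pS; set mc := gE pc => neg.
(* The negative mean is cut in three: one third pays for the rounding of m and k, one for the
   second-order term C xi^2 (m + n), and one remains as the rate. *)
pose ep := - (alpha * mg + beta * mS + (1 - beta) * mc) / 3.
have ep0 : 0 < ep by rewrite /ep; lra.
have [Cg Cg0 [xg xg0 Hg]] := chernoff1 gg; have [CS CS0 [xS xS0 HS]] := chernoff1 gS.
have [Cc Cc0 [xc xc0 Hc]] := chernoff1 gc.
pose C := Cg + CS + Cc; have C0 : 0 <= C by rewrite !addr_ge0.
pose xi := Num.min (Num.min xg xS) (Num.min xc (ep / (2 * C + 1))).
have C21 : 0 < 2 * C + 1 by lra.
have xi0 : 0 < xi by rewrite !lt_min xg0 xS0 xc0 divr_gt0.
have xig : 0 <= xi <= xg by rewrite ltW//= !ge_min lexx.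
have xiS : 0 <= xi <= xS by rewrite ltW//= !ge_min lexx orbT.
have xic : 0 <= xi <= xc by rewrite ltW//= !ge_min lexx !orbT.
have xiC : 2 * C * xi ^+ 2 <= ep * xi.
  have : xi <= ep / (2 * C + 1) by rewrite !ge_min lexx !orbT.
  rewrite ler_pdivlMr// => h; rewrite expr2 mulrA ler_wpM2r ?(ltW xi0)//.
  by have := ltW xi0; nra.
exists (ep * xi); first by rewrite mulr_gt0.
have [N HN] := eventually_ge ((`|mg| + `|mS| + `|mc|) / ep).
exists N => n nN S cardS; set m := nfloor alpha n; set k := nfloor beta n in cardS.
pose psi i x := expR (xi * kind pg pS pc m S i x).
have ipsi i : gint (psi i).
  rewrite /psi /kind; case: ifP => _; first exact: (Hg xi xig).1.
  case: insubP => [l _ _|_]; last exact: (Hc xi xic).1.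
  by case: ifP => _; [exact: (HS xi xiS).1|exact: (Hc xi xic).1].
have [SB EB] := @SI_prod R (m + n) psi 1 (fun i _ => ipsi i).
exists (fun e => 1 * \prod_(i < m + n) psi i (e i)); split => //.
- by move=> e; rewrite mul1r prodr_ge0// => i _; exact: expR_ge0.
- rewrite EB mul1r.
  apply: (@le_trans _ _ (\prod_(i < m + n) expR (xi * kind mg mS mc m S i + C * xi ^+ 2))).
    apply: ler_prod => i _; apply/andP; split.
      by rewrite -[leLHS](gE_cst 0); apply: le_gE; [exact: gint_cst|exact: ipsi|move=> x; exact: expR_ge0].
    have x2 : 0 <= xi ^+ 2 by exact: sqr_ge0.
    rewrite /psi /kind; case: ifP => _.
      apply: (le_trans (Hg xi xig).2); rewrite ler_expR lerD2l ler_wpM2r// /C; lra.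
    case: insubP => [l _ _|_]; last first.
      by apply: (le_trans (Hc xi xic).2); rewrite ler_expR lerD2l ler_wpM2r// /C; lra.
    case: ifP => _.
      by apply: (le_trans (HS xi xiS).2); rewrite ler_expR lerD2l ler_wpM2r// /C; lra.
    by apply: (le_trans (Hc xi xic).2); rewrite ler_expR lerD2l ler_wpM2r// /C; lra.
  rewrite -expR_sum ler_expR big_split/= sumr_const card_ord -(mulr_natr (C * _)) -mulr_sumr.
  rewrite (sum_kind mg mS mc m S (fun t _ => t)) sumr_const card_ord.
  have -> : \sum_(l < n) (if l \in S then mS else mc) = k%:R * mS + (n%:R - k%:R) * mc.
    rewrite (bigID (mem S))/= (eq_bigr (fun=> mS)); last by move=> l ->.
    rewrite [X in _ + X](eq_bigr (fun=> mc)); last by move=> l /negbTE ->.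
    rewrite !sumr_const cardS -(mulr_natl mS) -(mulr_natl mc); congr (_ + _ * _).
    have -> : #|[pred i | i \notin S]| = #|~: S| by apply: eq_card => i; rewrite !inE.
    have := cardsC S; rewrite cardS card_ord => /(congr1 (fun x => x%:R : R)).
    by rewrite natrD; lra.
  have /andP[m1 m2] := nfloor_itv n (ltW a0); have /andP[k1 k2] := nfloor_itv n (ltW b0).
  rewrite -/m -/k in m1 m2 k1 k2; rewrite -(mulr_natl mg) natrD.
  have n0 : 0 <= n%:R :> R by [].
  have := HN n nN; rewrite ler_pdivrMr// => Hn.
  have bm : `|m%:R - alpha * n%:R| <= 1 by rewrite ler_norml; apply/andP; split; lra.
  have bk : `|k%:R - beta * n%:R| <= 1 by rewrite ler_norml; apply/andP; split; lra.
  have hm : (m%:R - alpha * n%:R) * mg <= `|mg|.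
    by rewrite (le_trans (ler_norm _))// normrM ler_piMl.
  have hS : (k%:R - beta * n%:R) * mS <= `|mS|.
    by rewrite (le_trans (ler_norm _))// normrM ler_piMl.
  have hc : - (k%:R - beta * n%:R) * mc <= `|mc|.
    by rewrite (le_trans (ler_norm _))// normrM normrN ler_piMl.
  have mean : m%:R * mg + (k%:R * mS + (n%:R - k%:R) * mc) <= - (2 * ep * n%:R).
    have : alpha * mg + beta * mS + (1 - beta) * mc = - (3 * ep) by rewrite /ep; field.
    move=> /(congr1 ( *%R n%:R)); lra.
  have := ler_wpM2l (ltW xi0) mean.
  have : C * xi ^+ 2 * (m%:R + n%:R) <= ep * xi * n%:R.
    apply: (@le_trans _ _ (C * xi ^+ 2 * (2 * n%:R))).
      rewrite ler_wpM2l ?(mulr_ge0 C0 (sqr_ge0 xi))//.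
      have : alpha * n%:R <= 1 * n%:R by rewrite ler_wpM2r// ltW.
      lra.
    rewrite (_ : C * xi ^+ 2 * (2 * n%:R) = 2 * C * xi ^+ 2 * n%:R); last by ring.
    by rewrite ler_wpM2r.
  lra.
- move=> e; rewrite mul1r /psi -expR_sum -[ltRHS]expR0 ltr_expR -mulr_sumr.
  rewrite pmulr_rlt0//.
  by rewrite (sum_kind pg pS pc m S (fun p i => p (e i))).
Qed.

End chernoff.

(** * Nets, the cone of descent directions, recovery and failure *)

Section geometry.
Context {R : realType}.

Definition ext (n : nat) (w : 'I_n -> R) (l : nat) : R :=
  if insub l is Some i then w i else 0.

Lemma ext_ord n (w : 'I_n -> R) (i : 'I_n) : ext w i = w i.
Proof. by rewrite /ext (valK i). Qed.

Lemma cauchy_unit n (x w : nat -> R) : dot n w w = 1 -> `|dot n x w| <= Num.sqrt (dot n x x).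
Proof.
move=> w1; rewrite -sqrtr_sqr ler_wsqrtr// -subr_ge0.
have E (s : R) : dot n (fun k => x k - s * w k) (fun k => x k - s * w k) =
    dot n x x - 2 * s * dot n x w + s ^+ 2 * dot n w w.
  rewrite /dot (mulr_sumr _ _ _ (2 * s)) (mulr_sumr _ _ _ (s ^+ 2)) -sumrB -big_split.
  by apply: eq_bigr => k _ /=; ring.
rewrite (_ : _ - _ = dot n (fun k => x k - dot n x w * w k) (fun k => x k - dot n x w * w k)); last first.
  by rewrite E w1; ring.
by apply: sumr_ge0 => k _; rewrite -expr2 sqr_ge0.
Qed.

Lemma unit_entry n (w : nat -> R) (k : 'I_n) : dot n w w = 1 -> `|w k| <= 1.
Proof.
move=> w1; rewrite -(@ler_pXn2r _ 2)// ?nnegrE// expr1n -w1 real_normK ?num_real//.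
rewrite /dot (bigD1 k)//= -expr2 lerDl; apply: sumr_ge0 => i _.
by rewrite -expr2 sqr_ge0.
Qed.

(** The cube is cut into cells of side 1/K and one point of [T] is kept in each cell that meets [T].
    The net lies in [T] itself because unit norm and membership in the cone will be needed at its
    points. *)
Lemma finite_net (n : nat) (T : set ('I_n -> R)) (eta : R) : 0 < eta ->
  (exists w, T w) -> (forall w, T w -> forall i, `|w i| <= 1) ->
  exists (I : finType) (nt : I -> 'I_n -> R), (forall i, T (nt i)) /\
    forall w, T w -> exists i, forall k, `|w k - nt i k| <= eta.
Proof.
move=> eta0 [w0 Tw0] T1.
pose K : nat := (Num.truncn eta^-1).+1.
have K0 : 0 < K%:R :> R by rewrite ltr0n.
have Keta : K%:R^-1 <= eta by rewrite -[leRHS]invrK lef_pV2 ?posrE ?invr_gt0//; apply: ltW; exact: truncnS_gt.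
(* The endpoint 1 has index 2K, hence the successor. *)
pose cell (x : R) : 'I_(2 * K).+1 := inord (Num.truncn (K%:R * (x + 1))).
(* A cell disjoint from [T] receives the default [w0], also a point of [T]. *)
pose nt (g : {ffun 'I_n -> 'I_(2 * K).+1}) : 'I_n -> R :=
  xget w0 [set w | T w /\ forall k, cell (w k) = g k].
exists {ffun 'I_n -> 'I_(2 * K).+1}, nt; split.
  by move=> g; rewrite /nt; case: xgetP => [w _ []|].
move=> w Tw; exists [ffun k => cell (w k)] => k; rewrite /nt.
case: xgetP => [w' _ [Tw' Hw']|/(_ w)[]]; last by split => // j; rewrite ffunE.
have := Hw' k; rewrite ffunE /cell => /(congr1 val).
have cb u : T u -> (Num.truncn (K%:R * (u k + 1)) < (2 * K).+1)%N.
  move=> Tu; have := T1 u Tu k; rewrite ler_norml => /andP[u1 u2].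
  rewrite ltnS -(ler_nat R); apply: (@le_trans _ _ (K%:R * (u k + 1))).
    by rewrite truncn_le mulr_ge0 ?(ltW K0)//; lra.
  by rewrite natrM mulrC ler_wpM2r ?(ltW K0)//; lra.
rewrite /= !inordK ?cb// => E.
have itv u : T u -> (Num.truncn (K%:R * (u k + 1)))%:R <= K%:R * (u k + 1) < (Num.truncn (K%:R * (u k + 1))).+1%:R.
  move=> Tu; have := T1 u Tu k; rewrite ler_norml => /andP[u1 u2].
  by apply: truncn_itv; rewrite mulr_ge0 ?(ltW K0)//; lra.
have /andP[a1 a2] := itv _ Tw; have /andP[b1 b2] := itv _ Tw'.
rewrite E -natr1 in b1 b2; rewrite -natr1 in a2.
apply: le_trans Keta; rewrite -[leRHS]mul1r ler_pdivlMr// -(gtr0_norm K0) -normrM.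
rewrite ler_norml; move: a1 a2 b1 b2; set u := (Num.truncn _)%:R => a1 a2 b1 b2.
by apply/andP; split; lra.
Qed.

Lemma ssum_mul m n (v : nat -> R) : ssum (m * n) v = \sum_(k < m) \sum_(l < n) `|v (k * n + l)%N|.
Proof. exact: (sum_ord_mul m n (fun r => `|v r|)). Qed.

Lemma bil_lipr m n (z v w w' : nat -> R) (eta : R) : (forall k : 'I_m, `|z k| <= 1) ->
  (forall l : 'I_n, `|w l - w' l| <= eta) ->
  `|bil m n z v w - bil m n z v w'| <= eta * ssum (m * n) v.
Proof.
move=> z1 ww; rewrite /bil -sumrB ssum_mul mulr_sumr (le_trans (ler_norm_sum _ _ _))//.
apply: ler_sum => k _; rewrite -sumrB mulr_sumr (le_trans (ler_norm_sum _ _ _))//.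
apply: ler_sum => l _; rewrite -mulrBr !normrM mulrC ler_pM// ?mulr_ge0//.
by rewrite ler_piMl.
Qed.

Lemma bil_lipl m n (z z' v w : nat -> R) (eta : R) : (forall l : 'I_n, `|w l| <= 1) ->
  (forall k : 'I_m, `|z k - z' k| <= eta) ->
  `|bil m n z v w - bil m n z' v w| <= eta * ssum (m * n) v.
Proof.
move=> w1 zz; rewrite /bil -sumrB ssum_mul mulr_sumr (le_trans (ler_norm_sum _ _ _))//.
apply: ler_sum => k _; rewrite -sumrB mulr_sumr (le_trans (ler_norm_sum _ _ _))//.
apply: ler_sum => l _; rewrite -mulrBl -mulrBl !normrM -[leRHS]mulr1 ler_pM ?mulr_ge0//.
by rewrite ler_wpM2r.
Qed.

Definition cone (n : nat) (S : {set 'I_n}) (w : 'I_n -> R) :=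
  (forall i, i \notin S -> 0 <= w i) /\ \sum_i w i <= 0.

(** On nonnegative vectors the l1 norm is the sum of the entries. So for a competitor u of no larger
    norm, u - x lies in the kernel and has nonpositive sum, and it is nonnegative off S, where x
    vanishes. *)
Lemma recovery_of_cone m n (S : {set 'I_n}) (A : 'M[R]_(m, n)) :
  (forall w, cone S w -> (exists i, w i != 0) -> exists k, \sum_l A k l * w l != 0) ->
  recovery_event m S A.
Proof.
move=> H x xS.
have x0 i : 0 <= x i 0.
  by have [/= h1 h2] := xS i; have [/h1/ltW//|/h2 ->] := boolP (i \in S).
split; first by split.
move=> u [Au u0] ux.
have l1E (y : 'cV[R]_n) : (forall i, 0 <= y i 0) -> l1 y = \sum_i y i 0.
  by move=> y0; apply: eq_bigr => i _; rewrite ger0_norm.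
rewrite !l1E// ltNge; apply/negP => sux.
have [||k /eqP] := H (fun i => u i 0 - x i 0).
- split; last by rewrite sumrB subr_le0.
  by move=> i iS; have [_ /(_ iS) ->] := xS i; rewrite subr0.
- apply: contrapT => /forallNP h; apply: ux; apply/matrixP => i j; rewrite ord1.
  by have /negP := h i; rewrite negbK subr_eq0 => /eqP.
apply; under eq_bigr do rewrite mulrBr.
rewrite sumrB; apply/eqP; rewrite subr_eq0; apply/eqP.
by have /matrixP/(_ k 0) := Au; rewrite !mxE.
Qed.

(** Take x constant on S and so large that x + w stays nonnegative; x + w is then feasible with a
    smaller norm. *)
Lemma failure_of_cone m n (S : {set 'I_n}) (A : 'M[R]_(m, n)) (w : 'I_n -> R) :
  (forall i, i \notin S -> 0 <= w i) -> \sum_i w i < 0 ->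
  (forall k, \sum_l A k l * w l = 0) -> failure_event m S A.
Proof.
move=> w0 sw Aw.
pose b : R := 1 + \sum_i `|w i|.
have b0 : 0 < b by rewrite ltr_wpDr// sumr_ge0.
have bw i : - w i <= b.
  rewrite (le_trans (ler_norm _))// normrN /b (bigD1 i)//=.
  by rewrite addrCA lerDl addr_ge0// sumr_ge0.
pose x : 'cV[R]_n := \col_i (if i \in S then b else 0).
exists x; split.
  by move=> i; rewrite mxE; split => [->//|/negbTE ->].
move=> [_ /(_ (\col_i (x i 0 + w i)))] h.
have u0 i : 0 <= x i 0 + w i.
  rewrite mxE; case: ifPn => iS; last by rewrite add0r w0.
  by have := bw i; lra.
have : l1 x < l1 (\col_i (x i 0 + w i)).
  apply: h.
  - split; last by move=> i; rewrite mxE.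
    apply/matrixP => k j; rewrite !mxE.
    under eq_bigr do rewrite mxE mulrDr.
    by rewrite big_split/= Aw addr0 ord1.
  - move=> /matrixP E; have : \sum_i w i = 0.
      by apply: big1 => i _; have := E i 0; rewrite mxE; lra.
    by move=> sw0; rewrite sw0 ltxx in sw.
rewrite /l1 (eq_bigr (fun i => x i 0)); last first.
  by move=> i _; rewrite ger0_norm// mxE; case: ifP => // _; exact: ltW.
rewrite [ltRHS](eq_bigr (fun i => x i 0 + w i)); last first.
  by move=> i _; rewrite mxE ger0_norm.
by rewrite big_split/= ltrDl ltNge ltW.
Qed.

Lemma continuous_bigsum (T : topologicalType) (I : finType) (F : I -> T -> R) :
  (forall i, continuous (F i)) -> continuous (fun x => \sum_i F i x).
Proof.
move=> cF; elim: (index_enum I) => [|i r IH] x.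
  by under eq_fun do rewrite big_nil; exact: cvg_cst.
under eq_fun do rewrite big_cons.
by apply: cvgD; [exact: cF|exact: IH].
Qed.

Section continuity.
Context {T : topologicalType}.
Implicit Types (f g : T -> R).

Lemma continuous_addf f g : continuous f -> continuous g -> continuous (fun x => f x + g x).
Proof. by move=> cf cg x; apply: cvgD; [exact: cf|exact: cg]. Qed.

Lemma continuous_scalef (a : R) f : continuous f -> continuous (fun x => a * f x).
Proof. by move=> cf x; apply: cvgMr; exact: cf. Qed.

Lemma continuous_cstsub (a : R) f : continuous f -> continuous (fun x => a - f x).
Proof. by move=> cf x; apply: cvgB; [exact: cvg_cst|exact: cf]. Qed.

Lemma continuous_sqrtf f : continuous f -> continuous (fun x => Num.sqrt (f x)).
Proof. by move=> cf x; exact: (continuous_comp (cf x) (@sqrt_continuous R _)). Qed.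

Lemma continuous_normf f : continuous f -> continuous (fun x => `|f x|).
Proof. by move=> cf x; exact: (continuous_comp (cf x) (@norm_continuous _ R^o _)). Qed.

Lemma continuous_sqrf f : continuous f -> continuous (fun x => f x ^+ 2).
Proof. by move=> cf x; exact: (continuous_comp (cf x) (@exprn_continuous R 2 _)). Qed.

End continuity.

(* A minimiser of |y - Aw| + kap |w|_1 over the cone has zero residual. *)
Lemma cone_surjective m n (S : {set 'I_n}) (A : 'M[R]_(m, n)) (c : R) (y : 'I_m -> R) :
  0 < c ->
  (forall z : 'I_m -> R, \sum_k z k ^+ 2 = 1 -> exists w, [/\ cone S w,
     (forall l, `|w l| <= 1) & c <= \sum_k z k * \sum_l A k l * w l]) ->
  exists w, cone S w /\ forall k, \sum_l A k l * w l = y k.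
Proof.
move=> c0 H.
(* The penalty makes the functional coercive, so that a minimum exists; kap n <= c/2 keeps its slope
   below half of [c]. *)
pose kap : R := c / 2 / n.+1%:R.
have kap0 : 0 < kap by rewrite !divr_gt0.
have kapn : kap * n%:R <= c / 2.
  by rewrite -mulrA ler_piMr ?divr_ge0 ?ltW// mulrC ltr_pdivrMr// mul1r ltr_nat.
pose act (u : 'rV[R]_n) k := \sum_l A k l * u 0 l.
pose res u := Num.sqrt (\sum_k (y k - act u k) ^+ 2).
pose pen (u : 'rV[R]_n) : R := \sum_l `|u 0 l|.
pose psi u := res u + kap * pen u.
(* Outside the box of radius [r0] the penalty alone exceeds [psi 0], so the minimum over the compact
   part of the cone is global. *)
pose r0 : R := psi 0 / kap + 1.
have psi0 : 0 <= psi 0.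
  by rewrite addr_ge0 ?sqrtr_ge0// mulr_ge0 ?(ltW kap0)// sumr_ge0.
have r00 : 0 <= r0 by rewrite addr_ge0// divr_ge0// ltW.
pose box (i : 'I_n) : set R := if i \in S then `[- r0, r0]%classic else `[0, r0]%classic.
pose K := [set u : 'rV[R]_n | forall i, box i (u ord0 i)] `&` [set u : 'rV[R]_n | \sum_l u 0 l <= 0].
have cco l : continuous (fun u : 'rV[R]_n => u 0 l) by exact: coord_continuous.
have cK : compact K.
  apply: compact_closedI.
    by apply: rV_compact => i; rewrite /box; case: ifP => _; exact: segment_compact.
  apply: (@preimage_closed _ _ (fun u : 'rV[R]_n => \sum_l u 0 l) [set x | x <= 0]); last exact: closed_le.
  by move=> u _; apply: continuous_bigsum.
have cpsi : continuous psi.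
  rewrite /psi /res /pen /act; apply: continuous_addf.
    apply: continuous_sqrtf; apply: continuous_bigsum => k.
    apply: continuous_sqrf; apply: continuous_cstsub.
    by apply: continuous_bigsum => l; apply: continuous_scalef; exact: cco.
  apply: continuous_scalef; apply: continuous_bigsum => l.
  by apply: continuous_normf; exact: cco.
have K0 : K 0.
  split => [i|] /=; last by rewrite big1// => l _; rewrite mxE.
  by rewrite mxE /box; case: ifP => _; rewrite /= in_itv/= ?oppr_le0 r00 ?lexx.
have [wb wbK wmin] := @compact_EVT_min _ R psi K (ex_intro _ 0 K0) cK (continuous_subspaceT cpsi).
have conewb : cone S (fun l => wb 0 l).
  move: wbK; rewrite inE => -[bx sm]; split => // i iS; have := bx i.
  by rewrite /box (negbTE iS) /= in_itv/= => /andP[].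
have gmin (u : 'rV[R]_n) : cone S (fun l => u 0 l) -> psi wb <= psi u.
  move=> [u1 u2]; have [uK|uK] := pselect (K u); first by apply: wmin; rewrite inE.
  have [i ui] : exists i, r0 < `|u 0 i|.
    apply: contrapT => /forallNP h; apply: uK; split => // i.
    have := h i => /negP; rewrite -leNgt ler_norml /box => /andP[h1 h2].
    by case: ifPn => iS; rewrite /= in_itv/= h2 ?h1// u1.
  apply: (@le_trans _ _ (psi 0)); first by apply: wmin; rewrite inE.
  apply: (@le_trans _ _ (kap * r0)).
    by rewrite /r0 mulrDr mulrCA divff ?gt_eqF// mulr1 lerDl mulr1 ltW.
  apply: (@le_trans _ _ (kap * pen u)); last by rewrite /psi lerDr sqrtr_ge0.
  rewrite ler_wpM2l ?(ltW kap0)// (le_trans (ltW ui))// /pen (bigD1 i)//= lerDl.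
  exact: sumr_ge0.
exists (fun l => wb 0 l); split => //.
pose r k := y k - act wb k; pose rho := Num.sqrt (\sum_k r k ^+ 2).
suff rho0 : rho = 0.
  move=> k; have : \sum_k r k ^+ 2 = 0.
    apply/eqP; rewrite -[X in X == _]sqr_sqrtr; first by rewrite -/rho rho0 expr0n.
    by apply: sumr_ge0 => j _; exact: sqr_ge0.
  move=> /eqP; rewrite psumr_eq0; last by move=> j _; exact: sqr_ge0.
  by move=> /allP/(_ k (mem_index_enum _)); rewrite sqrf_eq0 subr_eq0 => /eqP ->.
apply/eqP; rewrite eq_le sqrtr_ge0 andbT leNgt; apply/negP => rho0.
have rr : \sum_k r k ^+ 2 = rho ^+ 2.
  by rewrite sqr_sqrtr//; apply: sumr_ge0 => j _; exact: sqr_ge0.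
(* If the residual were nonzero, the direction attached to r / rho would lower its norm at a rate
   above c/2, while the penalty grows at a rate at most c/2. *)
have [|w [cw w1 zAw]] := H (fun k => r k / rho).
  under eq_bigr do rewrite expr_div_n.
  by rewrite -mulr_suml rr divff// expf_neq0// gt_eqF.
pose Aw k := \sum_l A k l * w l.
have rAw : c * rho <= \sum_k r k * Aw k.
  rewrite -ler_pdivlMr// mulr_suml; apply: (le_trans zAw).
  by rewrite le_eqVlt; apply/orP; left; apply/eqP; apply: eq_bigr => k _; rewrite mulrAC.
pose Q := \sum_k Aw k ^+ 2.
have Q0 : 0 <= Q by apply: sumr_ge0 => k _; exact: sqr_ge0.
(* The first bound gives t Q < c rho, which brings the squared residual below (rho - c t / 2)^2; the
   second keeps rho - c t / 2 positive. *)
pose t := Num.min (c * rho / (2 * (Q + 1))) (rho / c).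
have Q1 : 0 < 2 * (Q + 1) by rewrite mulr_gt0// ltr_wpDl.
have t0 : 0 < t by rewrite lt_min; apply/andP; split; [apply: divr_gt0 => //; exact: mulr_gt0|exact: divr_gt0].
have tQ : t * (2 * (Q + 1)) <= c * rho by rewrite -ler_pdivlMr// ge_min lexx.
have tc : t * c <= rho by rewrite -ler_pdivlMr// ge_min lexx orbT.
pose u : 'rV[R]_n := \row_l (wb 0 l + t * w l).
have cu : cone S (fun l => u 0 l).
  have [wb1 wb2] := conewb; have [cw1 cw2] := cw; split.
    by move=> i iS; rewrite mxE addr_ge0 ?wb1// mulr_ge0 ?(ltW t0)// cw1.
  under eq_bigr do rewrite mxE.
  rewrite big_split/= -mulr_sumr; have := mulr_ge0_le0 (ltW t0) cw2; lra.
have := gmin u cu; apply/negP; rewrite -ltNge /psi.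
have resu : res u < rho - c / 2 * t.
  have bnd0 : 0 <= rho - c / 2 * t by have := mulr_gt0 t0 c0; lra.
  rewrite -[ltRHS](ger0_norm bnd0) -sqrtr_sqr ltr_sqrt; last first.
    by rewrite exprn_gt0//; have := mulr_gt0 t0 c0; lra.
  have -> : \sum_k (y k - act u k) ^+ 2 = rho ^+ 2 - 2 * t * (\sum_k r k * Aw k) + t ^+ 2 * Q.
    rewrite -rr /Q !mulr_sumr -sumrB -big_split; apply: eq_bigr => k _ /=.
    have -> : act u k = act wb k + t * Aw k.
      by rewrite /act /Aw mulr_sumr -big_split; apply: eq_bigr => l _ /=; rewrite mxE; ring.
    by rewrite /r; ring.
  have tt := ltW t0; have := ler_wpM2l tt rAw; have := ler_wpM2l tt tQ.
  have h1 := mulr_gt0 t0 (mulr_gt0 c0 rho0).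
  have h2 := sqr_ge0 (c / 2 * t); have h3 := mulr_ge0 tt Q0; have h4 := mulr_gt0 t0 t0.
  move: h1 h2 h3 h4; set X := \sum_k _.
  by rewrite !expr2; nra.
have penu : pen u <= pen wb + t * n%:R.
  rewrite /pen -[n in n%:R]card_ord -sum1_card natr_sum mulr_sumr -big_split.
  apply: ler_sum => l _ /=; rewrite mxE (le_trans (ler_normD _ _))// lerD2l normrM (gtr0_norm t0).
  by rewrite ler_wpM2l ?(ltW t0).
have := ler_wpM2l (ltW kap0) penu; have := ler_wpM2l (ltW t0) kapn.
have -> : res wb = rho by [].
rewrite mulrDr (mulrCA kap t).
by set a := kap * pen u; set b := kap * pen wb; lra.
Qed.

End geometry.

(** * The error function in terms of the Gaussian tail *)

Section error_function.
Context {R : realType}.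
Implicit Types (a b t u x y c beta theta : R).
Local Notation mu := (@lebesgue_measure R).

Lemma integral_gpdf a b : a <= b ->
  (\int[mu]_(x in `[a, b]) (gpdf x)%:E = (gQ a - gQ b)%:E)%E.
Proof.
move=> ab; pose f x := step a x + (-1) * step b x.
have fi : gint f by apply: gintD; [|apply: gintZ]; exact: gint_step.
have fE : gE f = gQ a - gQ b.
  rewrite gED; [|exact: gint_step|by apply: gintZ; exact: gint_step].
  by rewrite gEZ ?mulN1r//; exact: gint_step.
have f1 x : f x = \1_(`]a, b]%classic) x.
  rewrite /f /step indicE mem_setE in_itv/=.
  case: (ltP a x) => ax /=; last by rewrite ltNge (le_trans ax ab)/= mulr0 addr0.
  by case: ltP => bx /=; ring.
rewrite -fE -gE_EFin// ge0_integral_gamR; last 2 first.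
- exact: measurable_gint.
- by move=> x; rewrite f1.
rewrite -integral_itv_obnd_cbnd; last first.
  by apply/measurable_EFinP; apply: measurable_funTS; exact: measurable_gpdf.
rewrite integral_mkcond; apply: eq_integral => x _; rewrite patchE f1 indicE.
by case: ifPn => _; rewrite ?mul1r ?mul0r.
Qed.

Lemma gQ_le a b : a <= b -> gQ b <= gQ a.
Proof.
move=> ab; rewrite -subr_ge0 -lee_fin -integral_gpdf//.
by apply: integral_ge0 => x _; rewrite lee_fin gpdf_ge0.
Qed.

Lemma gQ_lip a b : a <= b -> gQ a - gQ b <= b - a.
Proof.
move=> ab; rewrite -lee_fin -integral_gpdf//.
apply: (@le_trans _ _ (\int[mu]_(x in `[a, b]) (cst 1) x)%E).
  apply: ge0_le_integral => //.
  - by move=> x _; rewrite lee_fin gpdf_ge0.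
  - by apply/measurable_EFinP; apply: measurable_funTS; exact: measurable_gpdf.
  - move=> x _; rewrite lee_fin gpdfE.
    apply: mulr_ile1 => //; rewrite ?invr_ge0 ?sqrtr_ge0 ?expR_ge0//.
      rewrite invf_le1 ?sqrtr_gt0 ?mulr_gt0 ?pi_gt0// -[leLHS]sqrtr1 ler_wsqrtr//.
      by have := @pi_ge2 R; lra.
    by rewrite -expR0 ler_expR mulNr oppr_le0 divr_ge0 ?sqr_ge0.
rewrite integral_cst//= mul1e lebesgue_measure_itv/= lte_fin.
by case: ltP => // ba; rewrite lee_fin subr_ge0.
Qed.

Lemma continuous_gQ : continuous (gQ : R -> R).
Proof.
move=> x; apply/cvgrPdist_le => e e0; near=> y.
have : `|x - y| <= e by near: y; exact: (@cvgr_dist_le _ _ _ (nbhs x) _ id x cvg_id).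
move=> xy; have [h|h] := leP x y.
  rewrite ger0_norm ?subr_ge0 ?gQ_le// (le_trans (gQ_lip h))//.
  by rewrite (le_trans _ xy)// distrC ler_norm.
rewrite distrC ger0_norm ?subr_ge0 ?gQ_le ?(ltW h)// (le_trans (gQ_lip (ltW h)))//.
by rewrite (le_trans _ xy)// ler_norm.
Unshelve. all: by end_near. Qed.

(** Markov's inequality for e^x: crude, but enough to make the tail small for the intermediate value
    theorem. *)
Lemma gQ_le_exp t : gQ t <= expR (2^-1 - t).
Proof.
have -> : expR (2^-1 - t) = gE (fun x => expR (- t) * expR (1 * x)).
  by rewrite gEZ ?gE_expR; [rewrite -expRD; congr expR; lra|exact: gint_expR].
apply: le_gE; [exact: gint_step|by apply: gintZ; exact: gint_expR|move=> x].
rewrite -expRD mul1r /step; case: ifPn => [tx|_]; last exact: expR_ge0.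
by rewrite -expR0 ler_expR; lra.
Qed.

Lemma gQ_ge_exp t : 1 - expR (2^-1 + t) <= gQ t.
Proof.
have i1 : gint (fun x : R => (- expR t) * expR ((-1) * x)) by apply: gintZ; exact: gint_expR.
have -> : 1 - expR (2^-1 + t) = gE (fun x => 1 + (- expR t) * expR ((-1) * x)).
  rewrite gED//; last exact: gint_cst.
  rewrite gE_cst gEZ ?gE_expR; last exact: gint_expR.
  by rewrite mulNr -expRD; congr (_ - expR _); lra.
apply: le_gE; [by apply: gintD => //; exact: gint_cst|exact: gint_step|move=> x].
rewrite [- expR t * _]mulNr -expRD /step; case: ifPn => [_|]; first by rewrite gerBl expR_ge0.
by rewrite -leNgt => xt; rewrite subr_le0 -[leLHS]expR0 ler_expR; lra.
Qed.

Lemma gQ_surj (p : R) : 0 < p < 1 -> exists t, gQ t = p.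
Proof.
move=> /andP[p0 p1].
(* With M = 1/2 + 1/p + 1/(1 - p) both bounds follow from e^(-1/q) <= q. *)
have [M [M0 Mp Mq]] : exists M : R, [/\ 0 <= M, expR (2^-1 - M) <= p & expR (2^-1 - M) <= 1 - p].
  have key (q : R) : 0 < q -> expR (- q^-1) <= q.
    move=> q0; rewrite expRN -[leRHS]invrK lef_pV2 ?posrE ?expR_gt0 ?invr_gt0//.
    by rewrite (le_trans _ (expR_ge1Dx _))// lerDr.
  exists (2^-1 + p^-1 + (1 - p)^-1); have ip : 0 < p^-1 by rewrite invr_gt0.
  have iq : 0 < (1 - p)^-1 by rewrite invr_gt0; lra.
  split; first lra.
    by rewrite (le_trans _ (key p p0))// ler_expR; lra.
  by rewrite (le_trans _ (key (1 - p) _))//; [rewrite ler_expR; lra|lra].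
have [|||c _ <-] := @IVT R gQ (- M) M p; last by exists c.
- lra.
- exact/continuous_subspaceT/continuous_gQ.
- rewrite ge_min le_max; apply/andP; split; apply/orP.
    by right; rewrite (le_trans (gQ_le_exp M)).
  by left; rewrite (le_trans _ (gQ_ge_exp _))//; lra.
Qed.

Lemma gpdf_sqrt2 u : Num.sqrt (1 / (2 * pi)) * expR (- u ^+ 2) = gpdf (Num.sqrt 2 * u).
Proof.
rewrite gpdfE mul1r sqrtrV ?mulr_ge0 ?pi_ge0//; congr (_ * expR _).
by rewrite exprMn sqr_sqrtr//; field.
Qed.

Lemma Rintegral_gauss a b : a <= b ->
  Rintegral mu [set s : R | a <= s <= b] (fun s => expR (- s ^+ 2)) =
  Num.sqrt pi * (gQ (Num.sqrt 2 * a) - gQ (Num.sqrt 2 * b)).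
Proof.
move=> ab; have s20 : 0 < Num.sqrt 2 :> R by rewrite sqrtr_gt0.
rewrite (_ : [set s | _] = `[a, b]%classic); last by apply/seteqP; split => x; rewrite /= in_itv.
have dF (x : R) : is_derive x 1 (fun y : R => Num.sqrt 2 * y) (Num.sqrt 2).
  by apply: is_derive_eq; rewrite [LHS]mulr1.
have F'E : derive1 (fun y : R => Num.sqrt 2 * y) = cst (Num.sqrt 2).
  by apply/funext => x; rewrite derive1E (@derive_val _ _ _ _ _ _ _ (dF x)).
have cF : continuous (fun y : R => Num.sqrt 2 * y).
  by move=> x; apply: cvgMr; exact: cvg_id.
have := @integration_by_substitution_increasing R (fun y => Num.sqrt 2 * y) gpdf a b ab.
rewrite integral_gpdf ?ler_pM2l// => H.
have {H} : ((gQ (Num.sqrt 2 * a) - gQ (Num.sqrt 2 * b))%:E =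
    \int[mu]_(x in `[a, b]) (((Num.sqrt pi)^-1)%:E * (expR (- x ^+ 2))%:E))%E.
  rewrite H; last 6 first.
  - by move=> x y _ _; rewrite ltr_pM2l.
  - by rewrite F'E => x _; exact: cvg_cst.
  - by rewrite F'E; exact: is_cvg_cst.
  - by rewrite F'E; exact: is_cvg_cst.
  - by split => [x _||]; [case: (dF x)|exact/cvg_at_right_filter/cF|exact/cvg_at_left_filter/cF].
  - by apply: continuous_subspaceT; exact: continuous_gpdf.
  apply: eq_integral => x _; rewrite -EFinM; congr EFin.
  rewrite F'E; change (gpdf (Num.sqrt 2 * x) * Num.sqrt 2 = (Num.sqrt pi)^-1 * expR (- x ^+ 2)).
  rewrite -gpdf_sqrt2 mulrAC.
  congr (_ * _); rewrite mul1r sqrtrV ?mulr_ge0 ?pi_ge0// sqrtrM// invfM mulrAC mulVf ?mul1r//.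
have ci : mu.-integrable `[a, b] (EFin \o (fun x : R => expR (- x ^+ 2))).
  apply: continuous_compact_integrable; first exact: segment_compact.
  apply: continuous_subspaceT => x.
  by apply: continuous_comp; [apply: continuousN; exact: exprn_continuous|exact: continuous_expR].
have sp : Num.sqrt pi != 0 :> R by rewrite gt_eqF ?sqrtr_gt0 ?pi_gt0.
rewrite integralZl// => H; apply: (mulfI (invr_neq0 sp)); rewrite [RHS]mulKf//.
by have := congr1 fine H; rewrite fineM//; last exact: integrable_fin_num.
Qed.

Lemma erfE u : erf u = 1 - 2 * gQ (Num.sqrt 2 * u).
Proof.
have sp : Num.sqrt pi != 0 :> R by rewrite gt_eqF ?sqrtr_gt0 ?pi_gt0.
rewrite /erf; case: ifPn => [u0|]; last rewrite -ltNge => /ltW u0.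
  by rewrite Rintegral_gauss// mulr0 gQ0 mulrA divfK//; field.
by rewrite Rintegral_gauss// mulr0 gQ0 mulrN mulrA divfK//; field.
Qed.

(** [erfinv] picks a preimage, so its defining property follows once one exists: [gQ] takes every
    value in (0, 1), and [erfE] carries this over to [erf]. *)
Lemma gQ_erfinv c beta theta : beta < 1 -> -1 < earg c beta theta < 1 ->
  gQ (Num.sqrt 2 * erfinv (earg c beta theta)) = 1 - c * (1 - theta) / (1 - beta).
Proof.
move=> b1; set y := earg _ _ _ => /andP[y1 y2].
have [t gt] : exists t, gQ t = (1 - y) / 2 by apply: gQ_surj; apply/andP; split; lra.
have : erf (erfinv y) = y.
  apply: (@xgetPex _ 0 [set u | erf u = y]); exists (t / Num.sqrt 2) => /=.
  rewrite erfE [Num.sqrt 2 * _]mulrC divfK ?gt; first lra.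
  by rewrite gt_eqF// sqrtr_gt0.
rewrite erfE => h; have -> : gQ (Num.sqrt 2 * erfinv y) = (1 - y) / 2 by lra.
by rewrite /y /earg; field; rewrite subr_eq0 gt_eqF.
Qed.

(** The square root of E^2 is |E|, so the stated threshold carries |t| where the computation of
    means gives t. *)
Lemma expr_sqrtE (E beta : R) :
  (1 - beta) / Num.sqrt (2 * pi) * (Num.sqrt (2 * E ^+ 2) / expR (E ^+ 2)) =
  `|Num.sqrt 2 * E| * ((1 - beta) * gpdf (Num.sqrt 2 * E)).
Proof.
rewrite (@sqrtrM _ 2 (E ^+ 2))// sqrtr_sqr normrM (ger0_norm (sqrtr_ge0 _)) -expRN -gpdf_sqrt2.
by rewrite mul1r sqrtrV ?mulr_ge0 ?pi_ge0//; ring.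
Qed.

(** With this s the first term of the equation is c1 s, so c1 s is the quantile attached to
    [earg c2]. The last clause serves to compare it with t: as 1 - gQ t > 0, [gQ (c1 * s)] is below
    [gQ t] when c2 > 1 and above it when c2 < 1. *)
Lemma solves_eq_params (c1 c2 beta theta : R) : 0 < beta < 1 -> solves_eq c1 c2 beta theta ->
  let t := Num.sqrt 2 * erfinv (earg 1 beta theta) in
  let s := (1 - beta) * gpdf t / theta in
  [/\ theta = beta + (1 - beta) * gQ t, s * theta = (1 - beta) * gpdf t, 0 < s,
      0 < 1 - gQ t & 1 - gQ (c1 * s) = c2 * (1 - gQ t)].
Proof.
move=> /andP[b0 b1] [/andP[bt t1] r1 r2 eqn] t s.
have th0 : 0 < theta by lra.
have b1' : 1 - beta != 0 by rewrite subr_eq0 gt_eqF.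
have gt : gQ t = 1 - 1 * (1 - theta) / (1 - beta) by exact: gQ_erfinv.
split.
- by rewrite gt; field.
- by rewrite /s divfK// gt_eqF.
- rewrite /s divr_gt0// mulr_gt0 ?subr_gt0// gpdfE.
  by rewrite mulr_gt0 ?expR_gt0// invr_gt0 sqrtr_gt0 mulr_gt0// pi_gt0.
- move: r1; rewrite /earg => /andP[+ _]; rewrite gt; set X := _ / _; lra.
have -> : c1 * s = Num.sqrt 2 * erfinv (earg c2 beta theta).
  by move: eqn; rewrite gpdf_sqrt2 -/t /s; lra.
by rewrite gQ_erfinv// gt; field.
Qed.

End error_function.

(** * From finite families to spheres, and from witnesses to overwhelming probability *)

Section gordon_spheres.
Context {R : realType}.

Lemma dot_lip N (x y z : nat -> R) (eta : R) : (forall k : 'I_N, `|x k - y k| <= eta) ->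
  dot N x z - eta * ssum N z <= dot N y z.
Proof.
move=> xy; rewrite lerBlDr -lerBlDl /dot -sumrB /ssum mulr_sumr; apply: ler_sum => k _.
rewrite -mulrBl (le_trans (ler_norm _))// normrM.
by rewrite ler_wpM2r.
Qed.

Lemma ssum_split m n (e : nat -> R) : ssum (m + n) e = ssum m e + ssum n (fun l => e (m + l)%N).
Proof. by rewrite /ssum big_split_ord. Qed.

Lemma ssum_ge0 N (v : nat -> R) : 0 <= ssum N v.
Proof. exact: sumr_ge0. Qed.

(* A fixed net is enough because [ssum v] and [ssum e] are below [1 / mu] up to
   probability [delta]. *)
Lemma gordon_spheres (a b m n : nat) (X : set ('I_a -> R)) (Y : set ('I_b -> R))
    (Z W : ('I_a -> R) -> ('I_b -> R) -> nat -> R)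
    (kap delta : R) (B : (nat -> R) -> R) (E : set (nat -> R)) :
  0 < kap -> 0 < delta ->
  (exists x, X x) -> (exists y, Y y) ->
  (forall x, X x -> forall i, `|x i| <= 1) -> (forall y, Y y -> forall i, `|y i| <= 1) ->
  (forall x y, X x -> Y y -> dot m (Z x y) (Z x y) = 1 /\ dot n (W x y) (W x y) = 1) ->
  (forall x y y', Z x y = Z x y' \/ W x y = W x y') ->
  (forall x x' y y' (eta : R), 0 < eta -> (forall i, `|x i - x' i| <= eta) ->
     (forall i, `|y i - y' i| <= eta) ->
     forall k, `|Z x y k - Z x' y' k| <= eta /\ `|W x y k - W x' y' k| <= eta) ->
  SI (m + n) B -> (forall e, 0 <= B e) ->
  (forall e, B e < 1 -> forall x, X x -> exists2 y, Y y &
     5 * kap <= dot m (Z x y) e + dot n (W x y) (fun l => e (m + l)%N)) ->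
  (forall v, (forall x, X x -> exists2 y, Y y & kap / 2 <= bil m n (Z x y) v (W x y)) -> E v) ->
  ((1 - gEn (m + n) B - expR (- (kap ^+ 2 / 2)) - delta)%:E
   <= giter (m * n) (fun v => (\1_E v)%:E))%E.
Proof.
move=> kap0 delta0 X0 Y0 X1 Y1 unit ZW lip SIB B0 goodY goodX.
pose g : R := gE (fun x : R => `|x|).
have g0 : 0 <= g.
  by apply: Rintegral_ge0 => x _.
pose M : R := ((m * n)%:R + (m + n)%:R) * g + 1.
have M0 : 0 < M by rewrite ltr_wpDl// mulr_ge0.
(* [mu] times either l1 norm has mean at most delta/3; the last third of delta is left for the
   smoothing. *)
pose mu : R := delta / 3 / M.
have mu0 : 0 < mu by rewrite !divr_gt0.
have muM (N : R) : 0 <= N -> N <= (m * n)%:R + (m + n)%:R -> mu * (N * g) <= delta / 3.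
  move=> N0 Nle; rewrite /mu mulrAC -mulrA ler_piMr//; first by rewrite divr_ge0// ltW.
  rewrite ler_pdivrMr// mul1r /M; have := ler_wpM2r g0 Nle; lra.
(* With l1 norms below 1/mu, one displacement by eta costs at most kap/4: 5 kap stays above 4 kap
   when y is moved, and kap stays above kap/2 when x is moved in both [Z] and [W]. *)
pose eta : R := kap * mu / 4.
have eta0 : 0 < eta by rewrite divr_gt0// mulr_gt0.
have etaS (s : R) : s * mu < 1 -> eta * s <= kap / 4.
  move=> smu; rewrite /eta; have := ltW smu => /(ler_wpM2l (ltW kap0)); lra.
have [I [nx [nxX netX]]] := finite_net eta0 X0 X1.
have [J [ny [nyY netY]]] := finite_net eta0 Y0 Y1.
pose Zv (p : I * J) := Z (nx p.1) (ny p.2); pose Wv (p : I * J) := W (nx p.1) (ny p.2).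
pose B' e := B e + mu * ssum (m + n) e.
have [S1 S2] := SI_scale mu (@SI_ssum R (m + n)).1.
have [S3 S4] := SI_add SIB S1.
have eE : gEn (m + n) B' <= gEn (m + n) B + delta / 3.
  by rewrite S4 S2 (SI_ssum _).2 lerD2l; apply: muM => //; rewrite lerDr.
have dE : mu * ((m * n)%:R * g) <= delta / 3 by apply: muM => //; rewrite lerDl.
have d3 : 0 < delta / 3 by rewrite divr_gt0.
apply: (le_trans _ (@gordon_event R I J m n Zv Wv _ _ _ kap B' E mu kap0 (ltW mu0) S3 _ _ _ (delta / 3) d3)).
- by rewrite lee_fin -/g; lra.
- by move=> p; exact: (unit _ _ (nxX _) (nyY _)).1.
- by move=> p; exact: (unit _ _ (nxX _) (nyY _)).2.
- by move=> [i j] [i' j'] /= ->; exact: ZW.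
- by move=> e; rewrite addr_ge0// mulr_ge0 ?(ltW mu0) ?ssum_ge0.
- move=> e B'e i; have se := ssum_ge0 (m + n) e; have ms := mulr_ge0 (ltW mu0) se.
  have Be : B e < 1 by move: B'e; rewrite /B'; lra.
  have Se : ssum (m + n) e * mu < 1 by move: B'e (B0 e); rewrite /B' mulrC; lra.
  have [y Yy hy] := goodY e Be _ (nxX i); have [j hj] := netY y Yy.
  exists j; rewrite /Zv /Wv /=.
  have xx k : `|nx i k - nx i k| <= eta by rewrite subrr normr0 ltW.
  have H := lip _ _ _ _ _ eta0 xx hj.
  have H1 := @dot_lip m _ _ e eta (fun k : 'I_m => (H k).1).
  have H2 := @dot_lip n _ _ (fun l => e (m + l)%N) eta (fun k : 'I_n => (H k).2).
  have := etaS _ Se; rewrite ssum_split mulrDr; lra.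
- move=> v hv sv; apply: goodX => x Xx; have [i hi] := netX x Xx.
  have [j hj] := hv i; exists (ny j) => //.
  have yy k : `|ny j k - ny j k| <= eta by rewrite subrr normr0 ltW.
  have H := lip _ _ _ _ _ eta0 hi yy.
  have [Zu Wu] := unit _ _ Xx (nyY j); have [Zu' Wu'] := unit _ _ (nxX i) (nyY j).
  have := @bil_lipl R m n _ _ v (W x (ny j)) eta (fun l => unit_entry l Wu) (fun k : 'I_m => (H k).1).
  have := @bil_lipr R m n (Z (nx i) (ny j)) v _ _ eta (fun l => unit_entry l Zu') (fun k : 'I_n => (H k).2).
  have := etaS _ sv; move: hj; rewrite /Zv /Wv /=.
  rewrite !ler_norml; set a1 := bil _ _ _ _ _; set a2 := bil _ _ _ _ _; set a3 := bil _ _ _ _ _.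
  by move=> *; lra.
Qed.

Lemma exp_absorb (c : R) (K : R) : 0 < c -> exists N : nat, forall n : nat, (N <= n)%N ->
  K * expR (- (c * n%:R)) <= expR (- (c / 2 * n%:R)).
Proof.
move=> c0; have [N HN] := eventually_ge (2 * K / c); exists N => n /HN.
rewrite ler_pdivrMr// => h.
have -> : - (c * n%:R) = - (c / 2 * n%:R) - c / 2 * n%:R by lra.
rewrite expRD mulrCA ler_piMr ?expR_ge0// expRN ler_pdivrMr ?expR_gt0// mul1r.
by rewrite (le_trans _ (expR_ge1Dx _))//; lra.
Qed.

(* [Q] holds outside an event whose indicator is dominated by a function [B] of
   exponentially small mean. *)
Definition witnessed (alpha beta : R) (Q : forall n, {set 'I_n} -> (nat -> R) -> Prop) :=
  exists2 c : R, 0 < c & exists N : nat, forall n : nat, (N <= n)%N ->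
    forall S : {set 'I_n}, #|S| = nfloor beta n ->
    exists B : (nat -> R) -> R, [/\ SI (nfloor alpha n + n) B, forall e, 0 <= B e,
       gEn (nfloor alpha n + n) B <= expR (- (c * n%:R)) & forall e, B e < 1 -> Q n S e].

(** Witnesses add: where the sum is below 1, so is each of them. Halving the rate absorbs the factor
    2. *)
Lemma witnessedI (alpha beta : R) (Q1 Q2 : forall n, {set 'I_n} -> (nat -> R) -> Prop) :
  witnessed alpha beta Q1 -> witnessed alpha beta Q2 ->
  witnessed alpha beta (fun n S e => Q1 n S e /\ Q2 n S e).
Proof.
move=> [c1 c10 [N1 H1]] [c2 c20 [N2 H2]]; pose c := Num.min c1 c2.
have c0 : 0 < c by rewrite lt_min c10.
have [N3 H3] := exp_absorb 2 c0.
exists (c / 2); first by rewrite divr_gt0.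
exists (maxn N1 (maxn N2 N3)) => n; rewrite !geq_max => /and3P[n1 n2 n3] S kS.
have [B1 [S1 B10 E1 Q1S]] := H1 n n1 S kS; have [B2 [S2 B20 E2 Q2S]] := H2 n n2 S kS.
exists (fun e => B1 e + B2 e); have [S3 S4] := SI_add S1 S2; split => //.
- by move=> e; rewrite addr_ge0.
- rewrite S4 (le_trans _ (H3 n n3))// (le_trans (lerD E1 E2))//.
  have L (x : R) : c <= x -> expR (- (x * n%:R)) <= expR (- (c * n%:R)).
    by move=> cx; rewrite ler_expR lerN2 ler_wpM2r.
  by have := L c1 _; have := L c2 _; rewrite /c !ge_min !lexx orbT => /(_ isT) h1 /(_ isT) h2; lra.
- by move=> e h; have := B10 e; have := B20 e; split; [apply: Q1S|apply: Q2S]; lra.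
Qed.

(** With kap = c0 sqrt n and delta = e^(-n) the three losses are exponentially small; half of the
    smallest rate absorbs the factor 3. *)
Lemma overwhelming_of_witnessed (alpha beta c0 : R)
    (Q : forall n, {set 'I_n} -> (nat -> R) -> Prop)
    (P : forall (n : nat) (S : {set 'I_n}), set 'M[R]_(nfloor alpha n, n)) :
  0 < c0 -> witnessed alpha beta Q ->
  (exists N : nat, forall n, (N <= n)%N -> forall S : {set 'I_n}, #|S| = nfloor beta n ->
     forall (B : (nat -> R) -> R) (delta : R), 0 < delta ->
     SI (nfloor alpha n + n) B -> (forall e, 0 <= B e) -> (forall e, B e < 1 -> Q n S e) ->
     ((1 - gEn (nfloor alpha n + n) B - expR (- ((c0 * Num.sqrt n%:R) ^+ 2 / 2)) - delta)%:E
       <= gauss_prob (P n S))%E) ->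
  overwhelming alpha beta P.
Proof.
move=> c00 [c1 c10 [N1 H1]] [N2 H2]; pose c := Num.min (Num.min c1 (c0 ^+ 2 / 2)) 1.
have c20 : 0 < c0 ^+ 2 / 2 by rewrite divr_gt0 ?exprn_gt0.
have cc : 0 < c by rewrite !lt_min c10 ltr01 c20.
have [N3 H3] := exp_absorb 3 cc.
exists (c / 2); split; first by rewrite divr_gt0.
exists (maxn N1 (maxn N2 N3)) => n; rewrite !geq_max => /and3P[n1 n2 n3] S kS.
have [B [S1 B0 E1 QS]] := H1 n n1 S kS.
apply: (le_trans _ (H2 n n2 S kS B (expR (- n%:R)) (expR_gt0 _) S1 B0 QS)).
rewrite lee_fin exprMn sqr_sqrtr//.
have L (x : R) : c <= x -> expR (- (x * n%:R)) <= expR (- (c * n%:R)).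
  by move=> cx; rewrite ler_expR lerN2 ler_wpM2r.
have := L c1 _; have := L (c0 ^+ 2 / 2) _; have := L 1 _.
rewrite /c !ge_min !lexx !orbT mul1r -/c => /(_ isT) h1 /(_ isT) h2 /(_ isT) h3.
have := H3 n n3; rewrite (_ : c0 ^+ 2 * _ / 2 = c0 ^+ 2 / 2 * n%:R); last by lra.
lra.
Qed.

End gordon_spheres.

(** * The two thresholds for a fixed support *)

Section weak_threshold.
Context {R : realType}.

Lemma growth_quad (a b c : R) : growth (fun x : R => a * x ^+ 2 + b * x + c).
Proof.
split.
  apply: continuous_measurable_fun => x; apply: cvgD; last exact: cvg_cst.
  by apply: cvgD; apply: cvgMr; [exact: exprn_continuous|exact: cvg_id].
exists (`|a| + `|b| + `|c|); first by rewrite !addr_ge0.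
move=> x; rewrite (le_trans (ler_normD _ _))// (le_trans (lerD (ler_normD _ _) (lexx _)))//.
rewrite (normrM a) (normrM b) (ger0_norm (sqr_ge0 x)).
have x1 : `|x| <= 1 + x ^+ 2.
  by rewrite -[x ^+ 2]real_normK ?num_real//; have := sqr_ge0 (`|x| - 1); nra.
have x0 := sqr_ge0 x; have a0 := normr_ge0 a; have b0 := normr_ge0 b; have c0 := normr_ge0 c.
have := ler_wpM2l b0 x1; have := mulr_ge0 c0 x0; lra.
Qed.

Lemma growth_step (t : R) (f : R -> R) : growth f -> growth (fun x => step t x * f x).
Proof.
move=> [mf [B B0 fB]]; split; first by apply: measurable_funM => //; exact: measurable_step.
exists B => // x; rewrite normrM (ger0_norm (step_ge0 t x)) (le_trans _ (fB x))//.
by rewrite ler_piMl// step_le1.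
Qed.

Lemma growth_addc (c : R) (f : R -> R) : growth f -> growth (fun x => f x + c).
Proof.
move=> [mf [B B0 fB]]; split; first exact: measurable_funD.
exists (B + `|c|); first by rewrite addr_ge0.
move=> x; rewrite (le_trans (ler_normD _ _))// mulrDl lerD//.
by rewrite ler_peMr// lerDl sqr_ge0.
Qed.

Lemma gE_quad (a b c : R) : gE (fun x => a * x ^+ 2 + b * x + c) = a + c.
Proof.
have [i1 e1] := @gE_id R; have [i2 e2] := @gE_sqr R.
have j1 := gintZ b i1; have j2 := gintZ a i2; have j3 := gintD j2 j1.
by rewrite gED//; [rewrite gED// !gEZ// e1 e2 gE_cst; ring|exact: gint_cst].
Qed.

Lemma gE_step_quad (t a b c : R) : gE (fun x => step t x * (a * x ^+ 2 + b * x + c)) =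
  a * (gQ t + t * gpdf t) + b * gpdf t + c * gQ t.
Proof.
have [i1 e1] := @tail_moment1 R t; have [i2 e2] := @tail_moment2 R t; have i3 := @gint_step R t.
have j1 := gintZ b i1; have j2 := gintZ a i2; have j3 := gintZ c i3; have j4 := gintD j2 j1.
rewrite (@eq_gE _ _ (fun x => a * (step t x * x ^+ 2) + b * (step t x * x) + c * step t x)); last first.
  by move=> x; ring.
by rewrite gED// gED// !gEZ// e1 e2.
Qed.

Lemma gE_addc (c : R) (f : R -> R) : growth f -> gE (fun x => f x + c) = gE f + c.
Proof.
by move=> /growth_gint fi; rewrite gED//; [rewrite gE_cst|exact: gint_cst].
Qed.

Definition trunc (t : R) (n : nat) (S : {set 'I_n}) (l : 'I_n) (phi : R -> R) (x : R) :=
  if l \in S then phi x else step t x * phi x.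

(** Subtracting rho from each of the n summands turns the bound into the negativity of a statistic,
    whose mean is known from the truncated moments. *)
Lemma witnessed_sum_lt (alpha beta t a b c rho : R) (f : R -> R) : 0 < alpha < 1 -> 0 < beta < 1 ->
  (forall x, f x = a * x ^+ 2 + b * x + c) ->
  beta * (a + c) + (1 - beta) * (a * (gQ t + t * gpdf t) + b * gpdf t + c * gQ t) < rho ->
  witnessed alpha beta (fun n S e =>
    \sum_(l < n) trunc t S l f (e (nfloor alpha n + l)%N) < rho * n%:R).
Proof.
move=> alpha01 beta01 /funext -> mean; pose g (x : R) : R := a * x ^+ 2 + b * x + c.
have gg : growth g by exact: growth_quad.
have gsg := growth_step t gg.
have g0 : growth (fun _ : R => 0).
  by split => //; exists 0 => // x; rewrite normr0 mul0r.
have [|C C0 [N H]] := stat_chernoff alpha01 beta01 g0 (growth_addc (- rho) gg) (growth_addc (- rho) gsg).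
  rewrite gE_cst (gE_addc _ gg) (gE_addc _ gsg) (_ : gE g = a + c); last exact: gE_quad.
  by rewrite (@gE_step_quad t a b c); lra.
exists C => //; exists N => n nN S kS; have [B [B1 B2 B3 B4]] := H n nN S kS.
exists B; split => // e /B4; rewrite /stat big1// add0r.
rewrite (eq_bigr (fun l : 'I_n => trunc t S l g (e (nfloor alpha n + l)%N) - rho)); last first.
  by move=> l _; rewrite /trunc; case: ifP.
rewrite sumrB sumr_const card_ord -[rho *+ _]mulr_natr subr_lt0.
exact.
Qed.

Lemma witnessed_norm (alpha beta a rho : R) : 0 < alpha < 1 -> 0 < beta < 1 -> a < rho ->
  witnessed alpha beta (fun n S e =>
    a * dot (nfloor alpha n) e e < rho * (nfloor alpha n)%:R).
Proof.
move=> alpha01 beta01 ar.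
have gf : growth (fun x : R => a * x ^+ 2 + 0 * x + (- rho)) by exact: growth_quad.
have g0 : growth (fun _ : R => 0).
  by split => //; exists 0 => // x; rewrite normr0 mul0r.
have [|C C0 [N H]] := stat_chernoff alpha01 beta01 gf g0 g0.
  have /andP[a0 _] := alpha01; rewrite !gE_cst gE_quad !mulr0 !addr0.
  by rewrite pmulr_rlt0// subr_lt0.
exists C => //; exists N => n nN S kS; have [B [B1 B2 B3 B4]] := H n nN S kS.
exists B; split => // e /B4; rewrite /stat [X in _ + X]big1; last by move=> l _; case: ifP.
rewrite addr0 (eq_bigr (fun k : 'I__ => a * (e k * e k) - rho)); last by move=> k _; rewrite mul0r addr0 expr2.
rewrite sumrB -mulr_sumr sumr_const card_ord -[rho *+ _]mulr_natr subr_lt0.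
exact.
Qed.

Definition sphere (n : nat) : set ('I_n -> R) := [set x | \sum_i x i ^+ 2 = 1].

Lemma dot_ext n (x : 'I_n -> R) (h : nat -> R) : dot n (ext x) h = \sum_i x i * h i.
Proof. by apply: eq_bigr => i _; rewrite ext_ord. Qed.

Lemma sphere_dot n (x : 'I_n -> R) : sphere x -> dot n (ext x) (ext x) = 1.
Proof. by move=> <-; rewrite dot_ext; apply: eq_bigr => i _; rewrite ext_ord expr2. Qed.

Lemma sphere_le1 n (x : 'I_n -> R) : sphere x -> forall i, `|x i| <= 1.
Proof. by move=> /sphere_dot/unit_entry h i; rewrite -ext_ord. Qed.

Lemma ext_lip n (x y : 'I_n -> R) (eta : R) : 0 < eta -> (forall i, `|x i - y i| <= eta) ->
  forall k, `|ext x k - ext y k| <= eta.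
Proof.
by move=> eta0 xy k; rewrite /ext; case: insubP => [i _ _//|_]; rewrite subrr normr0 ltW.
Qed.

Lemma sphere_delta n (i0 : 'I_n) (c : R) : c ^+ 2 = 1 -> sphere (fun i => if i == i0 then c else 0).
Proof.
move=> c1; rewrite /sphere/= (bigD1 i0)//= eqxx c1 big1 ?addr0// => i /negbTE ->.
by rewrite expr0n.
Qed.

Lemma sphere_normalize n (x : 'I_n -> R) : 0 < \sum_i x i ^+ 2 ->
  sphere (fun i => x i / Num.sqrt (\sum_i x i ^+ 2)).
Proof.
move=> x0; rewrite /sphere/=; under eq_bigr do rewrite expr_div_n.
by rewrite -mulr_suml sqr_sqrtr ?ltW// divff// gt_eqF.
Qed.

Lemma sphere_attains m (e : nat -> R) : 0 < dot m e e ->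
  exists2 y : 'I_m -> R, sphere y & dot m (ext y) e = Num.sqrt (dot m e e).
Proof.
move=> e0; have eE : \sum_(i < m) e i ^+ 2 = dot m e e by apply: eq_bigr => i _; rewrite expr2.
have := @sphere_normalize m (fun i => e i); rewrite eE => /(_ e0) sy.
exists (fun i : 'I_m => e i / Num.sqrt (dot m e e)) => //.
rewrite dot_ext -{2}(sqr_sqrtr (ltW e0)); under eq_bigr do rewrite mulrAC.
rewrite -mulr_suml -/(dot m e e) -{1}(sqr_sqrtr (ltW e0)) expr2 mulfK//; last first.
  by rewrite gt_eqF// sqrtr_gt0.
by rewrite -expr2 sqrtr_sqr ger0_norm ?sqrtr_ge0.
Qed.

Lemma trunc_sqr t n (S : {set 'I_n}) l (s x : R) :
  trunc t S l (fun x => (x - s) ^+ 2) x = trunc t S l (fun x => x - s) x ^+ 2.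
Proof. by rewrite /trunc /step; case: ifP => _ //; case: ifP => _; ring. Qed.

(** Replacing h by h - s can only increase u.h, as u has nonpositive sum and s >= 0. Off S, where u
    >= 0, the entries with h <= t <= s contribute nonpositively and are dropped. *)
Lemma cone_dot_le t s n (S : {set 'I_n}) (u h : 'I_n -> R) : cone S u -> 0 <= s -> t <= s ->
  \sum_i u i * h i <= \sum_i u i * trunc t S i (fun x => x - s) (h i).
Proof.
move=> [u0 su] s0 ts; apply: (@le_trans _ _ (\sum_i u i * (h i - s))).
  under [leRHS]eq_bigr do rewrite mulrBr.
  by rewrite sumrB -mulr_suml lerDl oppr_ge0 mulr_le0_ge0.
apply: ler_sum => i _; rewrite /trunc; case: ifPn => // iS.
rewrite /step; case: ifPn => [_|]; first by rewrite mul1r.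
by rewrite -leNgt mul0r mulr0 => ht; rewrite mulr_ge0_le0 ?u0//; lra.
Qed.

Lemma bil_mat m n (v : nat -> R) (z : 'I_m -> R) (w : 'I_n -> R) :
  bil m n (ext z) v (ext w) = \sum_k z k * \sum_l mat_of m n v k l * w l.
Proof.
apply: eq_bigr => k _; rewrite ext_ord mulr_sumr; apply: eq_bigr => l _.
by rewrite ext_ord mxE mulrA.
Qed.

Lemma eventually_sizes (alpha beta K : R) : 0 < alpha -> 0 < beta ->
  exists N : nat, forall n : nat, (N <= n)%N ->
    [/\ (0 < n)%N, (0 < nfloor alpha n)%N, (0 < nfloor beta n)%N & K <= n%:R].
Proof.
move=> a0 b0; have [N1 H1] := eventually_ge (2 / alpha).
have [N2 H2] := eventually_ge (2 / beta); have [N3 H3] := eventually_ge K.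
exists (maxn N1 (maxn N2 N3)) => n; rewrite !geq_max => /and3P[/H1 n1 /H2 n2 /H3 n3].
rewrite ler_pdivrMr// mulrC in n1; rewrite ler_pdivrMr// mulrC in n2.
have /andP[m1 _] := nfloor_itv n (ltW a0); have /andP[k1 _] := nfloor_itv n (ltW b0).
split => //; rewrite -(ltr_nat R); [|lra|lra].
by rewrite -(pmulr_rgt0 _ a0); lra.
Qed.

Lemma recovery_whp (alpha beta t s th : R) : 0 < alpha < 1 -> 0 < beta < 1 ->
  th = beta + (1 - beta) * gQ t -> s * th = (1 - beta) * gpdf t -> 0 < s -> t < s ->
  th + t * (s * th) - s ^+ 2 * th < alpha ->
  overwhelming alpha beta (fun n S => recovery_event (nfloor alpha n) S).
Proof.
move=> alpha01 beta01 thE sE s0 ts Falpha.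
have [/andP[a0 a1] /andP[b0 b1]] := (alpha01, beta01).
(* The maximum with 0 makes the levels below positive, so that their square roots behave. *)
pose F := Num.max (th + t * (s * th) - s ^+ 2 * th) 0.
have F0 : 0 <= F by rewrite le_max lexx orbT.
have FF : th + t * (s * th) - s ^+ 2 * th <= F by rewrite le_max lexx.
have Fa : F < alpha by rewrite gt_max Falpha.
(* Levels at quarters of the gap, F < rho1 < rho2 < rho alpha < alpha: rho1 n bounds the truncated
   sum from above, rho m bounds |g|^2 from below, and the room between rho2 and rho alpha absorbs
   the rounding of m. *)
pose rho1 := F + (alpha - F) / 4; pose rho2 := F + (alpha - F) / 2.
pose rho := (F + 3 * (alpha - F) / 4) / alpha.
have rhoa : rho * alpha = F + 3 * (alpha - F) / 4 by rewrite /rho divfK// gt_eqF.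
have rho0 : 0 < rho by rewrite divr_gt0//; lra.
have rho1' : rho < 1 by rewrite ltr_pdivrMr// mul1r; lra.
have W1 : witnessed alpha beta (fun n S e =>
    \sum_(l < n) trunc t S l (fun x => (x - s) ^+ 2) (e (nfloor alpha n + l)%N) < rho1 * n%:R).
  apply: (@witnessed_sum_lt _ _ _ 1 (- 2 * s) (s ^+ 2)) => //; first by move=> x; ring.
  by rewrite /rho1; move: FF sE thE; set q := gQ t; set g := gpdf t; nra.
have W2 := @witnessed_norm alpha beta (-1) (- rho) alpha01 beta01 ltac:(lra).
(* The 5 matches the level 5 kap of [gordon_spheres], where kap = c0 sqrt n. *)
pose c0 := (Num.sqrt rho2 - Num.sqrt rho1) / 5.
have c00 : 0 < c0 by rewrite divr_gt0// subr_gt0 ltr_sqrt /rho1 /rho2; lra.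
apply: (overwhelming_of_witnessed c00 (witnessedI W1 W2)).
have [N HN] := eventually_sizes (4 / (alpha - F)) a0 b0.
exists N => n /HN[n0 m0 k0]; rewrite ler_pdivrMr ?subr_gt0// => dn S kS B delta delta0 SIB B0 good.
have /andP[m1 _] := nfloor_itv n (ltW a0); set m := nfloor alpha n in m0 m1 good SIB *.
have [i0 i0S] : exists i, i \in S by apply/card_gt0P; rewrite kS.
(* Rows are the unit vectors x of -C and columns the unit z: each x needs some z that makes the
   process large. The best z gives |g|, and x.h is at least minus the supremum of w.h over unit w in
   C. *)
apply: (@gordon_spheres R n m m n [set x | sphere x /\ cone S (fun i => - x i)] (@sphere m)
  (fun x y => ext y) (fun x y => ext x) _ delta B [set v | recovery_event m S (mat_of m n v)]) => //.
- by rewrite mulr_gt0// sqrtr_gt0 ltr0n.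
- exists (fun i => if i == i0 then 1 else 0); split; first by apply: sphere_delta; rewrite expr1n.
  split => [i iS|]; first by case: eqP iS => [->|]; rewrite ?i0S ?oppr0.
  by rewrite sumrN oppr_le0; apply: sumr_ge0 => i _; case: ifP.
- by exists (fun i => if i == Ordinal m0 then 1 else 0); apply: sphere_delta; rewrite expr1n.
- by move=> x [/sphere_le1].
- exact: sphere_le1.
- by move=> x y [/sphere_dot ? _] /sphere_dot.
- by right.
- by move=> x x' y y' eta eta0 xx yy k; split; apply: ext_lip.
- move=> e /good[sphi]; rewrite !mulN1r mulNr ltrN2 -/m => gn x [sx cx].
  have rm : rho2 * n%:R <= rho * m%:R.
    have := ler_wpM2l (ltW rho0) m1; rewrite mulrBr mulrA rhoa mulr1 -/m /rho2; lra.
  have gpos : 0 < dot m e e by rewrite (lt_trans _ gn)// mulr_gt0 ?ltr0n.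
  have [y sy ye] := sphere_attains gpos; exists y => //.
  rewrite ye; pose p l := trunc t S l (fun x => x - s) (e (m + l)%N).
  have xh : - Num.sqrt (rho1 * n%:R) <= dot n (ext x) (fun l => e (m + l)%N).
    rewrite dot_ext -lerN2 opprK -sumrN; under eq_bigr do rewrite -mulNr.
    rewrite (le_trans (@cone_dot_le t s n S _ _ cx (ltW s0) (ltW ts)))//.
    have := @cauchy_unit R n (ext p) (ext x) (sphere_dot sx).
    rewrite ler_norml => /andP[+ _]; rewrite !dot_ext.
    under eq_bigr do rewrite ext_ord.
    rewrite [X in _ <= X](eq_bigr (fun i => p i * x i)) => [h|i _]; last by rewrite ext_ord.
    rewrite (_ : \sum_i _ = - \sum_i p i * x i); last first.
      by rewrite -sumrN; apply: eq_bigr => i _; rewrite mulNr mulrC.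
    rewrite lerNl (le_trans _ h)// lerN2 ler_wsqrtr// (le_trans _ (ltW sphi))// le_eqVlt.
    by apply/orP; left; apply/eqP; apply: eq_bigr => i _; rewrite trunc_sqr expr2.
  have : Num.sqrt (rho2 * n%:R) <= Num.sqrt (dot m e e) by rewrite ler_wsqrtr// (le_trans rm)// ltW.
  move: xh; rewrite !sqrtrM ?/rho1 ?/rho2; [|lra|lra].
  by rewrite -/rho1 -/rho2 /c0; lra.
(* A nonzero kernel vector in the cone, normalised and negated, would annihilate the bilinear form
   for every z, against its positive lower bound. *)
- move=> v hv; apply: recovery_of_cone => w cw [i wi].
  apply: contrapT => /forallNP Aw0.
  have w0 : 0 < \sum_i w i ^+ 2.
    rewrite (bigD1 i)//= ltr_wpDr//; last by rewrite exprn_even_gt0.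
    by apply: sumr_ge0 => j _; exact: sqr_ge0.
  set r := Num.sqrt (\sum_i w i ^+ 2).
  have r0 : 0 < r by rewrite sqrtr_gt0.
  have sx := sphere_normalize w0; rewrite -/r in sx.
  have [|y sy] := hv (fun i => - (w i / r)).
    split; first by rewrite /sphere/=; under eq_bigr do rewrite sqrrN.
    have [w1 w2] := cw; split => [j jS|]; first by rewrite opprK divr_ge0 ?w1// ltW.
    by under eq_bigr do rewrite opprK; rewrite -mulr_suml pmulr_lle0 ?invr_gt0.
  rewrite bil_mat big1; first by rewrite leNgt divr_gt0// mulr_gt0// sqrtr_gt0 ltr0n.
  move=> k _; rewrite (_ : \sum_l _ = - r^-1 * \sum_l mat_of m n v k l * w l); last first.
    by rewrite mulr_sumr; apply: eq_bigr => l _; ring.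
  by have /negP := Aw0 k; rewrite negbK => /eqP ->; rewrite !mulr0.
Qed.

Lemma failure_whp (alpha beta t s th : R) : 0 < alpha < 1 -> 0 < beta < 1 ->
  th = beta + (1 - beta) * gQ t -> s * th = (1 - beta) * gpdf t -> 0 < s -> s < t ->
  alpha < th + t * (s * th) - s ^+ 2 * th ->
  overwhelming alpha beta (fun n S => failure_event (nfloor alpha n) S).
Proof.
move=> alpha01 beta01 thE sE s0 st.
have [/andP[a0 a1] /andP[b0 b1]] := (alpha01, beta01).
set F := _ - _ => aF.
have [q0 q1] : 0 <= gQ t /\ gQ t <= 1.
  rewrite -{1}(@gE_cst R 0) -(@gE_cst R 1); split; apply: le_gE; rewrite ?gint_cst ?gint_step//.
  - exact: step_ge0.
  - exact: step_le1.
have [th0 th1] : 0 < th /\ th <= 1 by rewrite thE; split; nra.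
pose d := F - alpha; have d0 : 0 < d by rewrite subr_gt0.
(* The bounds on eps give s' < t, eps^2 <= eps, and a displacement of the two means below by at most
   d/8. *)
pose eps := Num.min (Num.min ((t - s) / 2) 1) (d / (8 * (s + 1))).
have s1 : 0 < s + 1 by lra.
have s8 : 0 < 8 * (s + 1) by rewrite mulr_gt0.
have eps0 : 0 < eps by rewrite !lt_min ltr01 divr_gt0//= ?divr_gt0// subr_gt0.
have e1 : eps <= (t - s) / 2 by rewrite !ge_min lexx.
have e2 : eps <= 1 by rewrite !ge_min lexx orbT.
have e3 : eps * (8 * (s + 1)) <= d by rewrite -ler_pdivlMr// !ge_min lexx orbT.
(* The expected sum of the test vector, per coordinate, is (s - s') th < 0, which leaves room for
   fluctuations; s' < t makes its entries off S nonnegative. *)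
pose s' := s + eps; have s't : s' < t by rewrite /s'; lra.
pose k1 := F - d / 4; pose k2 := F + d / 4; pose rho := (alpha + d / 4) / alpha.
have rhoa : rho * alpha = alpha + d / 4 by rewrite /rho divfK// gt_eqF.
have rho1 : 1 < rho by rewrite ltr_pdivlMr// mul1r; lra.
have dF : d < F by rewrite /d; lra.
(* For the truncated vector p built from h - s', the mean of p.h per coordinate is F - eps s th, and
   that of |p|^2 is F + th eps^2. *)
have m1 : k1 < beta + (1 - beta) * (gQ t + t * gpdf t - s' * gpdf t).
  have -> : beta + (1 - beta) * (gQ t + t * gpdf t - s' * gpdf t) = F - eps * (s * th).
    by rewrite /F /s'; move: sE thE; set g := gpdf t; set q := gQ t; nra.
  by rewrite /k1; have := mulr_ge0 (ltW eps0) (ltW s0); nra.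
have m2 : beta * (1 + s' ^+ 2) +
    (1 - beta) * ((gQ t + t * gpdf t) + (- 2 * s') * gpdf t + s' ^+ 2 * gQ t) < k2.
  have -> : beta * (1 + s' ^+ 2) +
    (1 - beta) * ((gQ t + t * gpdf t) + (- 2 * s') * gpdf t + s' ^+ 2 * gQ t) = F + th * eps ^+ 2.
    transitivity (th * (1 + s' ^+ 2) + (1 - beta) * gpdf t * (t - 2 * s')).
      by rewrite thE; ring.
    by rewrite -sE /F /s'; ring.
  by rewrite /k2; have := mulr_ge0 (ltW eps0) (ltW s0); nra.
have W1 : witnessed alpha beta (fun n S e =>
    \sum_(l < n) trunc t S l (fun x => x - s') (e (nfloor alpha n + l)%N) < 0 * n%:R).
  apply: (@witnessed_sum_lt _ _ _ 0 1 (- s')) => //; first by move=> x; ring.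
  rewrite (_ : _ < 0 = ((1 - beta) * gpdf t - s' * th < 0)); last by congr (_ < _); rewrite thE; ring.
  by rewrite -sE -mulrBl pmulr_llt0// subr_lt0 ltrDl.
have W2 : witnessed alpha beta (fun n S e =>
    \sum_(l < n) trunc t S l (fun x => - (x * (x - s'))) (e (nfloor alpha n + l)%N) < - k1 * n%:R).
  apply: (@witnessed_sum_lt _ _ _ (- 1) s' 0) => //; first by move=> x; ring.
  by move: m1; lra.
have W3 : witnessed alpha beta (fun n S e =>
    \sum_(l < n) trunc t S l (fun x => (x - s') ^+ 2) (e (nfloor alpha n + l)%N) < k2 * n%:R).
  apply: (@witnessed_sum_lt _ _ _ 1 (- 2 * s') (s' ^+ 2)) => //; first by move=> x; ring.
  by move: m2; lra.
have W4 := @witnessed_norm alpha beta 1 rho alpha01 beta01 rho1.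
have k10 : 0 < k1 by rewrite /k1; lra.
have k20 : 0 < k2 by rewrite /k2; lra.
have sk2 : 0 < Num.sqrt k2 by rewrite sqrtr_gt0.
pose c0 := (k1 / Num.sqrt k2 - Num.sqrt (rho * alpha)) / 5.
(* With alpha + d/4 = F - 3d/4, the difference (F - d/4)^2 - (F + d/4)(F - 3d/4) is d^2/4 > 0, so k1
   / sqrt k2 exceeds sqrt(rho alpha). *)
have c00 : 0 < c0.
  rewrite divr_gt0// subr_gt0 ltr_pdivlMr// -sqrtrM; last by rewrite rhoa; lra.
  rewrite -[ltRHS](gtr0_norm k10) -sqrtr_sqr ltr_sqrt ?exprn_gt0// rhoa.
  by rewrite /k1 /k2 (_ : alpha = F - d); [nra|rewrite /d; lra].
apply: (overwhelming_of_witnessed c00 (witnessedI (witnessedI W1 W2) (witnessedI W3 W4))).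
have [N HN] := eventually_sizes 0 a0 b0.
exists N => n /HN[n0 m0 k0 _] S kS B delta delta0 SIB B0 good.
have /andP[_ mle] := nfloor_itv n (ltW a0); set m := nfloor alpha n in m0 mle good SIB *.
have [i0 i0S] : exists i, i \in S by apply/card_gt0P; rewrite kS.
have rn0 : 0 < n%:R :> R by rewrite ltr0n.
have sn0 : 0 < Num.sqrt n%:R :> R by rewrite sqrtr_gt0.
(* The roles are exchanged: rows are the unit z and columns the unit w in the cone. The normalised
   truncated vector serves every z, since z.g >= -|g|. *)
apply: (@gordon_spheres R m n m n (@sphere m) [set w | sphere w /\ cone S w]
  (fun x y => ext x) (fun x y => ext y) _ delta B [set v | failure_event m S (mat_of m n v)]) => //.
- by rewrite mulr_gt0.
- by exists (fun i => if i == Ordinal m0 then 1 else 0); apply: sphere_delta; rewrite expr1n.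
- exists (fun i => if i == i0 then - 1 else 0); split; first by apply: sphere_delta; rewrite sqrrN expr1n.
  split => [i iS|]; first by case: eqP iS => [->|]; rewrite ?i0S.
  by apply: sumr_le0 => i _; case: ifP => // _; rewrite oppr_le0.
- exact: sphere_le1.
- by move=> x [/sphere_le1].
- by move=> x y /sphere_dot ? [/sphere_dot].
- by left.
- by move=> x x' y y' eta eta0 xx yy k; split; apply: ext_lip.
- move=> e /good[[]]; rewrite mul0r mulNr mul1r => sp hp [pp gn] z sz.
  pose p l := trunc t S l (fun x => x - s') (e (m + l)%N).
  have {}hp : k1 * n%:R < \sum_l p l * e (m + l)%N.
    rewrite -ltrN2 (le_lt_trans _ hp)// -sumrN le_eqVlt; apply/orP; left; apply/eqP.
    by apply: eq_bigr => l _; rewrite /p /trunc; case: ifP => _; ring.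
  have {}pp : \sum_l p l ^+ 2 < k2 * n%:R.
    by rewrite (le_lt_trans _ pp)// le_eqVlt; apply/orP; left; apply/eqP; apply: eq_bigr => l _; rewrite trunc_sqr.
  have p0 : 0 < \sum_l p l ^+ 2.
    rewrite lt_neqAle sumr_ge0 ?andbT; last by move=> l _; exact: sqr_ge0.
    apply/eqP => /esym/eqP; rewrite psumr_eq0; last by move=> l _; exact: sqr_ge0.
    move=> /allP p0; move: hp; rewrite big1; first by rewrite ltNge mulr_ge0 ?(ltW k10) ?(ltW rn0).
    by move=> l _; have := p0 l (mem_index_enum _); rewrite sqrf_eq0 => /eqP ->; rewrite mul0r.
  set r := Num.sqrt (\sum_l p l ^+ 2); have r0 : 0 < r by rewrite sqrtr_gt0.
  exists (fun l => p l / r).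
    split; first exact: sphere_normalize.
    split => [l lS|]; last by rewrite -mulr_suml pmulr_lle0 ?invr_gt0// ltW.
    rewrite divr_ge0 ?(ltW r0)// /p /trunc (negbTE lS) /step; case: ifPn => [tx|_]; last by rewrite mul0r.
    by rewrite mul1r; lra.
  have zg : - Num.sqrt (rho * alpha * n%:R) <= dot m (ext z) e.
    have := @cauchy_unit R m e (ext z) (sphere_dot sz); rewrite ler_norml => /andP[+ _].
    rewrite /dot; under [X in _ <= X]eq_bigr do rewrite mulrC.
    apply: le_trans; rewrite lerN2 ler_wsqrtr// (le_trans (ltW gn))// -mulrA ler_wpM2l//.
    by rewrite ltW// (lt_trans ltr01).
  have wh : k1 / Num.sqrt k2 * Num.sqrt n%:R <= dot n (ext (fun l => p l / r)) (fun l => e (m + l)%N).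
    rewrite dot_ext; under eq_bigr do rewrite mulrAC.
    rewrite -mulr_suml ler_pdivlMr//.
    have rle : r <= Num.sqrt k2 * Num.sqrt n%:R.
      by rewrite -sqrtrM ?(ltW k20)// ler_wsqrtr// ltW.
    apply: (le_trans _ (ltW hp)).
    apply: (@le_trans _ _ (k1 / Num.sqrt k2 * Num.sqrt n%:R * (Num.sqrt k2 * Num.sqrt n%:R))).
      by rewrite ler_wpM2l// mulr_ge0 ?(ltW sn0)// divr_ge0 ?(ltW k10)// ltW.
    rewrite mulrACA divfK ?gt_eqF// -expr2 sqr_sqrtr//.
  move: zg; rewrite sqrtrM; last by rewrite rhoa; lra.
  by move: wh; rewrite /c0; lra.
- move=> v hv; pose A := mat_of m n v.
  have c20 : 0 < c0 * Num.sqrt n%:R / 2 by rewrite divr_gt0// mulr_gt0.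
  (* Solving Aw = A 1_S in the cone gives the kernel vector w - 1_S: it is nonnegative off S and its
     sum is at most -|S| < 0. *)
  have [|w [[w0 sw] Aw]] := @cone_surjective R m n S A _ (fun k => \sum_l A k l * (l \in S)%:R) c20.
    move=> z sz; have [w [sw cw]] := hv z sz; rewrite bil_mat => h.
    by exists w; split => //; exact: sphere_le1.
  apply: (@failure_of_cone R m n S A (fun l => w l - (l \in S)%:R)).
  - by move=> i iS; rewrite (negbTE iS) subr0 w0.
  - rewrite sumrB; apply: (@le_lt_trans _ _ (0 - \sum_l (l \in S)%:R)); first by rewrite lerD2r.
    rewrite sub0r oppr_lt0 (bigD1 i0)//= i0S ltr_pwDl// sumr_ge0//.
  - move=> k; under eq_bigr do rewrite mulrBr.
    by rewrite sumrB Aw subrr.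
Qed.

End weak_threshold.

Theorem theorem5 (R : realType) (alpha beta : R)
  (e1c e2c e1m e1g e3g : R) :
  0 < alpha < 1 -> 0 < beta < 1 ->
  0 < e1c < 1 -> 0 < e2c < 1 -> 0 < e1m < 1 -> 0 < e1g < 1 -> 0 < e3g < 1 ->
  (* part (1) *)
  (forall theta : R,
     solves_eq (1 - e1c) (1 + e1c) beta theta ->
     (forall theta' : R, solves_eq (1 - e1c) (1 + e1c) beta theta' -> theta' = theta) ->
     let E := erfinv (earg 1 beta theta) in
     let G := (1 - beta) * Num.sqrt (1 / (2 * pi)) * expR (- E ^+ 2) in
     (1 - beta) / Num.sqrt (2 * pi) * (Num.sqrt (2 * E ^+ 2) / expR (E ^+ 2))
       + theta - G ^+ 2 / theta < alpha ->
     overwhelming alpha beta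
       (fun n S => recovery_event (nfloor alpha n) S)) /\
  (* part (2) *)
  (forall theta : R,
     solves_eq (1 + e2c) (1 - e2c) beta theta ->
     (forall theta' : R, solves_eq (1 + e2c) (1 - e2c) beta theta' -> theta' = theta) ->
     let E := erfinv (earg 1 beta theta) in
     let G := (1 - beta) * Num.sqrt (1 / (2 * pi)) * expR (- E ^+ 2) in
     alpha < 1 / (1 + e1m) ^+ 2 *
       ((1 - e1g) * (theta + (1 - beta) / Num.sqrt (2 * pi)
                              * (Num.sqrt (2 * E ^+ 2) / expR (E ^+ 2)))
        - (1 + e3g) ^+ 2 * (G ^+ 2 / theta)) ->
     overwhelming alpha beta
       (fun n S => failure_event (nfloor alpha n) S)).
Proof.
move=> alpha01 beta01 /andP[e1 _] /andP[e2 _] /andP[em _] /andP[eg1 _] /andP[eg3 _].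
have ltQ (x y : R) : gQ y < gQ x -> x < y.
  by apply: contraTT; rewrite -!leNgt; exact: gQ_le.
split=> theta sol _ E G; have /andP[b0 b1] := beta01.
- have [thE sE s0 p0 eqn] := solves_eq_params beta01 sol.
  have /andP[bt _] : beta <= theta <= 1 by case: sol.
  have th0 : 0 < theta := lt_le_trans b0 bt.
  rewrite expr_sqrtE -/E; move: thE sE s0 p0 eqn; rewrite -/E.
  set t := Num.sqrt 2 * E; set s := _ / theta => thE sE s0 p0 eqn.
  have -> : G = s * theta by rewrite sE /G -mulrA gpdf_sqrt2.
  (* The equation gives 1 - gQ ((1 - e1c) s) = (1 + e1c)(1 - gQ t) > 1 - gQ t, hence t < (1 - e1c)
     s. *)
  have ts : t < s.
    have : t < (1 - e1c) * s by apply: ltQ; nra.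
    by nra.
  rewrite -sE => Ha; apply: (recovery_whp alpha01 beta01 thE sE s0 ts).
  apply: le_lt_trans Ha.
  have -> : (s * theta) ^+ 2 / theta = s ^+ 2 * theta by field; rewrite gt_eqF.
  (* Here t may be negative; the stated threshold has |t| >= t, so the assumption on alpha is at
     least as strong. *)
  rewrite lerD2r [leRHS]addrC lerD2l ler_wpM2r ?ler_norm//.
  by rewrite mulr_ge0// ltW.
- have [thE sE s0 p0 eqn] := solves_eq_params beta01 sol.
  have /andP[bt _] : beta <= theta <= 1 by case: sol.
  have th0 : 0 < theta := lt_le_trans b0 bt.
  rewrite expr_sqrtE -/E; move: thE sE s0 p0 eqn; rewrite -/E.
  set t := Num.sqrt 2 * E; set s := _ / theta => thE sE s0 p0 eqn.
  have -> : G = s * theta by rewrite sE /G -mulrA gpdf_sqrt2.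
  have ts : (1 + e2c) * s < t by apply: ltQ; nra.
  have st : s < t by nra.
  (* Now t > s > 0, so |t| is t. *)
  rewrite -sE (ger0_norm (ltW (lt_trans s0 st))) => Ha.
  apply: (failure_whp alpha01 beta01 thE sE s0 st).
  move: Ha; rewrite (_ : (s * theta) ^+ 2 / theta = s ^+ 2 * theta); last by field; rewrite gt_eqF.
  have /andP[a0 _] := alpha01.
  have : 0 < t * (s * theta) by apply: mulr_gt0; [exact: lt_trans st|exact: mulr_gt0].
  have : 0 < s ^+ 2 * theta by rewrite mulr_gt0 ?exprn_gt0.
  set X := t * _; set Y := s ^+ 2 * _ => Y0 X0.
  (* The remaining epsilons only lower the bound: multiplied by (1 + e1m)^2 > 1, the assumption
     implies alpha < theta + X - Y. *)
  have K1 : 1 < (1 + e1m) ^+ 2 by rewrite expr2; nra.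
  have K2 : 1 < (1 + e3g) ^+ 2 by rewrite expr2; nra.
  rewrite mul1r mulrC ltr_pdivlMr; last exact: lt_trans K1.
  by nra.
Qed.
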